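(* Let $W$ be the group $G_{25}$ or $G_{32}$ (Shephard–Todd notation). (1) The algebra $\mathrm{Br}(W)$ is not a free $\mathcal A$-module. (2) If $R$ is a proper ring for $W$ in which $\mu^6=1$, then $\mathrm{Br}^R(W)$ is a free $R$-module with basis $\{we_B\mid B\in\mathcal C^K_{adm},\ w\in W/K_B\}$, where $K=\mathrm{Frac}(R)$ and $W/K_B$ denotes a set of left coset representatives of $K_B$ in $W$.
   Context: All modules over $K$ are finite dimensional. The groups and $\mu$. $G_{25}\subseteq GL(\mathbb C^3)$ is generated by the order $3$ unitary reflections with hyperplanes $z_i=0$ ($i=1,2,3$) and $z_1+\zeta^\kappa z_2+\zeta^\lambda z_3=0$ ($\kappa,\lambda\in\{0,1,2\}$, $\zeta=e^{2\pi i/3}$). $G_{32}$ is the rank $4$ group of that name in the Shephard–Todd classification. For $W=G_{25}$ or $G_{32}$ all reflections have order $3$ and there are exactly two conjugacy classes of reflections: the distinguished ones (those acting by $e^{2\pi i/3}$ on the orthogonal complement of their hyperplane) and their inverses; let $\mu_1,\mu_2$ be the respective parameters $\mu_s$ of these classes, and $\mu:=\mu_1/\mu_2$. Complex reflection groups. A reflection of $V_W$ is an $r\in GL(V_W)$ such that $H_r:=\ker(r-1)$ has codimension $1$; $H_r$ is its reflecting hyperplane. $\mathcal R$ is the set of reflections in $W\subseteq GL(V_W)$ and $\mathcal H$ the set of their reflecting hyperplanes. $W$ acts on $\mathcal H$ by $wH=w(H)$ and on $\mathcal R$ by conjugation; $\sim$ denotes conjugacy. $\mathcal R_{a\to b}$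 is the set of $s\in\mathcal R$ with $sa=b$. Distinct $H_1,H_2\in\mathcal H$ are transverse, $H_1\pitchfork H_2$, if they are the only elements of $\mathcal H$ containing $H_1\cap H_2$; $H_1\not\pitchfork H_2$ means distinct and not transverse. A transverse collection is a (possibly empty) set of pairwise transverse elements of $\mathcal H$; $\mathcal C$ is the set of all of them, with the induced $W$-action. $\mathrm{Stab}(B)=\{w\in W: wB=B\}$. Brauer-Chen algebra. Let $\delta,\mu_s$ ($s\in\mathcal R$) be indeterminates, $\underline\mu=\{\mu_s\}$, and $\mathcal A=\mathbb Z[\underline\mu^{\pm1},\delta^{\pm1}]/(\mu_s-\mu_{s'}\mid s\sim s')$. $\mathrm{Br}(W)$ is the $\mathcal A$-algebra generated by the elements of $W$ (with the group relations) and elements $e_H$, $H\in\mathcal H$, with relations: (B1) $e_H^2=\delta e_H$; (B2) $we_Hw^{-1}=e_{wH}$; (B3) $we_H=e_H$ if $H\subseteq\ker(w-1)$; (B4) $e_{H_1}e_{H_2}=e_{H_2}e_{H_1}$ if $H_1\pitchfork H_2$; (B5) $e_{H_1}e_{H_2}=\sum_{s\in\mathcal R_{H_2\to H_1}}\mu_s s\,e_{H_2}$ if $H_1\not\pitchfork H_2$. For an $\mathcal A$-algebra $R$, $\mathrm{Br}^R(W)=R\otimes_{\mathcal A}\mathrm{Br}(W)$. For $B\in\mathcal C$, $e_B=\prod_{H\in B}e_H$ ($e_\emptyset=1$). Proper rings. A (commutative) $\mathcal A$-algebra $R$ is proper for $W$ if $R$ is a domain of characteristic $0$; $\mathrm{Frac}(R)$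 has a subfield $k_R$ containing the images of $\underline\mu$ over which every subgroup of $W$ splits; $\delta$ is transcendental over $k_R$ and $\mathrm{Frac}(R)$ is a finite extension of $k_R(\delta)$. A proper field is a proper $R$ that is a field. Admissibility. For $B\in\mathcal C$ and a $K\mathrm{Stab}(B)$-module $V$, let $\hat V$ be the image of $V$ in $\mathrm{Ind}_{K\mathrm{Stab}(B)}^{KW}V$. The pair $(B,V)$ is admissible if $\mathrm{Ann}_{KW}(e_B)\cdot\hat V=0$, where $\mathrm{Ann}_{KW}(e_B)=\{x\in KW: xe_B=0\text{ in }\mathrm{Br}^K(W)\}$. $B$ is $K$-admissible if $(B,V)$ is admissible for some $V\neq0$; $\mathcal C^K_{adm}$ is the set of $K$-admissible $B\in\mathcal C$ (it contains $\emptyset$). The group $K_B$. Let $\mathcal R_B=\{r\in\mathcal R: H_r\in B\}$. $K_B$ is the subgroup of $\mathrm{Stab}(B)$ generated by $\mathcal R_B$ and all products $s_2^{-1}s_1$ with $s_1,s_2\in\mathcal R$ such that $s_1B=s_2B\ne B$ and $s_1H\neq s_2H$ for all $H\in B\setminus s_1B$. For $B=\emptyset$, $K_B=1$. *)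

(* Defs.v *)
From HB Require Import structures.
From mathcomp Require Import all_boot all_order all_algebra all_fingroup.
From mathcomp Require Import mxrepresentation.
From mathcomp Require Import boolp.

Set Implicit Arguments.
Unset Strict Implicit.
Unset Printing Implicit Defensive.

Import GRing.Theory Num.Theory.
Local Open Scope ring_scope.
Local Open Scope quotient_scope.

(* Algebras by generators and relations.  [presAlg rel] is the unital        *)
(* associative R-algebra generated by X subject to [rel]: the quotient of    *)
(* formal expressions by the least congruence containing [rel] and the       *)
(* R-algebra axioms.  It is turned into a type by classical choice.          *)

Inductive term (R : comPzRingType) (X : Type) : Type :=
| Cst of R
| Gen of X
| Add of term R X & term R X
| Mul of term R X & term R X.
Arguments Cst {R X} _.
Arguments Gen {R X} _.

HB.instance Definition _ (R : comPzRingType) (X : Type) :=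
  gen_eqMixin (term R X).
HB.instance Definition _ (R : comPzRingType) (X : Type) :=
  gen_choiceMixin (term R X).

Section Presented.
Variables (R : comPzRingType) (X : Type).
Variable rel : term R X -> term R X -> Prop.

Inductive pcong : term R X -> term R X -> Prop :=
| pcong_refl t : pcong t t
| pcong_sym t u : pcong t u -> pcong u t
| pcong_trans t u v : pcong t u -> pcong u v -> pcong t v
| pcong_Add t t' u u' :
    pcong t t' -> pcong u u' -> pcong (Add t u) (Add t' u')
| pcong_Mul t t' u u' :
    pcong t t' -> pcong u u' -> pcong (Mul t u) (Mul t' u')
| pcong_addA t u v : pcong (Add t (Add u v)) (Add (Add t u) v)
| pcong_addC t u : pcong (Add t u) (Add u t)
| pcong_add0 t : pcong (Add (Cst 0) t) t
| pcong_mulA t u v : pcong (Mul t (Mul u v)) (Mul (Mul t u) v)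
| pcong_mul1 t : pcong (Mul (Cst 1) t) t
| pcong_mulDl t u v : pcong (Mul (Add t u) v) (Add (Mul t v) (Mul u v))
| pcong_mulDr t u v : pcong (Mul t (Add u v)) (Add (Mul t u) (Mul t v))
| pcong_CstD a b : pcong (Cst (a + b)) (Add (Cst a) (Cst b))
| pcong_CstM a b : pcong (Cst (a * b)) (Mul (Cst a) (Cst b))
| pcong_CstC a t : pcong (Mul (Cst a) t) (Mul t (Cst a))
| pcong_mul0 t : pcong (Mul (Cst 0) t) (Cst 0)
| pcong_rel t u : rel t u -> pcong t u.

Definition peq (t u : term R X) : bool := `[< pcong t u >].

Lemma peq_refl : reflexive peq.
Proof. by move=> t; apply/asboolP; exact: pcong_refl. Qed.
Lemma peq_sym : symmetric peq.
Proof. by move=> t u; apply: asbool_equiv_eq; split=> /pcong_sym. Qed.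
Lemma peq_trans : transitive peq.
Proof.
move=> u t v /asboolP tu /asboolP uv; apply/asboolP; exact: pcong_trans uv.
Qed.

Canonical peq_equiv := EquivRel peq peq_refl peq_sym peq_trans.

Definition presAlg := {eq_quot peq_equiv}.
HB.instance Definition _ := Choice.on presAlg.

Definition ptm (t : term R X) : presAlg := \pi_({eq_quot peq_equiv}) t.
Definition prepr (x : presAlg) : term R X :=
  generic_quotient.repr (x : {eq_quot peq_equiv}).

Lemma preprK x : ptm (prepr x) = x.
Proof. exact: reprK. Qed.

Lemma ptm_eq t u : ptm t = ptm u <-> pcong t u.
Proof.
split; first by move/eqP; rewrite /ptm piE => /asboolP.
by move=> tu; apply/eqP; rewrite /ptm piE; apply/asboolP.
Qed.

Lemma prepr_ptm t : pcong (prepr (ptm t)) t.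
Proof. by apply/ptm_eq; rewrite preprK. Qed.

Lemma ptmW (P : presAlg -> Prop) : (forall t, P (ptm t)) -> forall x, P x.
Proof. by move=> H x; rewrite -(preprK x). Qed.

Definition padd (x y : presAlg) := ptm (Add (prepr x) (prepr y)).
Definition pmul (x y : presAlg) := ptm (Mul (prepr x) (prepr y)).
Definition pscale (a : R) (x : presAlg) := ptm (Mul (Cst a) (prepr x)).
Definition popp (x : presAlg) := pscale (-1) x.

Lemma paddE t u : padd (ptm t) (ptm u) = ptm (Add t u).
Proof. by apply/ptm_eq; apply: pcong_Add; apply: prepr_ptm. Qed.
Lemma pmulE t u : pmul (ptm t) (ptm u) = ptm (Mul t u).
Proof. by apply/ptm_eq; apply: pcong_Mul; apply: prepr_ptm. Qed.
Lemma pscaleE a t : pscale a (ptm t) = ptm (Mul (Cst a) t).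
Proof.
by apply/ptm_eq; apply: pcong_Mul; [apply: pcong_refl | apply: prepr_ptm].
Qed.

Lemma paddA : associative padd.
Proof.
elim/ptmW=> t; elim/ptmW=> u; elim/ptmW=> v.
by rewrite !paddE; apply/ptm_eq; exact: pcong_addA.
Qed.
Lemma paddC : commutative padd.
Proof.
elim/ptmW=> t; elim/ptmW=> u.
by rewrite !paddE; apply/ptm_eq; exact: pcong_addC.
Qed.
Lemma padd0 : left_id (ptm (Cst 0)) padd.
Proof. by elim/ptmW=> t; rewrite paddE; apply/ptm_eq; exact: pcong_add0. Qed.
Lemma paddN : left_inverse (ptm (Cst 0)) popp padd.
Proof.
elim/ptmW=> t; rewrite /popp pscaleE paddE; apply/ptm_eq.
apply: pcong_trans (pcong_mul0 t); apply: pcong_sym.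
rewrite -[X in Cst X](addNr 1); apply: pcong_trans.
  by apply: pcong_Mul; [exact: pcong_CstD | exact: pcong_refl].
apply: pcong_trans; first exact: pcong_mulDl.
by apply: pcong_Add; [exact: pcong_refl | exact: pcong_mul1].
Qed.

HB.instance Definition _ :=
  GRing.isZmodule.Build presAlg paddA paddC padd0 paddN.

Lemma pmulA : associative pmul.
Proof.
elim/ptmW=> t; elim/ptmW=> u; elim/ptmW=> v.
by rewrite !pmulE; apply/ptm_eq; exact: pcong_mulA.
Qed.
Lemma pmul1l : left_id (ptm (Cst 1)) pmul.
Proof. by elim/ptmW=> t; rewrite pmulE; apply/ptm_eq; exact: pcong_mul1. Qed.
Lemma pmul1r : right_id (ptm (Cst 1)) pmul.
Proof.
elim/ptmW=> t; rewrite pmulE; apply/ptm_eq.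
apply: pcong_trans (pcong_mul1 t); apply: pcong_sym; exact: pcong_CstC.
Qed.
Lemma pmulDl : left_distributive pmul padd.
Proof.
elim/ptmW=> t; elim/ptmW=> u; elim/ptmW=> v.
by rewrite !(paddE, pmulE); apply/ptm_eq; exact: pcong_mulDl.
Qed.
Lemma pmulDr : right_distributive pmul padd.
Proof.
elim/ptmW=> t; elim/ptmW=> u; elim/ptmW=> v.
by rewrite !(paddE, pmulE); apply/ptm_eq; exact: pcong_mulDr.
Qed.

HB.instance Definition _ :=
  GRing.Zmodule_isPzRing.Build presAlg pmulA pmul1l pmul1r pmulDl pmulDr.

Lemma pscaleA a b x : pscale a (pscale b x) = pscale (a * b) x.
Proof.
elim/ptmW: x => t; rewrite !pscaleE; apply/ptm_eq.
apply: pcong_trans; first exact: pcong_mulA.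
by apply: pcong_Mul; [apply: pcong_sym; exact: pcong_CstM | exact: pcong_refl].
Qed.
Lemma pscale1 : left_id 1 pscale.
Proof. by elim/ptmW=> t; rewrite pscaleE; apply/ptm_eq; exact: pcong_mul1. Qed.
Lemma pscaleDr : right_distributive pscale +%R.
Proof.
move=> a; elim/ptmW=> t; elim/ptmW=> u.
rewrite /GRing.add /= !(pscaleE, paddE); apply/ptm_eq; exact: pcong_mulDr.
Qed.
Lemma pscaleDl x : {morph pscale^~ x : a b / a + b}.
Proof.
move=> a b; elim/ptmW: x => t.
rewrite [RHS]/GRing.add /= !(pscaleE, paddE); apply/ptm_eq.
apply: pcong_trans (pcong_mulDl _ _ _).
by apply: pcong_Mul; [exact: pcong_CstD | exact: pcong_refl].
Qed.

HB.instance Definition _ := GRing.Zmodule_isLmodule.Build R presAlg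
  pscaleA pscale1 pscaleDr pscaleDl.

Lemma pscalerAl (a : R) (x y : presAlg) : a *: (x * y) = (a *: x) * y.
Proof.
elim/ptmW: x => t; elim/ptmW: y => u.
rewrite /GRing.scale /GRing.mul /= !(pscaleE, pmulE); apply/ptm_eq.
exact: pcong_mulA.
Qed.
Lemma pscalerAr (a : R) (x y : presAlg) : a *: (x * y) = x * (a *: y).
Proof.
elim/ptmW: x => t; elim/ptmW: y => u.
rewrite /GRing.scale /GRing.mul /= !(pscaleE, pmulE); apply/ptm_eq.
apply: pcong_trans; first exact: pcong_mulA.
apply: pcong_trans (pcong_sym (pcong_mulA _ _ _)).
by apply: pcong_Mul; [exact: pcong_CstC | exact: pcong_refl].
Qed.

Lemma ptmD t u : ptm (Add t u) = ptm t + ptm u.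
Proof. by rewrite -paddE. Qed.
Lemma ptmM t u : ptm (Mul t u) = ptm t * ptm u.
Proof. by rewrite -pmulE. Qed.
Lemma ptmC a : ptm (Cst a) = a *: (1 : presAlg).
Proof.
rewrite /GRing.scale /= pscaleE; apply/ptm_eq.
apply: pcong_sym; apply: pcong_trans; first exact: pcong_CstC.
exact: pcong_mul1.
Qed.

Section Eval.
Variables (S : pzRingType) (f : {rmorphism R -> S}) (g : X -> S).
Fixpoint peval (t : term R X) : S :=
  match t with
  | Cst a => f a
  | Gen x => g x
  | Add u v => peval u + peval v
  | Mul u v => peval u * peval v
  end.
Hypothesis f_central : forall a s, f a * s = s * f a.
Hypothesis g_rel : forall t u, rel t u -> peval t = peval u.
Lemma peval_cong t u : pcong t u -> peval t = peval u.
Proof.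
elim=> {t u} //=.
- by move=> t u v _ -> _ ->.
- by move=> t t' u u' _ -> _ ->.
- by move=> t t' u u' _ -> _ ->.
- by move=> *; rewrite addrA.
- by move=> *; rewrite addrC.
- by move=> *; rewrite rmorph0 add0r.
- by move=> *; rewrite mulrA.
- by move=> *; rewrite rmorph1 mul1r.
- by move=> *; rewrite mulrDl.
- by move=> *; rewrite mulrDr.
- by move=> *; rewrite rmorphD.
- by move=> *; rewrite rmorphM.
- by move=> *; rewrite rmorph0 mul0r.
Qed.
Definition plift (x : presAlg) : S := peval (prepr x).
Lemma pliftE t : plift (ptm t) = peval t.
Proof. exact/peval_cong/prepr_ptm. Qed.
End Eval.

End Presented.

(* Tensor product of M and N over scalars S acting on the right of M and on  *)
(* the left of N: finite formal sums of pairs modulo biadditivity and        *)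
(* (x a) (x) y = x (x) (a y).                                                *)

Section Tensor.
Variables (M N : zmodType) (S : Type) (ra : M -> S -> M) (la : S -> N -> N).

Inductive tcong : seq (M * N) -> seq (M * N) -> Prop :=
| tcong_refl s : tcong s s
| tcong_sym s t : tcong s t -> tcong t s
| tcong_trans s t u : tcong s t -> tcong t u -> tcong s u
| tcong_cat s s' t t' : tcong s s' -> tcong t t' -> tcong (s ++ t) (s' ++ t')
| tcong_comm s t : tcong (s ++ t) (t ++ s)
| tcong_0 y : tcong [:: (0, y)] [::]
| tcong_Dl x x' y : tcong [:: (x + x', y)] [:: (x, y); (x', y)]
| tcong_Dr x y y' : tcong [:: (x, y + y')] [:: (x, y); (x, y')]
| tcong_bal x a y : tcong [:: (ra x a, y)] [:: (x, la a y)].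

Definition teq (s t : seq (M * N)) : bool := `[< tcong s t >].
Lemma teq_refl : reflexive teq.
Proof. by move=> t; apply/asboolP; exact: tcong_refl. Qed.
Lemma teq_sym : symmetric teq.
Proof. by move=> t u; apply: asbool_equiv_eq; split=> /tcong_sym. Qed.
Lemma teq_trans : transitive teq.
Proof.
move=> u t v /asboolP tu /asboolP uv; apply/asboolP; exact: tcong_trans uv.
Qed.
Canonical teq_equiv := EquivRel teq teq_refl teq_sym teq_trans.

Definition tensor := {eq_quot teq_equiv}.
HB.instance Definition _ := Choice.on tensor.

Definition tpi (s : seq (M * N)) : tensor := \pi_({eq_quot teq_equiv}) s.
Definition trepr (x : tensor) : seq (M * N) :=
  generic_quotient.repr (x : {eq_quot teq_equiv}).

Lemma treprK x : tpi (trepr x) = x.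
Proof. exact: reprK. Qed.
Lemma tpi_eq s t : tpi s = tpi t <-> tcong s t.
Proof.
split; first by move/eqP; rewrite /tpi piE => /asboolP.
by move=> st; apply/eqP; rewrite /tpi piE; apply/asboolP.
Qed.
Lemma trepr_tpi s : tcong (trepr (tpi s)) s.
Proof. by apply/tpi_eq; rewrite treprK. Qed.
Lemma tpiW (P : tensor -> Prop) : (forall s, P (tpi s)) -> forall x, P x.
Proof. by move=> H x; rewrite -(treprK x). Qed.

Definition tneg (s : seq (M * N)) := [seq (- p.1, p.2) | p <- s].
Definition tadd (x y : tensor) := tpi (trepr x ++ trepr y).
Definition topp (x : tensor) := tpi (tneg (trepr x)).

Lemma taddE s t : tadd (tpi s) (tpi t) = tpi (s ++ t).
Proof. by apply/tpi_eq; apply: tcong_cat; apply: trepr_tpi. Qed.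

Lemma taddA : associative tadd.
Proof.
by elim/tpiW=> s; elim/tpiW=> t; elim/tpiW=> u; rewrite !taddE catA.
Qed.
Lemma taddC : commutative tadd.
Proof.
by elim/tpiW=> s; elim/tpiW=> t; rewrite !taddE; apply/tpi_eq/tcong_comm.
Qed.
Lemma tadd0 : left_id (tpi [::]) tadd.
Proof. by elim/tpiW=> s; rewrite taddE. Qed.
Lemma tneg_cat s : tcong (tneg s ++ s) [::].
Proof.
elim: s => [|[x y] s IHs] /=; first exact: tcong_refl.
have step : tcong ((- x, y) :: tneg s ++ (x, y) :: s)
                  ([:: (- x, y)] ++ [:: (x, y)] ++ (s ++ tneg s)).
  rewrite -[X in tcong X](cat1s (- x, y)); apply: tcong_cat.
    exact: tcong_refl.
  exact: (tcong_comm (tneg s) ((x, y) :: s)).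
apply: (tcong_trans step).
apply: (tcong_trans (t := [:: (0, y)] ++ [::])); last exact: tcong_0.
rewrite (catA [:: (- x, y)] [:: (x, y)]); apply: tcong_cat; last first.
  by apply: tcong_trans IHs; exact: tcong_comm.
apply: tcong_sym.
by rewrite -(addNr x); exact: tcong_Dl.
Qed.
Lemma taddN : left_inverse (tpi [::]) topp tadd.
Proof.
move=> x; rewrite /topp -{2}(treprK x) taddE; apply/tpi_eq; exact: tneg_cat.
Qed.

HB.instance Definition _ :=
  GRing.isZmodule.Build tensor taddA taddC tadd0 taddN.

Definition tens (x : M) (y : N) : tensor := tpi [:: (x, y)].

Lemma tpiE s : tpi s = \sum_(p <- s) tens p.1 p.2.
Proof.
elim: s => [|[x y] s IHs]; first by rewrite big_nil.
by rewrite big_cons -IHs /= /tens [RHS]taddE.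
Qed.

Lemma tensW (P : tensor -> Prop) :
    P 0 -> (forall u v, P u -> P v -> P (u + v)) ->
  (forall x y, P (tens x y)) -> forall u, P u.
Proof.
by move=> P0 PD Pt; elim/tpiW=> s; rewrite tpiE; elim/big_ind: _.
Qed.

Lemma tens0l y : tens 0 y = 0.
Proof. exact/tpi_eq/tcong_0. Qed.
Lemma tensDl x x' y : tens (x + x') y = tens x y + tens x' y.
Proof. by rewrite [RHS]taddE; apply/tpi_eq/tcong_Dl. Qed.
Lemma tensDr x y y' : tens x (y + y') = tens x y + tens x y'.
Proof. by rewrite [RHS]taddE; apply/tpi_eq/tcong_Dr. Qed.
Lemma tens_bal x a y : tens (ra x a) y = tens x (la a y).
Proof. exact/tpi_eq/tcong_bal. Qed.

(* The additive map x (x) y |-> g x y; meaningful when g is biadditive and   *)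
(* balanced (lemma tlift_tens).                                              *)
Definition tlift (Z : zmodType) (g : M -> N -> Z) (u : tensor) : Z :=
  \sum_(p <- trepr u) g p.1 p.2.

Section Lift.
Variables (Z : zmodType) (g : M -> N -> Z).
Hypothesis gDl : forall x x' y, g (x + x') y = g x y + g x' y.
Hypothesis gDr : forall x y y', g x (y + y') = g x y + g x y'.
Hypothesis gbal : forall x a y, g (ra x a) y = g x (la a y).

Lemma tlift_cong s t : tcong s t ->
  \sum_(p <- s) g p.1 p.2 = \sum_(p <- t) g p.1 p.2.
Proof.
elim=> {s t} //=.
- by move=> s t u _ -> _ ->.
- by move=> s s' t t' _ e1 _ e2; rewrite !big_cat /= e1 e2.
- by move=> s t; rewrite !big_cat /= addrC.
- move=> y; rewrite big_seq1 big_nil /=.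
  by apply: (@addrI _ (g 0 y)); rewrite -gDl !addr0.
- by move=> x x' y; rewrite !big_cons !big_nil !addr0 gDl.
- by move=> x y y'; rewrite !big_cons !big_nil !addr0 gDr.
- by move=> x a y; rewrite !big_seq1 gbal.
Qed.
Lemma tlift_tpi s : tlift g (tpi s) = \sum_(p <- s) g p.1 p.2.
Proof. exact/tlift_cong/trepr_tpi. Qed.
Lemma tlift_tens x y : tlift g (tens x y) = g x y.
Proof. by rewrite tlift_tpi big_seq1. Qed.
Lemma tlift0 : tlift g 0 = 0.
Proof. by rewrite [LHS]tlift_tpi big_nil. Qed.
Lemma tliftD u v : tlift g (u + v) = tlift g u + tlift g v.
Proof.
elim/tpiW: u => s; elim/tpiW: v => t.
by rewrite [tpi s + tpi t]taddE !tlift_tpi big_cat.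
Qed.
End Lift.
End Tensor.

(* Extension of scalars R (x)_A B of an A-algebra B along phi : A -> R.      *)

Section ScalarExtension.
Variables (A : comPzRingType) (R : comNzRingType) (phi : {rmorphism A -> R}).
Variable B : algType A.

Definition scext :=
  tensor (fun (r : R) (a : A) => r * phi a) (fun (a : A) (b : B) => a *: b).
HB.instance Definition _ := GRing.Zmodule.on scext.

Definition sctens (r : R) (b : B) : scext := tens _ _ r b.

Lemma sctensDl r r' b : sctens (r + r') b = sctens r b + sctens r' b.
Proof. exact: tensDl. Qed.
Lemma sctensDr r b b' : sctens r (b + b') = sctens r b + sctens r b'.
Proof. exact: tensDr. Qed.
Lemma sctens_bal r a b : sctens (r * phi a) b = sctens r (a *: b).
Proof. exact: (@tens_bal _ _ _ (fun r a => r * phi a)). Qed.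

Definition scmul (u v : scext) : scext :=
  tlift (fun r b => tlift (fun r' b' => sctens (r * r') (b * b')) v) u.
Definition scscale (a : R) (u : scext) : scext :=
  tlift (fun r b => sctens (a * r) b) u.

Section MulRight.
Variables (r : R) (b : B).
Let g r' b' := sctens (r * r') (b * b').
Let gDl x x' y : g (x + x') y = g x y + g x' y.
Proof. by rewrite /g mulrDr sctensDl. Qed.
Let gDr x y y' : g x (y + y') = g x y + g x y'.
Proof. by rewrite /g mulrDr sctensDr. Qed.
Let gbal x a y : g (x * phi a) y = g x (a *: y).
Proof. by rewrite /g mulrA sctens_bal scalerAr. Qed.
Lemma scmulr_tens r' b' :
  tlift g (sctens r' b') = sctens (r * r') (b * b').
Proof. exact: (tlift_tens gDl gDr gbal). Qed.
Lemma scmulrD (u v : scext) : tlift g (u + v) = tlift g u + tlift g v.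
Proof. exact: (tliftD gDl gDr gbal). Qed.
Lemma scmulr0 : tlift g (0 : scext) = 0.
Proof. exact: (tlift0 gDl gDr gbal). Qed.
End MulRight.

Lemma scextW (P : scext -> Prop) :
    P 0 -> (forall u v, P u -> P v -> P (u + v)) ->
  (forall r b, P (sctens r b)) -> forall u, P u.
Proof. exact: tensW. Qed.

Section MulLeft.
Variable v : scext.
Let g r b := tlift (fun r' b' => sctens (r * r') (b * b')) v.
Let gDl x x' y : g (x + x') y = g x y + g x' y.
Proof.
rewrite /g; elim/scextW: v => [|u w IHu IHw|r b].
- by rewrite !scmulr0 addr0.
- by rewrite !scmulrD IHu IHw addrACA.
- by rewrite !scmulr_tens mulrDl sctensDl.
Qed.
Let gDr x y y' : g x (y + y') = g x y + g x y'.
Proof.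
rewrite /g; elim/scextW: v => [|u w IHu IHw|r b].
- by rewrite !scmulr0 addr0.
- by rewrite !scmulrD IHu IHw addrACA.
- by rewrite !scmulr_tens mulrDl sctensDr.
Qed.
Let gbal x a y : g (x * phi a) y = g x (a *: y).
Proof.
rewrite /g; elim/scextW: v => [|u w IHu IHw|r b].
- by rewrite !scmulr0.
- by rewrite !scmulrD IHu IHw.
- by rewrite !scmulr_tens mulrAC sctens_bal scalerAl.
Qed.
Lemma scmull0 : scmul 0 v = 0.
Proof. exact: (tlift0 gDl gDr gbal). Qed.
Lemma scmulDl u u' : scmul (u + u') v = scmul u v + scmul u' v.
Proof. exact: (tliftD gDl gDr gbal). Qed.
Lemma scmull_tens r b : scmul (sctens r b) v = g r b.
Proof. exact: (tlift_tens gDl gDr gbal). Qed.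
End MulLeft.

Lemma scmulE r b r' b' :
  scmul (sctens r b) (sctens r' b') = sctens (r * r') (b * b').
Proof. by rewrite scmull_tens scmulr_tens. Qed.
Lemma scmul0 u : scmul u 0 = 0.
Proof.
elim/scextW: u => [|u v IHu IHv|r b]; first by rewrite scmull0.
- by rewrite scmulDl IHu IHv addr0.
- by rewrite scmull_tens scmulr0.
Qed.
Lemma scmulDr u v w : scmul u (v + w) = scmul u v + scmul u w.
Proof.
elim/scextW: u => [|u u' IHu IHv|r b]; first by rewrite !scmull0 addr0.
- by rewrite !scmulDl IHu IHv addrACA.
- by rewrite !scmull_tens scmulrD.
Qed.
Lemma scmulA : associative scmul.
Proof.
move=> u v w; elim/scextW: u => [|u u' IHu IHu'|r b].
- by rewrite !scmull0.
- by rewrite !scmulDl IHu IHu'.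
elim/scextW: v => [|u u' IHu IHu'|r' b'].
- by rewrite !(scmull0, scmul0).
- by rewrite !(scmulDl, scmulDr) IHu IHu'.
elim/scextW: w => [|u u' IHu IHu'|r'' b''].
- by rewrite !(scmull0, scmul0).
- by rewrite !(scmulDl, scmulDr) IHu IHu'.
by rewrite !scmulE !mulrA.
Qed.
Lemma scmul1l : left_id (sctens 1 1) scmul.
Proof.
elim/scextW=> [|u u' IHu IHu'|r b]; first by rewrite scmul0.
- by rewrite scmulDr IHu IHu'.
- by rewrite scmulE !mul1r.
Qed.
Lemma scmul1r : right_id (sctens 1 1) scmul.
Proof.
elim/scextW=> [|u u' IHu IHu'|r b]; first by rewrite scmull0.
- by rewrite scmulDl IHu IHu'.
- by rewrite scmulE !mulr1.
Qed.

HB.instance Definition _ := GRing.Zmodule_isPzRing.Build scext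
  scmulA scmul1l scmul1r (fun u v w => scmulDl w u v) scmulDr.

Section Scale.
Variable a : R.
Let g r b := sctens (a * r) b.
Let gDl x x' y : g (x + x') y = g x y + g x' y.
Proof. by rewrite /g mulrDr sctensDl. Qed.
Let gDr x y y' : g x (y + y') = g x y + g x y'.
Proof. by rewrite /g sctensDr. Qed.
Let gbal x c y : g (x * phi c) y = g x (c *: y).
Proof. by rewrite /g mulrA sctens_bal. Qed.
Lemma scscale_tens r b : scscale a (sctens r b) = sctens (a * r) b.
Proof. exact: (tlift_tens gDl gDr gbal). Qed.
Lemma scscaleDr u v : scscale a (u + v) = scscale a u + scscale a v.
Proof. exact: (tliftD gDl gDr gbal). Qed.
Lemma scscale0 : scscale a 0 = 0.
Proof. exact: (tlift0 gDl gDr gbal). Qed.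
End Scale.

Lemma scscaleA a b u : scscale a (scscale b u) = scscale (a * b) u.
Proof.
elim/scextW: u => [|u u' IHu IHu'|r c]; first by rewrite !scscale0.
- by rewrite !scscaleDr IHu IHu'.
- by rewrite !scscale_tens mulrA.
Qed.
Lemma scscale1 : left_id 1 scscale.
Proof.
elim/scextW=> [|u u' IHu IHu'|r c]; first by rewrite !scscale0.
- by rewrite !scscaleDr IHu IHu'.
- by rewrite !scscale_tens mul1r.
Qed.
Lemma scscaleDl u : {morph scscale^~ u : a b / a + b}.
Proof.
move=> a b; elim/scextW: u => [|u u' IHu IHu'|r c].
- by rewrite !scscale0 addr0.
- by rewrite !scscaleDr IHu IHu' addrACA.
- by rewrite !scscale_tens mulrDl sctensDl.
Qed.

HB.instance Definition _ := GRing.Zmodule_isLmodule.Build R scext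
  scscaleA scscale1 scscaleDr scscaleDl.

Lemma scscalerAl (a : R) (u v : scext) : a *: (u * v) = (a *: u) * v.
Proof.
rewrite /GRing.scale /GRing.mul /=; elim/scextW: u => [|u u' IHu IHu'|r b].
- by rewrite scscale0 !scmull0 scscale0.
- by rewrite scmulDl !scscaleDr IHu IHu' scmulDl.
elim/scextW: v => [|u u' IHu IHu'|r' b'].
- by rewrite !scmul0 scscale0.
- by rewrite scmulDr !scscaleDr IHu IHu' scmulDr.
by rewrite !(scmulE, scscale_tens) mulrA.
Qed.
Lemma scscalerAr (a : R) (u v : scext) : a *: (u * v) = u * (a *: v).
Proof.
rewrite /GRing.scale /GRing.mul /=; elim/scextW: u => [|u u' IHu IHu'|r b].
- by rewrite !scmull0 scscale0.
- by rewrite !scmulDl !scscaleDr IHu IHu'.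
elim/scextW: v => [|u u' IHu IHu'|r' b'].
- by rewrite scscale0 !scmul0 scscale0.
- by rewrite scmulDr !scscaleDr IHu IHu' scmulDr.
by rewrite !(scmulE, scscale_tens) mulrCA.
Qed.

Lemma sctensE r b : sctens r b = r *: sctens 1 b.
Proof. by rewrite /GRing.scale /= scscale_tens mulr1. Qed.

Lemma scext_neq0 (f : {linear B -> A^o}) : f 1 = 1 -> (1 : scext) != 0.
Proof.
move=> f1; pose g (r : R) (b : B) := r * phi (f b).
have gDl x x' y : g (x + x') y = g x y + g x' y by rewrite /g mulrDl.
have gDr x y y' : g x (y + y') = g x y + g x y'.
  by rewrite /g linearD rmorphD mulrDr.
have gbal x a y : g (x * phi a) y = g x (a *: y).
  by rewrite /g linearZ rmorphM mulrA.
apply/eqP => /(congr1 (tlift g)).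
rewrite (tlift0 gDl gDr gbal) [LHS](tlift_tens gDl gDr gbal) /g f1 rmorph1.
by move/eqP; rewrite mulr1 oner_eq0.
Qed.

End ScalarExtension.

(* K[H]-modules are given by matrix representations V of H acting on column  *)
(* vectors (so that they are left modules); [ind V] is KW (x)_{KH} V.        *)

Section Induced.
Variables (K : fieldType) (gT : finGroupType).

Definition grpalg := {ffun gT -> K}.
HB.instance Definition _ := GRing.Zmodule.on grpalg.

Definition gamul (x y : grpalg) : grpalg :=
  [ffun w => \sum_u x u * y (u^-1 * w)%g].
Definition gaone : grpalg := [ffun w => (w == 1%g)%:R].

Lemma gamulDl x y z : gamul (x + y) z = gamul x z + gamul y z.
Proof.
apply/ffunP=> w; rewrite !ffunE -big_split /=; apply: eq_bigr => u _.
by rewrite ffunE mulrDl.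
Qed.
Lemma gamulDr x y z : gamul x (y + z) = gamul x y + gamul x z.
Proof.
apply/ffunP=> w; rewrite !ffunE -big_split /=; apply: eq_bigr => u _.
by rewrite ffunE mulrDr.
Qed.
Lemma gamul1r x : gamul x gaone = x.
Proof.
apply/ffunP=> w; rewrite ffunE (bigD1 w) //= big1 ?addr0.
  by rewrite ffunE mulVg eqxx mulr1.
move=> u uw; rewrite ffunE; case: eqP; rewrite ?mulr0 // => uw1.
by case/eqP: uw; rewrite -[u]mulg1 -uw1 mulKVg.
Qed.
Lemma gamulA x y z : gamul x (gamul y z) = gamul (gamul x y) z.
Proof.
apply/ffunP=> w; rewrite !ffunE.
transitivity (\sum_u \sum_v x u * y (u^-1 * v)%g * z (v^-1 * w)%g).
  apply: eq_bigr => u _; rewrite ffunE mulr_sumr.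
  rewrite (reindex_inj (mulgI u^-1%g)); apply: eq_bigr => v _ /=.
  by rewrite mulrA invMg invgK -!mulgA mulKVg.
rewrite exchange_big; apply: eq_bigr => v _ /=.
by rewrite ffunE mulr_suml.
Qed.

Variables (H : {group gT}) (m : nat) (V : mx_representation K H m).

Definition subgrpalg := {x : grpalg | [forall w, (x w != 0) ==> (w \in H)]}.
Definition gaact (x : subgrpalg) (v : 'cV[K]_m) : 'cV[K]_m :=
  \sum_(w in H) (val x : grpalg) w *: (V w *m v).

Definition ind :=
  tensor (fun (x : grpalg) (y : subgrpalg) => gamul x (val y)) gaact.
HB.instance Definition _ := GRing.Zmodule.on ind.

Definition indtens (x : grpalg) (v : 'cV[K]_m) : ind := tens _ _ x v.
Definition indact (x : grpalg) (u : ind) : ind :=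
  tlift (fun y v => indtens (gamul x y) v) u.
(* the canonical map V -> ind V, whose image is \hat V *)
Definition indhat (v : 'cV[K]_m) : ind := indtens gaone v.

Lemma indact_tens x y v : indact x (indtens y v) = indtens (gamul x y) v.
Proof.
apply: (tlift_tens (g := fun y v => indtens (gamul x y) v)).
- by move=> a b c; rewrite gamulDr; exact: tensDl.
- by move=> a b c; exact: tensDr.
move=> a b c; rewrite gamulA.
exact: (@tens_bal _ _ _ (fun (x : grpalg) (y : subgrpalg) => gamul x (val y))).
Qed.
Lemma indact_hat x v : indact x (indhat v) = indtens x v.
Proof. by rewrite indact_tens gamul1r. Qed.

End Induced.

(* A finite complex reflection group W is a finGroupType gT with a           *)
(* representation rho acting on the column vectors C^n.                      *)

Section ReflectionGroup.
Variables (C : numClosedFieldType) (n : nat) (gT : finGroupType).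
Variable rho : mx_representation C [set: gT] n.

Definition lact (w : gT) : 'End('cV[C]_n) := linfun (mulmx (rho w)).
Definition fixv (w : gT) : {vspace 'cV[C]_n} := lker (lact w - \1)%VF.

Definition is_refl (w : gT) : bool := (\dim (fixv w)).+1 == n.
Definition refl := {s : gT | is_refl s}.
Definition hyp := seq_sub [seq fixv (val s) | s : refl].

Lemma fixvP w v : reflect (rho w *m v = v) (v \in fixv w).
Proof.
by rewrite memv_ker add_lfunE opp_lfunE id_lfunE lfunE subr_eq0; apply: eqP.
Qed.

Lemma lactM u w : lact (u * w)%g = (lact u \o lact w)%VF.
Proof.
apply/lfunP=> v; rewrite comp_lfunE !lfunE /=.
by rewrite repr_mxM ?inE // mulmxA.
Qed.
Lemma lact1 : lact 1 = \1%VF.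
Proof. by apply/lfunP=> v; rewrite !lfunE /= repr_mx1 mul1mx. Qed.

Lemma limg_fixv w s : (lact w @: fixv s)%VS = fixv (w * s * w^-1)%g.
Proof.
apply/eqP; rewrite eqEsubv; apply/andP; split; apply/subvP=> v.
  case/memv_imgP=> u /fixvP su ->; apply/fixvP.
  rewrite lfunE /= !repr_mxM ?inE // -!mulmxA (mulmxA (rho w^-1%g)).
  by rewrite -repr_mxM ?inE // mulVg repr_mx1 mul1mx su.
move=> /fixvP sv; apply/memv_imgP; exists (rho w^-1%g *m v).
  apply/fixvP; rewrite -{2}sv !mulmxA -!repr_mxM ?inE //.
  by rewrite !mulgA mulVg mul1g.
by rewrite lfunE /= mulmxA -repr_mxM ?inE // mulgV repr_mx1 mul1mx.
Qed.

Lemma is_reflJ w s : is_refl (w * s * w^-1)%g = is_refl s.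
Proof.
rewrite /is_refl -limg_fixv limg_dim_eq //; apply/eqP.
rewrite -subv0; apply/subvP=> v /memv_capP[_].
rewrite memv_ker lfunE /= => /eqP rv; rewrite memv0.
by rewrite -[v]mul1mx -(repr_mx1 rho) -(mulVg w) repr_mxM ?inE // -mulmxA rv
           mulmx0.
Qed.

Lemma hyp_refl (s : refl) : fixv (val s) \in [seq fixv (val r) | r : refl].
Proof. by apply/imageP; exists s. Qed.
Definition hyp_of (s : refl) : hyp := SeqSub (hyp_refl s).

Lemma hact_subproof w (H : hyp) :
  (lact w @: val H)%VS \in [seq fixv (val s) | s : refl].
Proof.
have /imageP[s _ ->] := valP H; rewrite limg_fixv.
have ws : is_refl (w * val s * w^-1)%g by rewrite is_reflJ (valP s).
by apply/imageP; exists (Sub (w * val s * w^-1)%g ws).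
Qed.
Definition hact (w : gT) (H : hyp) : hyp := SeqSub (hact_subproof w H).

Lemma hactM u w H : hact (u * w) H = hact u (hact w H).
Proof. by apply: val_inj; rewrite /= lactM limg_comp. Qed.
Lemma hact1 H : hact 1 H = H.
Proof. by apply: val_inj; rewrite /= lact1 lim1g. Qed.

Definition transverse (H1 H2 : hyp) : bool :=
  (H1 != H2) &&
  [forall H3 : hyp, (val H1 :&: val H2 <= val H3)%VS ==> (H3 \in [set H1; H2])].

Definition transverse_collection (B : {set hyp}) : bool :=
  [forall H1 in B, forall H2 in B, (H1 != H2) ==> transverse H1 H2].

Definition setact (w : gT) (B : {set hyp}) : {set hyp} := hact w @: B.

Definition Stab (B : {set hyp}) : {set gT} := [set w | setact w B == B].
Lemma group_set_Stab B : group_set (Stab B).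
Proof.
have e u w : setact (u * w) B = setact u (setact w B).
  by rewrite /setact -imset_comp; apply: eq_imset => H /=; rewrite hactM.
apply/group_setP; split=> [|u w]; rewrite !inE.
  by apply/eqP; rewrite -[RHS]imset_id; apply: eq_imset => H; rewrite hact1.
by rewrite e => /eqP uB /eqP ->; rewrite uB.
Qed.
Canonical Stab_group B := Group (group_set_Stab B).

(* B = set0 needs no separate clause: both generating sets are then empty *)
Definition KB (B : {set hyp}) : {set gT} :=
  <<[set val r | r : refl & hyp_of r \in B] :|:
    [set ((val p.2)^-1 * val p.1)%g | p : (refl * refl)%type &
       [&& setact (val p.1) B == setact (val p.2) B,
           setact (val p.1) B != B &
           [forall H in B :\: setact (val p.1) B,
              hact (val p.1) H != hact (val p.2) H]]]>>%g.

(* The ring of parameters Z[mu_s^{+-1}, delta^{+-1}] / (mu_s - mu_s').       *)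

Inductive parGen := gmu of refl | gmuV of refl | gdelta | gdeltaV.

Inductive par_rel : term int parGen -> term int parGen -> Prop :=
| par_comm x y : par_rel (Mul (Gen x) (Gen y)) (Mul (Gen y) (Gen x))
| par_mu s : par_rel (Mul (Gen (gmu s)) (Gen (gmuV s))) (Cst 1)
| par_delta : par_rel (Mul (Gen gdelta) (Gen gdeltaV)) (Cst 1)
| par_conj s s' : val s' \in (val s ^: [set: gT])%g ->
    par_rel (Gen (gmu s)) (Gen (gmu s')).

Definition parRing := presAlg par_rel.
HB.instance Definition _ := GRing.PzRing.on parRing.

Lemma parRing_mulC : commutative (@GRing.mul parRing).
Proof.
elim/ptmW=> t; elim/ptmW=> u.
elim: t u => [a|x|t IHt t' IHt'|t IHt t' IHt'] u.
- by rewrite -!ptmM; apply/ptm_eq; exact: pcong_CstC.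
- elim: u => [a|y|u IHu u' IHu'|u IHu u' IHu'].
  + by rewrite -!ptmM; apply/ptm_eq/pcong_sym; exact: pcong_CstC.
  + by rewrite -!ptmM; apply/ptm_eq/pcong_rel; exact: par_comm.
  + by rewrite ptmD mulrDr mulrDl IHu IHu'.
  + by rewrite ptmM mulrA IHu -mulrA IHu' mulrA.
- by rewrite ptmD mulrDr mulrDl IHt IHt'.
- by rewrite ptmM -mulrA IHt' mulrA IHt mulrA.
Qed.
HB.instance Definition _ :=
  GRing.PzRing_hasCommutativeMul.Build parRing parRing_mulC.

Lemma parRing_neq0 : (1 : parRing) != 0.
Proof.
pose g (_ : parGen) : int := 1.
apply/eqP => /ptm_eq H.
have /= := @peval_cong _ _ par_rel int idfun g _ _ _ _ H.
by move=> e; suff: (1 : int) = 0 by []; apply: e => [a x|t u []//]; exact: mulrC.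
Qed.
HB.instance Definition _ :=
  GRing.PzSemiRing_isNonZero.Build parRing parRing_neq0.

Definition mu (s : refl) : parRing := ptm par_rel (Gen (gmu s)).
Definition muV (s : refl) : parRing := ptm par_rel (Gen (gmuV s)).
Definition delta : parRing := ptm par_rel (Gen gdelta).
Definition mu_ratio (s1 s2 : refl) : parRing := mu s1 * muV s2.

Inductive brGen := gw of gT | ge of hyp.

Local Notation tw w := (Gen (gw w)).
Local Notation te H := (Gen (ge H)).

Inductive br_rel : term parRing brGen -> term parRing brGen -> Prop :=
| br_one : br_rel (tw 1%g) (Cst 1)
| br_mul u w : br_rel (Mul (tw u) (tw w)) (tw (u * w)%g)
| br_B1 H : br_rel (Mul (te H) (te H)) (Mul (Cst delta) (te H))
| br_B2 w H : br_rel (Mul (Mul (tw w) (te H)) (tw w^-1%g)) (te (hact w H))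
| br_B3 w H : (val H <= fixv w)%VS -> br_rel (Mul (tw w) (te H)) (te H)
| br_B4 H1 H2 : transverse H1 H2 ->
    br_rel (Mul (te H1) (te H2)) (Mul (te H2) (te H1))
| br_B5 H1 H2 : H1 != H2 -> ~~ transverse H1 H2 ->
    br_rel (Mul (te H1) (te H2))
      (\big[@Add _ _/Cst 0]_(s : refl | hact (val s) H2 == H1)
          Mul (Mul (Cst (mu s)) (tw (val s))) (te H2)).

Definition Br := presAlg br_rel.
HB.instance Definition _ := GRing.PzRing.on Br.
HB.instance Definition _ := GRing.Lmodule.on Br.

Let augg (x : brGen) : parRing := if x is gw _ then 1 else 0.
Lemma aug_rel t u : br_rel t u ->
  peval idfun augg t = peval idfun augg u.
Proof.
case=> //=; try by move=> *; rewrite ?mul1r ?mul0r ?mulr0.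
move=> H1 H2 _ _; rewrite mul0r.
elim/big_ind: _ => //= [x y <- <-|s _]; first by rewrite addr0.
by rewrite mulr0.
Qed.
Definition aug : Br -> parRing^o := @plift _ _ br_rel parRing idfun augg.
Lemma augE t : aug (ptm br_rel t) = peval idfun augg t.
Proof. by apply: pliftE; [move=> a s; rewrite mulrC | exact: aug_rel]. Qed.
Lemma aug_linear : linear aug.
Proof.
move=> a; elim/ptmW=> t; elim/ptmW=> u.
by rewrite [a *: ptm _ t]pscaleE -ptmD !augE.
Qed.
HB.instance Definition _ :=
  GRing.isLinear.Build parRing Br parRing^o *:%R aug aug_linear.
Lemma aug1 : aug 1 = 1.
Proof. exact: augE. Qed.

Lemma Br_neq0 : (1 : Br) != 0.
Proof.
by apply/eqP => /(congr1 aug)/eqP; rewrite linear0 aug1 oner_eq0.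
Qed.
HB.instance Definition _ := GRing.PzSemiRing_isNonZero.Build Br Br_neq0.
HB.instance Definition _ := GRing.LSemiModule_isLSemiAlgebra.Build
  parRing Br (@pscalerAl _ _ br_rel).
HB.instance Definition _ := GRing.LSemiAlgebra_isSemiAlgebra.Build
  parRing Br (@pscalerAr _ _ br_rel).

Definition brw (w : gT) : Br := ptm br_rel (Gen (gw w)).
Definition bre (H : hyp) : Br := ptm br_rel (Gen (ge H)).
(* the factors commute by br_B4 when B is a transverse collection *)
Definition breB (B : {set hyp}) : Br := \prod_(H in B) bre H.

Section BaseChange.
Variables (R : comNzRingType) (phi : {rmorphism parRing -> R}).

Definition BrR := scext phi Br.
HB.instance Definition _ := GRing.PzRing.on BrR.
HB.instance Definition _ := GRing.Lmodule.on BrR.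
HB.instance Definition _ :=
  GRing.PzSemiRing_isNonZero.Build BrR (scext_neq0 phi aug1).
HB.instance Definition _ := GRing.LSemiModule_isLSemiAlgebra.Build
  R BrR (@scscalerAl _ _ phi Br).
HB.instance Definition _ := GRing.LSemiAlgebra_isSemiAlgebra.Build
  R BrR (@scscalerAr _ _ phi Br).

Definition toBrR (b : Br) : BrR := sctens phi 1 b.
End BaseChange.

Section Admissible.
Variables (K : fieldType) (phi : {rmorphism parRing -> K}).

Definition KWtoBr (x : grpalg K gT) : BrR phi :=
  \sum_w x w *: toBrR phi (brw w).

Definition annih (B : {set hyp}) (x : grpalg K gT) : Prop :=
  KWtoBr x * toBrR phi (breB B) = 0.

Definition admissible_pair (B : {set hyp}) (m : nat)
    (V : mx_representation K (Stab_group B) m) : Prop :=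
  forall (x : grpalg K gT) (v : 'cV[K]_m),
    annih B x -> indact x (indhat V v) = 0.

Definition admissible (B : {set hyp}) : Prop :=
  exists (m : nat) (V : mx_representation K (Stab_group B) m),
    (0 < m)%N /\ admissible_pair V.

Definition Cadm : {set {set hyp}} :=
  [set B | transverse_collection B && `[< admissible B >]].
End Admissible.

Definition in_simple_ext (k F : fieldType) (iota : {rmorphism k -> F})
    (d x : F) : Prop :=
  exists p q : {poly k}, (map_poly iota q).[d] != 0 /\
    x = (map_poly iota p).[d] / (map_poly iota q).[d].

(* (k, iota) is the subfield k_R of Frac(R) *)
Definition proper_subfield (R : idomainType) (phi : {rmorphism parRing -> R})
    (k : fieldType) (iota : {rmorphism k -> {fraction R}}) : Prop :=
  let d := tofrac (phi delta) in
  [/\ forall s, exists c, iota c = tofrac (phi (mu s)),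
      group_closure_field k gT,
      ~ algebraicOver iota d
    & exists b : seq {fraction R}, forall x, exists c : nat -> {fraction R},
        (forall i, in_simple_ext iota d (c i)) /\
        x = \sum_(i < size b) c i * b`_i].

Definition proper_ring (R : idomainType) (phi : {rmorphism parRing -> R}) : Prop :=
  [pchar R] =i pred0 /\
  exists (k : fieldType) (iota : {rmorphism k -> {fraction R}}),
    proper_subfield phi iota.

End ReflectionGroup.

Section FreeModules.
Variables (R : pzRingType) (M : lmodType R).

(* (b i), i satisfying D, is a basis of M as an indexed family *)
Definition is_basis (I : choiceType) (D : I -> Prop) (b : I -> M) : Prop :=
  (forall (s : seq I) (c : I -> R), uniq s -> (forall i, i \in s -> D i) ->
     \sum_(i <- s) c i *: b i = 0 -> forall i, i \in s -> c i = 0) /\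
  (forall x : M, exists (s : seq I) (c : I -> R),
     (forall i, i \in s -> D i) /\ x = \sum_(i <- s) c i *: b i).

Definition is_free : Prop :=
  exists (I : choiceType) (b : I -> M), is_basis (fun=> True) b.
End FreeModules.

(* The groups G_25 and G_32.  [hrefl l z] is the unitary reflection of C^n   *)
(* with hyperplane {v | l v = 0} acting by z on its orthogonal complement.   *)

Section Groups.
Variable C : numClosedFieldType.

(* e^(2 i pi / 3) *)
Definition zeta3 : C := (-1 + 'i * sqrtC 3) / 2.

Definition adj (p q : nat) (a : 'M[C]_(p, q)) : 'M[C]_(q, p) :=
  (map_mx Num.conj a)^T.

Definition hrefl (n : nat) (l : 'rV[C]_n) (z : C) : 'M[C]_n :=
  1%:M - ((1 - z) / (l *m adj l) 0 0) *: (adj l *m l).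

Definition distinguished (n : nat) (gT : finGroupType)
    (rho : mx_representation C [set: gT] n) (s : refl rho) : Prop :=
  forall v : 'cV[C]_n, (forall u, u \in fixv rho (val s) -> adj u *m v = 0) ->
    rho (val s) *m v = zeta3 *: v.

Definition inv_distinguished (n : nat) (gT : finGroupType)
    (rho : mx_representation C [set: gT] n) (s : refl rho) : Prop :=
  exists2 t : refl rho, distinguished t & val s = ((val t)^-1)%g.

Inductive ST_type := G25 | G32.

Definition ST_rank (g : ST_type) : nat := if g is G25 then 3 else 4.

Definition rowseq (n : nat) (s : seq C) : 'rV[C]_n := \row_j s`_j.

(* Linear forms of the mirrors of G_32: the 40 diameters of Coxeter's        *)
(* Witting polytope 3{3}3{3}3{3}3, of which G_32 is the symmetry group.      *)
Definition ST_forms (g : ST_type) : seq 'rV[C]_(ST_rank g) :=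
  [seq delta_mx 0 i | i : 'I_(ST_rank g)] ++
  match g with
  | G25 => [seq rowseq _ [:: 1; zeta3 ^+ a; zeta3 ^+ b]
              | a <- iota 0 3, b <- iota 0 3]
  | G32 => flatten [seq
      [:: rowseq _ [:: 0; 1; - zeta3 ^+ p.1; zeta3 ^+ p.2];
          rowseq _ [:: -1; 0; zeta3 ^+ p.1; zeta3 ^+ p.2];
          rowseq _ [:: 1; - zeta3 ^+ p.1; 0; zeta3 ^+ p.2];
          rowseq _ [:: 1; zeta3 ^+ p.1; zeta3 ^+ p.2; 0]]
      | p <- [seq (a, b) | a <- iota 0 3, b <- iota 0 3]]
  end.

Definition ST_gens (g : ST_type) : seq 'M[C]_(ST_rank g) :=
  [seq hrefl l zeta3 | l <- ST_forms g] ++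
  [seq hrefl l (zeta3 ^+ 2) | l <- ST_forms g].

(* rho identifies gT with the subgroup of GL(C^n) generated by ST_gens g *)
Definition is_ST (g : ST_type) (gT : finGroupType)
    (rho : mx_representation C [set: gT] (ST_rank g)) : Prop :=
  [/\ mx_faithful rho,
      forall M, M \in ST_gens g -> exists w, rho w = M
    & <<[set w | rho w \in ST_gens g]>>%g = [set: gT]].

End Groups.

(* Main.v *)
(* The algebra is filtered by the size of the collections B.  For a pair     *)
(* (s, t) of reflections defining a generator of K_B, mu_s s e_B equals      *)
(* mu_t t e_B up to larger collections; hence K_B acts on e_B, up to larger  *)
(* collections, by a character chi_B with values in the powers of            *)
(* mu_2 / mu_1.  It is well defined when mu^6 = 1, being read off the        *)
(* determinant and the units by which W acts on the roots of B, and the      *)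
(* elements w e_B, w in W / K_B, then span.                                  *)
(* Conversely the module induced from chi_B is the direct sum of sectors     *)
(* indexed by the orbit of B; letting e_H act on the sector of B' by delta   *)
(* if H is in B', by the sum of the mu_s s over R_{G -> H} if some G in B'   *)
(* is not transverse to H, and by 0 otherwise, defines a representation, in  *)
(* which only (B4) requires a discussion.  After division of the e_H by      *)
(* delta, the matrix of the e_B' for B' in a given size is polynomial in     *)
(* 1 / delta and is the identity at 0, so it is invertible and the w e_B are *)
(* independent; every transverse collection is admissible.                   *)
(* If B is a maximal collection deprived of a mirror P, then                 *)
(* f = (delta - e_P) e_B satisfies mu_1 k f = mu_2 f for some k in W, so     *)
(* that (mu_1^N - mu_2^N) f = 0 with N = |W|, while f is nonzero modulo a    *)
(* prime p > N with all parameters equal to 1.  Specialising mu_1 to p + 1   *)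
(* and mu_2, delta to 1 shows that f has no expansion on a basis.            *)
(* The properties of the mirrors used here are checked on tables.            *)

(* W permutes finitely many Eisenstein roots up to sixth roots of unity. Two mirrors are transverse
   exactly when their roots are orthogonal ([transverse_hy]); otherwise each class contains exactly
   one reflection carrying the first to the second ([rf]). So (B5) has two terms, and at most three
   members of a transverse collection are non-transverse to a given mirror outside it ([nonp_le3]).
   The remaining facts about W are finite checks on roots.

   Spanning: e_G e_B can be computed through any member of B that is not transverse to G. Comparing
   the results gives [br_pair] and [br_triple], hence [br_KB]: modulo larger collections, K_B acts
   on e_B by chi_B, and [br_span] follows by descending induction on the size. The condition mu^6 =
   1 makes it possible to turn the sixth root of unity [chiC] into a power of mu_2 / mu_1.

   Independence: on the module induced from chi_B the relations dictate how each e_H must act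
   ([sE]); [sector_brauer] shows that this is a representation, the case analysis being [comm_pi].
   At 1 / delta = 0 the normalised e_B becomes the projector on the sectors containing B, so the
   matrix of [F0_Phi] is the identity there and is invertible for transcendental delta. The
   resulting [BrR_relation] serves twice: for independence ([basis_free]), and to show that every
   transverse collection is admissible ([tcol_admissible]).

   Non-freeness: for generic mu the relation of [br_pair] produces torsion ([tors_rel],
   [tors_torsion]). In a free module the coordinates of the torsion element f would be killed by
   mu_1^N - mu_2^N, hence vanish modulo p at parameters 1 ([torsion_coeff]), while f survives there
   ([tors_lift_neq0]). Comparing two specialisations replaces a proof that the ring of parameters is
   a domain. *)
Require Import Defs.
From HB Require Import structures.
From mathcomp Require Import all_boot all_order all_algebra all_fingroup.
From mathcomp Require Import fraction mxrepresentation ssrZ zify ring boolp.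
From Stdlib Require BinInt Zdiv.
Import Order.TTheory GRing.Theory Num.Theory.
Set Implicit Arguments.
Unset Strict Implicit.
Unset Printing Implicit Defensive.
Local Open Scope ring_scope.

(** * Tables of the mirrors *)

(* The pair (a, b) stands for the Eisenstein integer a + b zeta3. *)
Definition eis := (BinNums.Z * BinNums.Z)%type.
Definition zi (a b : int) : eis := (Z_of_int a, Z_of_int b).
Definition e0 : eis := zi (0) (0).
Definition e1 : eis := zi (1) (0).
Definition e3 : eis := zi (3) (0).
Definition eadd (x y : eis) : eis :=
  (BinInt.Z.add x.1 y.1, BinInt.Z.add x.2 y.2).
Definition eopp (x : eis) : eis := (BinInt.Z.opp x.1, BinInt.Z.opp x.2).
Definition emul (x y : eis) : eis :=
  (BinInt.Z.sub (BinInt.Z.mul x.1 y.1) (BinInt.Z.mul x.2 y.2),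
   BinInt.Z.sub (BinInt.Z.add (BinInt.Z.mul x.1 y.2) (BinInt.Z.mul x.2 y.1))
     (BinInt.Z.mul x.2 y.2)).
Definition econj (x : eis) : eis := (BinInt.Z.sub x.1 x.2, BinInt.Z.opp x.2).
Definition eeq (x y : eis) : bool :=
  BinInt.Z.eqb x.1 y.1 && BinInt.Z.eqb x.2 y.2.
Definition ezeta (a : nat) : eis := nth e0 [:: e1; zi (0) (1); zi (-1) (-1)] a.
Definition eunit (u : nat) : eis :=
  nth e0 [:: e1; zi (1) (1); zi (0) (1); zi (-1) (0); zi (-1) (-1); zi (0) (-1)] u.

Definition evadd (x y : seq eis) : seq eis := [seq eadd p.1 p.2 | p <- zip x y].
Definition evscale (a : eis) (x : seq eis) : seq eis := map (emul a) x.
Definition evconj (x : seq eis) : seq eis := map econj x.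
Definition eveq (x y : seq eis) : bool := all2 eeq x y.
Definition edot (x y : seq eis) : eis :=
  foldr (fun p s => eadd (emul p.1 p.2) s) e0 (zip x y).

(* The forms of [ST_forms], the coordinate forms being scaled by            *)
(* zeta3 - zeta3^2 so that all roots have norm 3.                           *)
Definition eforms_def (g : ST_type) : seq (seq eis) :=
  [seq [seq (if i == j then zi (1) (2) else e0) | j <- iota 0 (ST_rank g)]
     | i <- iota 0 (ST_rank g)] ++
  match g with
  | G25 => [seq [:: e1; ezeta a; ezeta b] | a <- iota 0 3, b <- iota 0 3]
  | G32 => flatten [seq
      [:: [:: e0; e1; eopp (ezeta p.1); ezeta p.2];
          [:: eopp e1; e0; ezeta p.1; ezeta p.2];
          [:: e1; eopp (ezeta p.1); e0; ezeta p.2];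
          [:: e1; ezeta p.1; ezeta p.2; e0]]
      | p <- [seq (a, b) | a <- iota 0 3, b <- iota 0 3]]
  end.

Definition eforms25 := Eval vm_compute in eforms_def G25.
Definition eforms32 := Eval vm_compute in eforms_def G32.
Definition eforms g := if g is G25 then eforms25 else eforms32.
Lemma eformsE g : eforms g = eforms_def g.
Proof. by case: g. Qed.

Definition nmir (g : ST_type) : nat := if g is G25 then 12 else 40.

Definition eform g i := nth [::] (eforms g) i.
Definition eroot g i := evconj (eform g i).
Definition egram g i j := edot (eform g i) (eroot g j).
Definition eone_sub (c : bool) : eis := if c then zi (1) (-1) else zi (2) (1).

(* 3 times the image of the root j by the reflection with root i and         *)
(* eigenvalue zeta3 (c = true) or zeta3^2 (c = false)                        *)
Definition erefl3 g (c : bool) i j : seq eis :=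
  evadd (evscale e3 (eroot g j))
        (evscale (eopp (emul (eone_sub c) (egram g i j))) (eroot g i)).

Definition alln (N : nat) (P : nat -> bool) : bool := all P (iota 0 N).
Lemma allnP N (P : pred nat) : reflect (forall i, (i < N)%N -> P i) (alln N P).
Proof.
apply: (iffP allP) => H i; last by rewrite mem_iota => /H.
by move=> iN; apply: H; rewrite mem_iota.
Qed.
Definition allb (P : bool -> bool) : bool := P true && P false.
Lemma allbP (P : pred bool) : reflect (forall c, P c) (allb P).
Proof.
by apply: (iffP andP) => [[? ?] []|H] //; split; apply: H.
Qed.

(** The factor 3 matches the cleared denominator of [erefl3]; the label is the mirror with the
    exponent of the unit. *)
Definition cands g : seq ((nat * nat) * seq eis) :=
  let R := map evconj (eforms g) in
  flatten [seq [seq ((k, u), evscale (emul e3 (eunit u)) (nth [::] R k))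
     | u <- iota 0 6] | k <- iota 0 (nmir g)].
(** A failed search returns (0, 0); [chk_act] rules out any wrong entry that this would produce. *)
Fixpoint ksearch (C : seq ((nat * nat) * seq eis)) (v : seq eis) : nat * nat :=
  if C is (ku, w) :: C' then (if eveq v w then ku else ksearch C' v)
  else (0, 0)%N.

(** Written with [if] so that evaluation stops at the first success. *)
Fixpoint hasl (A : Type) (P : A -> bool) (s : seq A) : bool :=
  if s is x :: s' then (if P x then true else hasl P s') else false.
Lemma haslE A (P : A -> bool) s : hasl P s = has P s.
Proof. by elim: s => //= x s ->. Qed.

Record table := Table {
  tN : nat;
  tact : seq (seq (seq (nat * nat)));  (* [c; i; j] |-> (k, u) *)
  torth : seq (seq bool);
  tmap : seq (seq (seq nat)) (* [c; j; k] |-> i *)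
}.
Definition b2i (c : bool) : nat := if c then 1 else 0.
Definition tac T c i j : nat * nat :=
  nth (0, 0)%N (nth [::] (nth [::] (tact T) (b2i c)) i) j.
Definition tor T i j : bool := nth false (nth [::] (torth T) i) j.
Definition tmp T c j k : nat := nth 0%N (nth [::] (nth [::] (tmap T) (b2i c)) j) k.

(** This only proposes the entries; the [chk_] booleans below certify them. *)
Definition mktable g : table :=
  let N := nmir g in
  let F := eforms g in
  let R := map evconj F in
  let C := cands g in
  let G := [seq [seq edot f r | r <- R] | f <- F] in
  let A := [seq [seq [seq ksearch C
      (evadd (evscale e3 ajr)
        (evscale (eopp (emul (eone_sub c) aig.2)) ai.1))
       | '(ajr, aig) <- zip R [seq (ai.1, y) | y <- ai.2]]
       | ai <- zip R G]
       | c <- [:: false; true]] in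
  let O := [seq [seq eeq x e0 | x <- r] | r <- G] in
  let M := [seq [seq [seq
       find (fun r => (nth (0, 0)%N r j).1 == k) Ac
       | k <- iota 0 N] | j <- iota 0 N] | Ac <- A] in
  Table N A O M.

Definition tableG25 := Eval vm_compute in mktable G25.
Definition tableG32 := Eval vm_compute in mktable G32.
Definition tab g : table := if g is G25 then tableG25 else tableG32.

(* Unlike [==>] and [||], these do not evaluate their second argument        *)
(* when the first one decides, which the virtual machine would do.           *)
Local Notation "a ===> b" := (if a then b else true)
  (at level 55, right associativity, only parsing).
Local Notation "a ||| b" := (if a then true else b)
  (at level 50, left associativity, only parsing).
(* The table is sealed: unification must not evaluate it. *)
Lemma stab_sig g : {T : table | T = tab g}. Proof. by exists (tab g). Qed.
Definition stab g := sval (stab_sig g).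
Lemma stabE g : stab g = tab g. Proof. exact: (svalP (stab_sig g)). Qed.

Section Checks.
Variables (g : ST_type) (T : table).
Let N := nmir g.
(* The reflection of root i and class c maps the root j to the unit number   *)
(* un c i j times the root sg c i j; rfi c j k is the root of the reflection *)
(* of class c mapping the mirror j to the mirror k.                          *)
Definition sg c i j : nat := (tac T c i j).1.
Definition un c i j : nat := (tac T c i j).2.
Definition og i j : bool := tor T i j.
Definition rfi c j k : nat := tmp T c j k.
Definition tnon i j : bool := (i != j) && ~~ og i j.

Definition chk_size : bool :=
  (size (eforms g) == N) && all (fun s => size s == ST_rank g) (eforms g).
Definition chk_act : bool :=
  allb (fun c => alln N (fun i => alln N (fun j =>
    [&& eveq (erefl3 g c i j)
          (evscale (emul e3 (eunit (un c i j))) (eroot g (sg c i j))),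
        (sg c i j < N)%N & (un c i j < 6)%N]))).
Definition chk_gram : bool :=
  alln N (fun i => alln N (fun j =>
    (og i j == eeq (egram g i j) e0) &&
    (if i == j then eeq (egram g i j) e3
     else og i j || eeq (emul (egram g i j) (econj (egram g i j))) e3))).
(** This determines the index set of the sum in (B5): one reflection of each class between
    non-orthogonal mirrors, none between orthogonal ones. *)
Definition chk_rf : bool :=
  alln N (fun j => alln N (fun k => allb (fun c =>
    if j == k then true else
    if og j k then alln N (fun i => sg c i j != k)
    else (rfi c j k < N)%N &&
         alln N (fun i => (sg c i j == k) == (i == rfi c j k))))).
(** Configuration behind the generators of K_B that swap two mirrors X and Y: the second condition
    gives the mirror Q of [Q_tr], and the third one the value of chi_B. *)
Definition chk_I2 : bool :=
  alln N (fun X => alln N (fun Y => og X Y ===> alln N (fun G =>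
    tnon X G && tnon Y G ===> allb (fun c =>
      let s := rfi c X G in let t := rfi (~~ c) Y G in
      (sg c s Y == sg (~~ c) t X) &&
      og (sg c s Y) (sg (~~ c) (rfi (~~ c) X G) Y) &&
      (((un c s X + un c s Y) %% 6 ==
        (un (~~ c) t X + un (~~ c) t Y) %% 6)%N))))).
(** Configuration behind the generators of K_B that permute X, Y, Z cyclically; the last line bounds
    by three the members of a collection that are non-transverse to G. *)
Definition chk_I3 : bool :=
  alln N (fun X => alln N (fun Y => og X Y ===> alln N (fun Z =>
    og X Z && og Y Z ===> alln N (fun G =>
    [&& tnon X G, tnon Y G & tnon Z G] ===> (allb (fun c =>
      let s := rfi c X G in let t := rfi c Y G in
      [&& sg c s Y == sg c t Z, sg c s Z == sg c t X &
       (un c s X + un c s Y + un c s Z) %% 6 ==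
        (un c t X + un c t Y + un c t Z) %% 6]%N) &&
      alln N (fun V => [&& og V X, og V Y & og V Z] ===> ~~ tnon V G)))))).
(** Input of (B4) when the same two mirrors obstruct G1 and G2. The two products of reflections are
    compared on the first [ST_rank g] roots only, which are multiples of the coordinate vectors. *)
Definition chk_T2 : bool :=
  alln N (fun X => alln N (fun Y => og X Y ===> alln N (fun G1 =>
    tnon X G1 && tnon Y G1 ===> alln N (fun G2 =>
      [&& og G1 G2, tnon X G2 & tnon Y G2] ===>
      (sg true (rfi true X G2) Y == G1) ||| (sg false (rfi false X G2) Y == G1)
      ||| allb (fun c =>
         let s := rfi c X G2 in let t1 := rfi c Y G1 in
         let Y' := sg c s Y in let X' := sg c t1 X in
         let t := rfi (~~ c) Y' G1 in let s1 := rfi (~~ c) X' G2 in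
         [&& tnon Y' G1, tnon X' G2 &
          alln (ST_rank g) (fun j =>
           let j1 := sg c s j in let j2 := sg c t1 j in
           (sg (~~ c) t j1 == sg (~~ c) s1 j2) &&
           ((un c s j + un (~~ c) t j1) %% 6 ==
            (un c t1 j + un (~~ c) s1 j2) %% 6)%N)]))))).
Definition chk_T3 : bool :=
  alln N (fun X => alln N (fun Y => og X Y ===> alln N (fun Z =>
    og X Z && og Y Z ===> alln N (fun G1 =>
    [&& tnon X G1, tnon Y G1 & tnon Z G1] ===> alln N (fun G2 =>
    [&& og G1 G2, tnon X G2, tnon Y G2 & tnon Z G2] ===>
    allb (fun c => let s := rfi c X G2 in
      (sg c s Y == G1) || (sg c s Z == G1))))))).
(** Every mirror is two non-transverse steps away from mirror 0; transitivity of W on the mirrors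
    and the constancy of eigenvalues in [mono_scalar] come from this. *)
Definition chk_conn : bool :=
  alln N (fun j => has (fun k => tnon 0 k && tnon k j) (iota 0 N)).

(* A reflection sending the root j to eunit u times the root k <> j is      *)
(* x |-> x - <v, x> v / d, v being the difference of the two vectors and d   *)
(* the product of the second one by v.                                       *)
Definition chk_class : bool :=
  let F := eforms g in let R := map evconj F in
  alln N (fun j => alln N (fun k => (j == k) ||| alln 6 (fun u =>
    let aj := nth [::] R j in let uk := evscale (eunit u) (nth [::] R k) in
    let v := evadd uk (evscale (eopp e1) aj) in
    let vc := evconj v in
    let d := edot (evconj uk) v in
    let z := eadd d (eopp (edot vc v)) in
    let cube x := emul x (emul x x) in
    let n := (emul (econj d) d).1 in
    if eeq d e0 then false else ~~ eeq (cube z) (cube d) |||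
    hasl (fun c => hasl (fun i => (sg c i j == k) && (un c i j == u))
      (iota 0 N)) [:: true; false] |||
    hasl (fun x =>
      let y := evadd (evscale d x) (evscale (eopp (edot vc x)) v) in
      hasl (fun yp => let q := emul (econj d) yp in
        ~~ (BinInt.Z.eqb (BinInt.Z.modulo q.1 n) (Z_of_int 0) &&
            BinInt.Z.eqb (BinInt.Z.modulo q.2 n) (Z_of_int 0))) y) R))).
End Checks.

Lemma chk_sizeT g : chk_size g. Proof. by case: g; vm_compute. Qed.
Lemma chk_actT g : chk_act g (stab g). Proof. by rewrite stabE; case: g; vm_compute. Qed.
Lemma lazy_if (a b : bool) : a -> (if a then b else true) -> b.
Proof. by move=> ->. Qed.

Lemma chk_gramT g : chk_gram g (stab g). Proof. by rewrite stabE; case: g; vm_compute. Qed.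
Lemma chk_rfT g : chk_rf g (stab g). Proof. by rewrite stabE; case: g; vm_compute. Qed.
Lemma chk_I2T g : chk_I2 g (stab g). Proof. by rewrite stabE; case: g; vm_compute. Qed.
Lemma chk_I3T g : chk_I3 g (stab g). Proof. by rewrite stabE; case: g; vm_compute. Qed.
Lemma chk_T2T g : chk_T2 g (stab g). Proof. by rewrite stabE; case: g; vm_compute. Qed.
Lemma chk_T3T g : chk_T3 g (stab g). Proof. by rewrite stabE; case: g; vm_compute. Qed.
Lemma chk_connT g : chk_conn g (stab g). Proof. by rewrite stabE; case: g; vm_compute. Qed.
Lemma chk_classT g : chk_class g (stab g). Proof. by rewrite stabE; case: g; vm_compute. Qed.

(** * Complex values of Eisenstein integers *)

Section EisensteinValues.
Variable C : numClosedFieldType.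
Local Notation w := (zeta3 C).

Lemma conj_zeta3 : w^* = - 1 - w.
Proof.
have r3 : (sqrtC 3 : C)^* = sqrtC 3.
  by apply: CrealP; rewrite realE sqrtC_ge0 ler0n.
rewrite /zeta3 fmorph_div rmorphD rmorphM rmorphN rmorph1 rmorph_nat /=.
  rewrite conjCi r3.
by field.
Qed.

Lemma zeta3_sq : w ^+ 2 = - 1 - w.
Proof.
have i2 : ('i : C) ^+ 2 = -1 by rewrite sqrCi.
have r2 : (sqrtC 3 : C) ^+ 2 = 3 by rewrite sqrtCK.
rewrite /zeta3 expr_div_n sqrrD sqrrN expr1n exprMn i2 r2.
by field.
Qed.

Lemma zeta3_mul : w * w = - 1 - w.
Proof. by rewrite -expr2 zeta3_sq. Qed.

Lemma zeta3_cube : w ^+ 3 = 1.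
Proof. by rewrite exprS zeta3_sq mulrBr mulrN1 zeta3_mul; ring. Qed.

Definition zofZ (z : BinNums.Z) : C := (int_of_Z z)%:~R.
Lemma zofZD x y : zofZ (BinInt.Z.add x y) = zofZ x + zofZ y.
Proof. by rewrite /zofZ -intrD -[RHS]/(_%:~R); congr (_%:~R); exact: (rmorphD int_of_Z). Qed.
Lemma zofZM x y : zofZ (BinInt.Z.mul x y) = zofZ x * zofZ y.
Proof. by rewrite /zofZ -intrM; congr (_%:~R); exact: (rmorphM int_of_Z). Qed.
Lemma zofZN x : zofZ (BinInt.Z.opp x) = - zofZ x.
Proof. by rewrite /zofZ -mulrNz; congr (_%:~R); exact: (rmorphN int_of_Z). Qed.
Lemma zofZB x y : zofZ (BinInt.Z.sub x y) = zofZ x - zofZ y.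
Proof. by rewrite -zofZN -zofZD. Qed.
Lemma zofZ_inj x y : zofZ x = zofZ y -> x = y.
Proof. by move/intr_inj/(can_inj int_of_ZK). Qed.
Lemma zofZ_int a : zofZ (Z_of_int a) = a%:~R.
Proof. by rewrite /zofZ Z_of_intK. Qed.
Lemma zofZ_conj x : (zofZ x)^* = zofZ x.
Proof. exact: rmorph_int. Qed.

Definition evc (x : eis) : C := zofZ x.1 + zofZ x.2 * w.

Lemma evcD x y : evc (eadd x y) = evc x + evc y.
Proof. by rewrite /evc /= !zofZD; ring. Qed.
Lemma evcN x : evc (eopp x) = - evc x.
Proof. by rewrite /evc /= !zofZN; ring. Qed.
Lemma evcM x y : evc (emul x y) = evc x * evc y.
Proof.
rewrite /evc /= !(zofZB, zofZD, zofZM).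
move: (zofZ x.1) (zofZ x.2) (zofZ y.1) (zofZ y.2) => a b c d.
transitivity (a * c + (a * d + b * c) * w + b * d * (w * w)); last by ring.
by rewrite zeta3_mul; ring.
Qed.
Lemma evc_conj x : evc (econj x) = (evc x)^*.
Proof.
rewrite /evc /= rmorphD rmorphM /= !zofZ_conj conj_zeta3 zofZB zofZN; ring.
Qed.
Lemma evc_zi a b : evc (zi a b) = a%:~R + b%:~R * w.
Proof. by rewrite /evc /= !zofZ_int. Qed.
Lemma evc0 : evc e0 = 0. Proof. by rewrite evc_zi mul0r addr0. Qed.
Lemma evc1 : evc e1 = 1. Proof. by rewrite evc_zi mul0r addr0. Qed.
Lemma evc3 : evc e3 = 3. Proof. by rewrite evc_zi mul0r addr0. Qed.

Lemma eeqP x y : reflect (x = y) (eeq x y).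
Proof.
case: x y => [a b] [c d]; rewrite /eeq /=.
by apply: (iffP andP) => [[/BinInt.Z.eqb_eq-> /BinInt.Z.eqb_eq->]//|[-> ->]];
  rewrite !BinInt.Z.eqb_refl.
Qed.

(** Four times the norm of a + b zeta3 is (2a - b)^2 + 3 b^2, which vanishes only for a = b = 0. *)
Lemma evc_eq0 x : evc x = 0 -> x = e0.
Proof.
move=> x0; have nx0 : evc (emul x (econj x)) = 0 by rewrite evcM x0 mul0r.
case: x x0 nx0 => [a b] x0.
rewrite evcM evc_conj /evc /= rmorphD rmorphM /= !zofZ_conj conj_zeta3.
set A := zofZ a; set B := zofZ b => /(congr1 ( *%R 4)).
have -> : 4 * ((A + B * w) * (A + B * (-1 - w))) =
          (2 * A - B) ^+ 2 + 3 * B ^+ 2.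
  transitivity ((2 * A - B) ^+ 2 + B * B * (- 1 - 4 * w - 4 * (w * w))).
    by ring.
  by rewrite zeta3_mul; ring.
have AR : (2 * A - B) \is Num.real.
  by rewrite rpredB ?rpredM ?rpred_nat // /A /B /zofZ ?rpred_int.
have BR : B \is Num.real by rewrite /B /zofZ rpred_int.
move=> /eqP; rewrite mulr0 paddr_eq0; last 2 first.
- by rewrite real_exprn_even_ge0.
- by rewrite mulr_ge0 ?ler0n ?real_exprn_even_ge0.
rewrite [X in _ && X]mulf_eq0 pnatr_eq0 /= !expf_eq0 /= => /andP[/eqP h /eqP B0].
have A0 : A = 0.
  by move/eqP: h; rewrite B0 subr0 mulf_eq0 pnatr_eq0 => /eqP.
have z0 : zofZ (Z_of_int 0) = 0 by rewrite zofZ_int.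
congr (_, _); apply: zofZ_inj; by rewrite z0.
Qed.

Lemma evc_inj : injective evc.
Proof.
move=> x y xy; have /evc_eq0: evc (eadd x (eopp y)) = 0.
  by rewrite evcD evcN xy subrr.
case: x y {xy} => [a b] [c d] [].
rewrite !BinInt.Z.add_opp_r.
by move=> /BinInt.Zminus_eq -> /BinInt.Zminus_eq ->.
Qed.

Lemma evc_eeq x y : (evc x == evc y) = eeq x y.
Proof. by apply/eqP/eeqP => [/evc_inj|->]. Qed.

(* exp(i pi / 3) *)
Definition zeta6 : C := - w ^+ 2.
Lemma zeta6E : zeta6 = 1 + w. Proof. by rewrite /zeta6 zeta3_sq; ring. Qed.
Lemma zeta6_sq : zeta6 ^+ 2 = w.
Proof. by rewrite /zeta6 sqrrN -exprM exprS zeta3_cube mulr1. Qed.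
Lemma zeta6_cube : zeta6 ^+ 3 = -1.
Proof. by rewrite /zeta6 exprNn -exprM mulnC exprM zeta3_cube expr1n mulr1 -signr_odd. Qed.
Lemma zeta6_exp6 : zeta6 ^+ 6 = 1.
Proof. by rewrite (exprM _ 3 2) zeta6_cube sqrrN expr1n. Qed.
Lemma evc_unit u : (u < 6)%N -> evc (eunit u) = zeta6 ^+ u.
Proof.
case: u => [|[|[|[|[|[|//]]]]]] _; rewrite evc_zi.
- by rewrite mul0r addr0.
- by rewrite zeta6E expr1 mul1r.
- by rewrite zeta6_sq mul1r add0r.
- by rewrite zeta6_cube mul0r addr0.
- by rewrite exprS zeta6_cube zeta6E; ring.
- by rewrite (exprD _ 3 2) zeta6_cube zeta6_sq; ring.
Qed.
(** The six tabulated units are pairwise distinct, so the order of [zeta6], a divisor of 6, cannot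
    be smaller. *)
Lemma zeta6_prim : 6.-primitive_root zeta6.
Proof.
have inj : {in [pred u | (u < 6)%N] &, injective (fun u => zeta6 ^+ u)}.
  move=> u v; rewrite !inE => u6 v6.
  rewrite -!evc_unit // => /evc_inj/eeqP.
  by move: u v u6 v6; do 6?[case=> //]; do 6?[case=> //].
have [m mp m6] := prim_order_exists (isT : (0 < 6)%N) zeta6_exp6.
suff -> : 6%N = m by [].
apply/eqP; rewrite eqn_leq (dvdn_leq _ m6) // andbT leqNgt; apply/negP => m_lt.
have := prim_expr_order mp; rewrite -(expr0 zeta6) => /inj; rewrite !inE m_lt.
by move=> /(_ isT isT) m0; move: (prim_order_gt0 mp); rewrite m0.
Qed.
Lemma zeta6_neq0 : zeta6 != 0.
Proof. by apply/eqP => z0; move/eqP: zeta6_exp6; rewrite z0 expr0n eq_sym oner_eq0. Qed.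
Lemma three_neq0 : (3 : C) != 0. Proof. by rewrite pnatr_eq0. Qed.
Lemma evc_one_sub c : evc (eone_sub c) = 1 - w ^+ (if c then 1 else 2)%N.
Proof. by case: c; rewrite evc_zi ?zeta3_sq; ring. Qed.
Lemma evc_zeta a : (a < 3)%N -> evc (ezeta a) = w ^+ a.
Proof.
case: a => [|[|[|//]]] _; rewrite evc_zi ?zeta3_sq; try by ring.
Qed.

Lemma evadd_nth (x y : seq eis) i : size x = size y ->
  evc (nth e0 (evadd x y) i) = evc (nth e0 x i) + evc (nth e0 y i).
Proof.
move=> sxy; have [iy|iy] := ltnP i (size y); last first.
  rewrite !nth_default ?size_map ?size_zip ?sxy ?minnn //.
  by rewrite evc0 addr0.
by rewrite /evadd (nth_map (e0, e0)) ?size_zip ?sxy ?minnn // nth_zip // evcD.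
Qed.
Lemma evscale_nth a x i :
  evc (nth e0 (evscale a x) i) = evc a * evc (nth e0 x i).
Proof.
have [ix|ix] := ltnP i (size x); last first.
  by rewrite !nth_default ?size_map // evc0 mulr0.
by rewrite /evscale (nth_map e0) // evcM.
Qed.
Lemma evconj_nth x i : evc (nth e0 (evconj x) i) = (evc (nth e0 x i))^*.
Proof.
have [ix|ix] := ltnP i (size x); last first.
  by rewrite !nth_default ?size_map // evc0 rmorph0.
by rewrite /evconj (nth_map e0) // evc_conj.
Qed.
Lemma edot_sum n (x y : seq eis) : size x = n -> size y = n ->
  evc (edot x y) = \sum_(i < n) evc (nth e0 x i) * evc (nth e0 y i).
Proof.
elim: n x y => [|n IHn] [|a x] [|b y] //=; first by rewrite big_ord0 evc0.
by move=> [sx] [sy]; rewrite big_ord_recl /= evcD evcM -IHn.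
Qed.
Lemma eveqP x y : size x = size y ->
  reflect (forall i, evc (nth e0 x i) = evc (nth e0 y i)) (eveq x y).
Proof.
move=> sxy; apply: (iffP idP) => [|H].
  elim: x y sxy => [|a x IHx] [|b y] //= [sxy] /andP[/eeqP-> /(IHx _ sxy) H].
  by case.
elim: x y sxy H => [|a x IHx] [|b y] //= [sxy] H.
rewrite -evc_eeq (H 0%N) eqxx /=; apply: IHx => // i; exact: (H i.+1).
Qed.

Definition evec n (x : seq eis) : 'cV[C]_n := \col_i evc (nth e0 x i).
End EisensteinValues.

(** * Mirrors and reflections *)

(** The same block matrix is factored in two ways into triangular ones, with diagonal blocks 1 - ab
    in one case and 1 - ba in the other. *)
Lemma det_sub_rank1 (F : comNzRingType) n (a : 'cV[F]_n) (b : 'rV[F]_n) :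
  \det (1%:M - a *m b) = 1 - (b *m a) 0 0.
Proof.
have e1 : block_mx 1%:M (- a) 0 (1%:M : 'M_1) *m block_mx (1%:M - a *m b) 0 (- b) 1%:M
        = block_mx 1%:M (- a) (- b) 1%:M.
  rewrite mulmx_block !mul1mx !mul0mx !mulmx1 !add0r.
  by rewrite mulNmx mulmxN opprK subrK.
have e2 : block_mx 1%:M 0 (- b) (1%:M : 'M_1) *m
          block_mx 1%:M (- a) 0 (1%:M - b *m a) = block_mx 1%:M (- a) (- b) 1%:M.
  rewrite mulmx_block !mul1mx !mul0mx !mulmx1 !addr0.
  by rewrite mulNmx mulmxN opprK addrC subrK.
have := congr1 determinant e1; rewrite -[in RHS]e2 !det_mulmx.
rewrite !det_ublock !det_lblock !det1 !mul1r !mulr1 => ->.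
by rewrite det_mx11 !mxE eqxx.
Qed.

Lemma size_evscale a x : size (evscale a x) = size x.
Proof. exact: size_map. Qed.

Section HermitianForm.
Variables (C : numClosedFieldType) (n : nat).
Implicit Types x y : 'cV[C]_n.
Definition ip x y : C := (adj x *m y) 0 0.
Lemma ipE x y : ip x y = \sum_i (x i 0)^* * y i 0.
Proof. by rewrite /ip mxE; apply: eq_bigr => i _; rewrite !mxE. Qed.
Lemma ipDr x y z : ip x (y + z) = ip x y + ip x z.
Proof. by rewrite /ip mulmxDr mxE. Qed.
Lemma ipZr a x y : ip x (a *: y) = a * ip x y.
Proof. by rewrite /ip -scalemxAr mxE. Qed.
Lemma ip_conj x y : (ip x y)^* = ip y x.
Proof.
rewrite !ipE rmorph_sum; apply: eq_bigr => i _.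
by rewrite rmorphM /= conjCK mulrC.
Qed.
Lemma ipDl x y z : ip (x + y) z = ip x z + ip y z.
Proof. by rewrite -ip_conj ipDr rmorphD /= !ip_conj. Qed.
Lemma ipZl a x y : ip (a *: x) y = a^* * ip x y.
Proof. by rewrite -ip_conj ipZr rmorphM /= ip_conj. Qed.
Lemma ipNr x y : ip x (- y) = - ip x y.
Proof. by rewrite -scaleN1r ipZr mulN1r. Qed.
Lemma ipNl x y : ip (- x) y = - ip x y.
Proof. by rewrite -ip_conj ipNr rmorphN /= ip_conj. Qed.
Lemma ipBr x y z : ip x (y - z) = ip x y - ip x z.
Proof. by rewrite ipDr ipNr. Qed.
Lemma ipBl x y z : ip (x - y) z = ip x z - ip y z.
Proof. by rewrite ipDl ipNl. Qed.
Lemma ip0r x : ip x 0 = 0.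
Proof. by rewrite -(scale0r 0) ipZr mul0r. Qed.
Lemma ip_eq0 x : (ip x x == 0) = (x == 0).
Proof.
apply/eqP/eqP => [|->]; last by rewrite ip0r.
rewrite ipE => x0; apply/colP => i; rewrite mxE.
have ge0 j : true -> 0 <= (x j 0)^* * x j 0 by rewrite mulrC mul_conjC_ge0.
move: x0 => /eqP; rewrite (psumr_eq0 _ ge0) => /allP/(_ i).
rewrite mem_index_enum => /(_ isT) /=; rewrite mulrC mul_conjC_eq0.
by move/eqP.
Qed.
Lemma mulmx_ip x y z : x *m adj y *m z = ip y z *: x.
Proof. by rewrite -mulmxA [adj y *m z]mx11_scalar mul_mx_scalar. Qed.

Definition unitary (M : 'M[C]_n) := forall x y, ip (M *m x) (M *m y) = ip x y.
Definition refl_mx (v : 'cV[C]_n) (a : C) : 'M[C]_n := 1%:M - (a *: v) *m adj v.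
Lemma refl_mxE v a x : refl_mx v a *m x = x - (a * ip v x) *: v.
Proof. by rewrite mulmxBl mul1mx mulmx_ip scalerA mulrC. Qed.
Lemma det_refl_mx v a : \det (refl_mx v a) = 1 - a * ip v v.
Proof. by rewrite det_sub_rank1 -scalemxAr mxE. Qed.

(* A unitary matrix differing from the identity by a rank one matrix is      *)
(* determined by one vector that it moves.                                   *)
Lemma unitary_rank1 (M : 'M[C]_n) v0 b : unitary M ->
  (forall x : 'cV[C]_n, exists c, M *m x - x = c *: v0) ->
  ip (M *m b) (M *m b - b) != 0 ->
  M = refl_mx (M *m b - b) ((ip (M *m b) (M *m b - b))^-1).
Proof.
move=> uM M1; set v := M *m b - b => d0.
have Mx x : M *m x = refl_mx v ((ip (M *m b) v)^-1) *m x.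
  rewrite refl_mxE; have [c0 vE] := M1 b; rewrite -/v in vE.
  have [c xE] := M1 x.
  have c00 : c0 != 0.
    by apply: contraNneq d0 => c00; rewrite vE c00 scale0r ip0r.
  have {xE} xE : M *m x = x + (c / c0) *: v.
    by rewrite vE scalerA divfK // -xE addrC subrK.
  rewrite xE; congr (_ + _); rewrite -scaleNr; congr (_ *: _).
  have := uM b x; rewrite xE ipDr ipZr => /eqP.
  rewrite addrC -subr_eq0 -addrA -ipBl -/v => /eqP e.
  have -> : ip v x = - (c / c0 * ip (M *m b) v).
    by apply/eqP; rewrite -addr_eq0 addrC e.
  by rewrite mulrN opprK [RHS]mulrC mulfK.
apply/row_matrixP => i; apply/rowP=> j.
by have := congr1 (fun u : 'cV_n => u i 0) (Mx (delta_mx j 0));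
  rewrite -!colE !mxE.
Qed.
End HermitianForm.

Section Mirrors.
Variables (C : numClosedFieldType) (g : ST_type).
Local Notation n := (ST_rank g).
Local Notation N := (nmir g).
Local Notation w := (zeta3 C).
Local Notation z6 := (zeta6 C).
Local Notation og := (og (stab g)).
Local Notation sg := (sg (stab g)).
Local Notation un := (un (stab g)).
Local Notation tnon := (tnon (stab g)).

Definition rv i : 'cV[C]_n := evec C n (eroot g i).
Definition zc (c : bool) : C := w ^+ (if c then 1 else 2)%N.
Definition rfl c i : 'M[C]_n := refl_mx (rv i) ((1 - zc c) / 3).

Lemma size_eforms : size (eforms g) = N.
Proof. by have /andP[/eqP] := chk_sizeT g. Qed.
Lemma size_eform i : (i < N)%N -> size (eform g i) = n.
Proof.
move=> iN; have /andP[_ /allP h] := chk_sizeT g.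
by apply/eqP/h/mem_nth; rewrite size_eforms.
Qed.
Lemma size_eroot i : (i < N)%N -> size (eroot g i) = n.
Proof. by move=> iN; rewrite size_map size_eform. Qed.
Lemma rvE i (p : 'I_n) : rv i p 0 = evc C (nth e0 (eroot g i) p).
Proof. by rewrite mxE. Qed.
Lemma adj_rvE i (p : 'I_n) : adj (rv i) 0 p = evc C (nth e0 (eform g i) p).
Proof. by rewrite !mxE /eroot evconj_nth conjCK. Qed.
Lemma n_leN : (n <= N)%N. Proof. by case: g. Qed.
Lemma n_gt1 : (1 < n)%N. Proof. by case: g. Qed.
Lemma N_gt0 : (0 < N)%N. Proof. by case: g. Qed.

Lemma edot_ip (x y : seq eis) : size x = n -> size y = n ->
  evc C (edot (evconj x) y) = ip (evec C n x) (evec C n y).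
Proof.
move=> sx sy; rewrite (@edot_sum _ n) ?size_map // ipE; apply: eq_bigr => i _.
by rewrite !mxE evconj_nth.
Qed.
Lemma ip_rv i j : (i < N)%N -> (j < N)%N -> ip (rv i) (rv j) = evc C (egram g i j).
Proof.
move=> iN jN; rewrite (@edot_sum _ n) ?size_eform ?size_eroot // /ip mxE.
by apply: eq_bigr => p _; rewrite adj_rvE rvE.
Qed.
Lemma og_ip i j : (i < N)%N -> (j < N)%N -> og i j = (ip (rv i) (rv j) == 0).
Proof.
move=> iN jN; rewrite ip_rv // -(evc0 C) evc_eeq.
by have /allnP/(_ i iN)/allnP/(_ j jN)/andP[/eqP->] := chk_gramT g.
Qed.
Lemma og_sym i j : (i < N)%N -> (j < N)%N -> og i j = og j i.
Proof. by move=> iN jN; rewrite !og_ip // -(ip_conj (rv i)) conjC_eq0. Qed.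
Lemma rv_norm i : (i < N)%N -> ip (rv i) (rv i) = 3.
Proof.
move=> iN; rewrite ip_rv //.
have /allnP/(_ i iN)/allnP/(_ i iN)/andP[_] := chk_gramT g.
by rewrite eqxx => /eeqP->; rewrite evc3.
Qed.
Lemma rv_neq0 i : (i < N)%N -> rv i != 0.
Proof. by move=> iN; rewrite -ip_eq0 rv_norm // pnatr_eq0. Qed.
Lemma og_irrefl i : (i < N)%N -> og i i = false.
Proof. by move=> iN; rewrite og_ip // rv_norm // pnatr_eq0. Qed.
Lemma non_ip i j : (i < N)%N -> (j < N)%N -> tnon i j ->
  ip (rv i) (rv j) * ip (rv j) (rv i) = 3.
Proof.
move=> iN jN; rewrite -(ip_conj (rv i)) ip_rv //.
have /allnP/(_ i iN)/allnP/(_ j jN)/andP[_] := chk_gramT g.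
move=> h /andP[/negPf ne /negPf no]; move: h; rewrite ne no => /eeqP/(congr1 (evc C)).
by rewrite evcM evc_conj evc3.
Qed.

Lemma zc_sum c : zc c ^+ 2 + zc c + 1 = 0.
Proof.
case: c; rewrite /zc ?expr1 -?exprM; first by rewrite zeta3_sq; ring.
by rewrite (exprD _ 3 1) zeta3_cube zeta3_sq; ring.
Qed.
Lemma zc_conj c : (zc c)^* = zc (~~ c).
Proof.
case: c; rewrite /zc /= ?expr1 zeta3_sq; first exact: conj_zeta3.
by rewrite rmorphB rmorphN rmorph1 /= conj_zeta3; ring.
Qed.
Lemma zcN c : zc c * zc (~~ c) = 1.
Proof. by case: c; rewrite /zc -exprD zeta3_cube. Qed.
Lemma zcNE c : zc (~~ c) = - 1 - zc c.
Proof. by case: c; rewrite /zc /= ?expr1 zeta3_sq; ring. Qed.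
Lemma zc_neq1 c : zc c != 1.
Proof.
apply/eqP => c1; have /eqP := zc_sum c.
rewrite c1 expr1n; have -> : 1 + 1 + 1 = 3 :> C by ring.
by rewrite pnatr_eq0.
Qed.
Lemma zc_inj : injective zc.
Proof.
have h : zc true != zc false.
  apply/eqP => e; have := zcN true; have := zcNE true.
  rewrite /= -e => e2 e1; have : (3 : C) = 0.
    have -> : (3 : C) = 4 * (zc true * zc true) - 1 by rewrite e1; ring.
    have -> : 4 * (zc true * zc true) - 1 =
       (zc true - (- 1 - zc true)) * (2 * zc true - 1) :> C by ring.
    by rewrite -e2 subrr mul0r.
  by move/eqP; rewrite pnatr_eq0.
by move=> [] [] // /eqP; rewrite ?(negPf h) // eq_sym (negPf h).
Qed.

Lemma rflE c i x : rfl c i *m x = x - ((1 - zc c) / 3 * ip (rv i) x) *: rv i.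
Proof. exact: refl_mxE. Qed.
Lemma rfl_unitary c i : (i < N)%N -> unitary (rfl c i).
Proof.
move=> iN x y; rewrite !rflE !(ipBl, ipBr, ipZl, ipZr) rv_norm //.
rewrite !(rmorphM, rmorphB, fmorphV, rmorph1, rmorph_nat) /= ip_conj zc_conj zcNE.
have := zc_sum c; move: (zc c) (ip _ _) (ip _ _) (ip _ _) => z p q r z1.
transitivity (r - q * p / 3 * (z ^+ 2 + z + 1)); last by rewrite z1 mulr0 subr0.
by field.
Qed.
Lemma rfl_fix c i x : ip (rv i) x = 0 -> rfl c i *m x = x.
Proof. by move=> x0; rewrite rflE x0 mulr0 scale0r subr0. Qed.
Lemma rfl_root c i : (i < N)%N -> rfl c i *m rv i = zc c *: rv i.
Proof.
move=> iN; rewrite rflE rv_norm // divfK ?pnatr_eq0 // scalerBl scale1r.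
by rewrite opprB addrC subrK.
Qed.
Lemma det_rfl c i : (i < N)%N -> \det (rfl c i) = zc c.
Proof.
by move=> iN; rewrite det_refl_mx rv_norm // divfK ?pnatr_eq0 // opprB addrC subrK.
Qed.
Lemma rfl_rank1 c i x : exists a, rfl c i *m x - x = a *: rv i.
Proof.
exists (- ((1 - zc c) / 3 * ip (rv i) x)).
by rewrite rflE addrAC subrr add0r scaleNr.
Qed.

Lemma sg_lt c i j : (i < N)%N -> (j < N)%N -> (sg c i j < N)%N.
Proof.
move=> iN jN; have /allbP/(_ c)/allnP/(_ i iN)/allnP/(_ j jN) := chk_actT g.
by case/and3P.
Qed.
Lemma un_lt c i j : (i < N)%N -> (j < N)%N -> (un c i j < 6)%N.
Proof.
move=> iN jN; have /allbP/(_ c)/allnP/(_ i iN)/allnP/(_ j jN) := chk_actT g.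
by case/and3P.
Qed.
Lemma rfl_act c i j : (i < N)%N -> (j < N)%N ->
  rfl c i *m rv j = z6 ^+ un c i j *: rv (sg c i j).
Proof.
move=> iN jN; have uN := un_lt c iN jN; have kN := sg_lt c iN jN.
have /allbP/(_ c)/allnP/(_ i iN)/allnP/(_ j jN) := chk_actT g.
case/and3P=> /eveqP h _ _; apply/colP => p.
have {h} := h C; rewrite /erefl3 !size_map size_zip !size_map.
rewrite !size_eform // minnn => /(_ erefl p).
rewrite evadd_nth ?size_map ?size_eform // !evscale_nth evcN !evcM evc3.
rewrite evc_unit // evc_one_sub -ip_rv // -!rvE -/(zc c) => h.
have {}h : rv (sg c i j) p 0 * z6 ^+ un c i j =
  rv j p 0 - (1 - zc c) / 3 * ip (rv i) (rv j) * rv i p 0.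
  apply: (mulfI (three_neq0 C)); rewrite [X in 3 * X]mulrC mulrA -h.
  by field.
rewrite [RHS]mxE [RHS]mulrC h rflE; by rewrite !mxE.
Qed.

(** The conjugate of 1 + 2 zeta3, a square root of -3, by which the coordinate forms were scaled. *)
Definition theta : C := - 1 - 2 * w.
Lemma theta_neq0 : theta != 0.
Proof.
have : theta ^+ 2 = - 3.
  rewrite /theta; transitivity (1 + 4 * w + 4 * w ^+ 2); first by ring.
  by rewrite zeta3_sq; ring.
by apply: contra_eqN => /eqP->; rewrite expr0n eq_sym oppr_eq0 pnatr_eq0.
Qed.
Lemma eform_coord i : (i < n)%N ->
  eform g i = [seq (if i == j then zi 1 2 else e0) | j <- iota 0 n].
Proof.
move=> i_n; rewrite /eform eformsE nth_cat size_map size_iota i_n.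
by rewrite (nth_map 0%N) ?size_iota // nth_iota.
Qed.
Lemma rv_coord (i : 'I_n) : rv i = theta *: delta_mx i 0.
Proof.
apply/colP => p; rewrite rvE evconj_nth eform_coord // !mxE eqxx andbT.
rewrite (nth_map 0%N) ?size_iota // nth_iota // add0n (inj_eq val_inj) eq_sym.
case: eqP => _; last by rewrite evc0 rmorph0 mulr0.
rewrite mulr1 evc_zi rmorphD rmorphM /= !rmorph_int conj_zeta3 /theta; ring.
Qed.
Lemma mx_ext (M M' : 'M[C]_n) :
  (forall i, (i < n)%N -> M *m rv i = M' *m rv i) -> M = M'.
Proof.
move=> h; apply/matrixP => i j; have := h j (ltn_ord j).
rewrite rv_coord -!scalemxAr => /(scalerI theta_neq0)/colP/(_ i).
by rewrite -!colE !mxE.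
Qed.

Definition fvec (s : seq eis) : 'rV[C]_n := \row_j evc C (nth e0 s j).
Lemma fvec_eform i : fvec (eform g i) = adj (rv i).
Proof. by apply/rowP => p; rewrite adj_rvE mxE. Qed.
Lemma rowseq_evc s : rowseq n (map (evc C) s) = fvec s.
Proof.
apply/rowP => p; rewrite !mxE; have [ps|ps] := ltnP p (size s).
  by rewrite (nth_map e0).
by rewrite !nth_default ?size_map ?evc0.
Qed.
(** A reflection does not depend on the scale of its form, so the normalisation of the roots to norm
    3 is harmless. *)
Lemma hrefl_rv a k i : (i < N)%N -> k != 0 ->
  hrefl (k *: adj (rv i)) a = refl_mx (rv i) ((1 - a) / 3).
Proof.
move=> iN k0; rewrite /hrefl /refl_mx.
have adjZ (x : C) p q (A : 'M[C]_(p, q)) : adj (x *: A) = x^* *: adj A.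
  by apply/matrixP => s t; rewrite !mxE rmorphM.
have adjK p q (A : 'M[C]_(p, q)) : adj (adj A) = A.
  by apply/matrixP => s t; rewrite !mxE conjCK.
rewrite adjZ adjK -!scalemxAl -!scalemxAr !scalerA; congr (_ - _ *: _).
rewrite mxE -/(ip _ _) rv_norm // ; field.
by rewrite k0 conjC_eq0 k0.
Qed.
Definition form_scale (i : nat) : C := if (i < n)%N then (theta^*)^-1 else 1.
Lemma form_scale_neq0 i : form_scale i != 0.
Proof.
by rewrite /form_scale; case: ifP; rewrite ?oner_eq0 // invr_eq0 conjC_eq0 theta_neq0.
Qed.
Lemma ST_formsE : ST_forms C g = [seq form_scale i *: adj (rv i) | i <- iota 0 N].
Proof.
have -> : iota 0 N = iota 0 n ++ iota n (N - n) by rewrite -iotaD subnKC ?n_leN.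
rewrite /ST_forms map_cat; congr (_ ++ _).
  rewrite -val_enum_ord -map_comp; apply: eq_map => i /=.
  rewrite /form_scale ltn_ord rv_coord; apply/rowP => p.
  rewrite !mxE rmorphM mulrA mulVf ?conjC_eq0 ?theta_neq0 // mul1r eqxx andbT.
  by rewrite rmorph_nat.
transitivity (map fvec (drop n (eforms g))); last first.
  rewrite -[drop n _](@take_oversize _ (N - n)); last first.
    by rewrite size_drop size_eforms.
  rewrite -(map_nth_iota [::]) ?size_eforms ?subnKC ?n_leN // -map_comp.
  apply/eq_in_map => i; rewrite mem_iota => /andP[ni _] /=.
  by rewrite -fvec_eform /form_scale ltnNge ni scale1r.
rewrite eformsE /eforms_def drop_size_cat ?size_map ?size_iota //.
rewrite -(eq_map rowseq_evc); case: g.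
  rewrite map_allpairs; apply/eq_in_allpairs => a b.
  rewrite !mem_iota => a3 b3; congr (rowseq _ _).
  by rewrite /= evc1 !evc_zeta.
rewrite [RHS]map_flatten -[in RHS]map_comp; congr flatten; apply/eq_in_map => p.
case/allpairsP=> -[a b] []; rewrite !mem_iota => a3 b3 ->.
by rewrite /= evc0 !evcN evc1 !evc_zeta.
Qed.
Lemma ST_gensP M :
  reflect (exists i c, (i < N)%N /\ M = rfl c i) (M \in ST_gens C g).
Proof.
have e2 c : map (fun l => hrefl l (zc c)) (ST_forms C g) = [seq rfl c i | i <- iota 0 N].
  rewrite ST_formsE -map_comp; apply/eq_in_map => i; rewrite mem_iota => iN /=.
  by rewrite hrefl_rv // form_scale_neq0.
rewrite /ST_gens mem_cat (e2 true) (e2 false).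
apply: (iffP orP) => [h|[i [c [iN ->]]]]; last first.
  by case: c; [left|right]; apply/mapP; exists i; rewrite ?mem_iota.
have {h} [c] : exists c, M \in [seq rfl c i | i <- iota 0 N].
  by case: h => h; [exists true | exists false].
by move/mapP=> [i]; rewrite mem_iota => iN ->; exists i, c.
Qed.

(** This invariant of the elements of W replaces an enumeration of the group. *)
Definition mono (M : 'M[C]_n) := forall j, (j < N)%N ->
  exists k u, [/\ (k < N)%N, (u < 6)%N & M *m rv j = z6 ^+ u *: rv k].
Lemma mono_rfl c i : (i < N)%N -> mono (rfl c i).
Proof.
by move=> iN j jN; exists (sg c i j), (un c i j); rewrite rfl_act ?sg_lt ?un_lt.
Qed.
Lemma z6_mod u : z6 ^+ (u %% 6) = z6 ^+ u.
Proof. by rewrite -[RHS](expr_mod _ (zeta6_exp6 C)). Qed.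
Lemma mono1 : mono 1%:M.
Proof. by move=> j jN; exists j, 0%N; rewrite mul1mx scale1r. Qed.
Lemma monoM M M' : mono M -> mono M' -> mono (M *m M').
Proof.
move=> m m' j /m'[k [u [kN u6 e]]]; have [l [v [lN v6 e']]] := m k kN.
exists l, ((u + v) %% 6)%N; split; rewrite ?ltn_pmod //.
by rewrite -mulmxA e -scalemxAr e' scalerA -exprD z6_mod.
Qed.
Lemma unitary1 : unitary (1%:M : 'M[C]_n).
Proof. by move=> x y; rewrite !mul1mx. Qed.
Lemma unitaryM (M M' : 'M[C]_n) : unitary M -> unitary M' -> unitary (M *m M').
Proof. by move=> m m' x y; rewrite -!mulmxA m m'. Qed.

(** If every mirror is fixed, each root is an eigenvector; unitarity forces equal eigenvalues on two
    non-orthogonal roots, and [chk_conn] propagates the equality to all of them. *)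
Lemma mono_scalar M : mono M -> unitary M ->
  (forall j k u, (j < N)%N -> (k < N)%N -> (u < 6)%N ->
     M *m rv j = z6 ^+ u *: rv k -> k = j) -> exists z, M = z%:M.
Proof.
move=> mM uM diag.
have ev j : (j < N)%N -> exists z, M *m rv j = z *: rv j.
  move=> jN; have [k [u [kN u6 e]]] := mM j jN.
  by exists (z6 ^+ u); rewrite e (diag _ _ _ jN kN u6 e).
have step j k a b : (j < N)%N -> (k < N)%N -> tnon j k ->
    M *m rv j = a *: rv j -> M *m rv k = b *: rv k -> a = b.
  move=> jN kN /andP[_]; rewrite og_ip // => jk aE bE.
  have := uM (rv j) (rv j); rewrite aE ipZl ipZr rv_norm // mulrA => /eqP.
  rewrite -subr_eq0 -{2}[3]mul1r -mulrBl mulf_eq0 pnatr_eq0 orbF subr_eq0 => /eqP aa.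
  have := uM (rv j) (rv k); rewrite aE bE ipZl ipZr mulrA => /eqP.
  rewrite -subr_eq0 -{2}[ip _ _]mul1r -mulrBl mulf_eq0 (negPf jk) orbF.
  rewrite subr_eq0 => /eqP ab.
  have a0 : a^* != 0 by apply: contra_eqN aa => /eqP->; rewrite mul0r eq_sym oner_eq0.
  by apply: (mulfI a0); rewrite ab.
have [z z0] := ev 0%N N_gt0; exists z; apply: mx_ext => i i_n.
have iN := leq_trans i_n n_leN; have [b bE] := ev i iN.
have /allnP/(_ i iN)/hasP[k] := chk_connT g; rewrite mem_iota => kN /andP[k0 ki].
have [a aE] := ev k kN.
by rewrite bE mul_scalar_mx -(step _ _ _ _ kN iN ki aE bE) (step _ _ _ _ N_gt0 kN k0 z0 aE).
Qed.

(** W has no reflection besides the listed ones. If M moves a mirror, [unitary_rank1] recovers it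
    from the image of one root, and [chk_class] examines all candidates: each has a wrong
    determinant, is listed, or sends some root outside the Eisenstein lattice. If M moves no mirror,
    it is scalar, hence the identity. *)
Lemma mono_classify M : mono M -> unitary M -> \det M ^+ 3 = 1 ->
  (exists v0, forall x : 'cV[C]_n, exists a, M *m x - x = a *: v0) -> M != 1%:M ->
  exists i c, (i < N)%N /\ M = rfl c i.
Proof.
move=> mM uM dM [v0 M1] Mn1.
have [[j [k [u [jN kN u6 kj jE]]]]|scal] := EM (exists j k u,
    [/\ (j < N)%N, (k < N)%N, (u < 6)%N, k <> j & M *m rv j = z6 ^+ u *: rv k]);
  last first.
  have [z zE] : exists z, M = z%:M.
    apply: mono_scalar => // j k u jN kN u6 e; apply: contrapT => kj.
    by apply: scal; exists j, k, u.
  case/negP: Mn1; apply/eqP.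
  have z1 : z = 1.
    (* For z <> 1 the image of M - 1 would be the whole space, which has dimension at least 2,
       against the rank one hypothesis. *)
    apply/eqP/negPn/negP => z1; have zn : z - 1 != 0 by rewrite subr_eq0.
    have dE (i : 'I_n) : exists a, delta_mx i 0 = a *: v0.
      have [a aE] := M1 (delta_mx i 0); exists ((z - 1)^-1 * a).
      rewrite -scalerA -aE zE mul_scalar_mx.
      have -> : z *: delta_mx i 0 - delta_mx i 0 = (z - 1) *: delta_mx i 0 :> 'cV_n.
        by rewrite scalerBl scale1r.
      by rewrite scalerA mulVf // scale1r.
    have [a aE] := dE (Ordinal (ltnW n_gt1)); have [b bE] := dE (Ordinal n_gt1).
    have := congr1 (fun x : 'cV_n => x (Ordinal n_gt1) 0) aE.
    have := congr1 (fun x : 'cV_n => x (Ordinal (ltnW n_gt1)) 0) aE.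
    have := congr1 (fun x : 'cV_n => x (Ordinal n_gt1) 0) bE.
    rewrite !mxE !eqxx -!val_eqE /= => b1 a0 a1.
    move/eqP: a1; rewrite eq_sym mulf_eq0 => /orP[/eqP a00|/eqP v10].
      by move/eqP: a0; rewrite a00 mul0r oner_eq0.
    by move/eqP: b1; rewrite v10 mulr0 oner_eq0.
  by rewrite zE z1.
have /allnP/(_ j jN)/allnP/(_ k kN) := chk_classT g.
have /negPf-> : j != k by apply/eqP => jk; apply: kj.
move=> /allnP/(_ u u6).
set F := eforms g; set R := map evconj F.
pose aj := nth [::] R j; pose uk := evscale (eunit u) (nth [::] R k).
pose v := evadd uk (evscale (eopp e1) aj); pose d := edot (evconj uk) v.
pose z := eadd d (eopp (edot (evconj v) v)); pose m := (emul (econj d) d).1.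
cbv zeta; rewrite -/aj -/uk -/v -/d -/z -/m.
have Rn i : (i < N)%N -> nth [::] R i = eroot g i.
  by move=> iN; rewrite (nth_map [::]) // size_eforms.
have sR i : (i < N)%N -> size (nth [::] R i) = n.
  by move=> iN; rewrite Rn // size_eroot.
have suk : size uk = n by rewrite size_map sR.
have sv : size v = n by rewrite /v !size_map size_zip suk size_map sR // minnn.
have ukE : evec C n uk = M *m rv j.
  apply/colP => p; rewrite jE !mxE evscale_nth evc_unit // Rn //.
have vE : evec C n v = M *m rv j - rv j.
  apply/colP => p; rewrite -ukE !mxE evadd_nth ?size_map ?suk ?sR //.
  by rewrite [X in _ + X]evscale_nth evcN evc1 mulN1r /aj Rn.
have dE : evc C d = ip (M *m rv j) (M *m rv j - rv j).
  by rewrite edot_ip // vE ukE.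
case: (boolP (eeq d e0)) => // /eeqP d0.
have d_neq0 : evc C d != 0 by rewrite -(evc0 C) evc_eeq; apply/eeqP.
have ME := unitary_rank1 uM M1 (b := rv j); rewrite -dE in ME.
have {ME}ME := ME d_neq0; rewrite -vE in ME.
have zE : evc C z = evc C d * \det M.
  rewrite ME det_refl_mx evcD evcN edot_ip // mulrBr mulr1.
  by rewrite mulrA mulfV // mul1r.
case: (boolP (~~ _)) => [/eeqP cz _|_].
  case: cz; apply: (@evc_inj C); rewrite !evcM zE.
  transitivity (evc C d * (evc C d * evc C d) * \det M ^+ 3); first by ring.
  by rewrite dM mulr1.
case: ifP => [|_]; first rewrite haslE => /hasP[c _].
  rewrite haslE => /hasP[i]; rewrite mem_iota => iN /andP[/eqP sE /eqP uE] _.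
  exists i, c; split=> //.
  have e : rfl c i *m rv j = M *m rv j by rewrite rfl_act // sE uE jE.
  have r1 : forall x : 'cV[C]_n, exists a, rfl c i *m x - x = a *: rv i.
    by move=> x; apply: rfl_rank1.
  have := unitary_rank1 (rfl_unitary c iN) r1 (b := rv j).
  by rewrite e -dE -vE => /(_ d_neq0) ->.
rewrite haslE => /hasP[x /mapP[f /(nthP [::])[l lN <-] ->]].
rewrite size_eforms in lN; rewrite -/(eroot g l) haslE.
set y := evadd _ _ => /(hasP)[yp /(nthP e0)[p psy <-]].
have sy : size y = n.
  by rewrite size_map size_zip !size_evscale size_eroot // sv minnn.
rewrite sy in psy.
have [l' [u' [lN' u6' lE]]] := mM l lN.
have ypE : nth e0 y p = emul d (emul (eunit u') (nth e0 (eroot g l') p)).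
  apply: (@evc_inj C); rewrite !evcM evc_unit // /y.
  rewrite evadd_nth ?size_evscale ?size_eroot ?sv //.
  rewrite !evscale_nth evcN edot_ip ?size_eroot //.
  have := congr1 (fun x : 'cV_n => x (Ordinal psy) 0) lE.
  rewrite /rv ME refl_mxE !mxE /= => <-.
  by rewrite mulrBr mulNr -mulrA mulVKf.
(* Here y is d times the image of a root; that image being integral, conj(d) y is divisible by the
   norm of d, against the last alternative of [chk_class]. *)
have -> : emul (econj d) (nth e0 y p) =
  emul (m, BinNums.Z0) (emul (eunit u') (nth e0 (eroot g l') p)).
  rewrite ypE; apply: (@evc_inj C); rewrite !evcM mulrA; congr (_ * _).
  rewrite -evcM; congr evc; rewrite /m; case: (d) => a b.
  congr (_, _); rewrite /=; ring.
case: (emul (eunit u') _) => a b; rewrite /emul /=.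
have -> : BinInt.Z.sub (BinInt.Z.mul m a) BinNums.Z0 = BinInt.Z.mul a m by lia.
have -> : BinInt.Z.sub (BinInt.Z.add (BinInt.Z.mul m b) BinNums.Z0) BinNums.Z0 =
   BinInt.Z.mul b m by lia.
by rewrite !Zdiv.Z_mod_mult.
Qed.
End Mirrors.

(** * Action on the mirrors *)

Section ReflectionGroups.
Variables (C : numClosedFieldType) (g : ST_type) (gT : finGroupType).
Variable rho : mx_representation C [set: gT] (ST_rank g).
Hypothesis hW : is_ST rho.
Local Notation n := (ST_rank g).
Local Notation N := (nmir g).
Local Notation w3 := (zeta3 C).
Local Notation z6 := (zeta6 C).
Local Notation og := (og (stab g)).
Local Notation sg := (sg (stab g)).
Local Notation un := (un (stab g)).
Local Notation rfi := (rfi (stab g)).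
Local Notation rv := (rv C g).
Local Notation rfl := (rfl C g).

Lemma rhoM u w : rho (u * w)%g = rho u *m rho w.
Proof. by rewrite repr_mxM ?inE. Qed.
Lemma rho_inj : injective rho.
Proof. by case: hW => f _ _ u w; apply: (mx_faithful_inj f); rewrite inE. Qed.
Lemma rho_ind (P : 'M[C]_n -> Prop) : P 1%:M ->
  (forall A B, P A -> P B -> P (A *m B)) ->
  (forall c i, (i < N)%N -> P (rfl c i)) -> forall w, P (rho w).
Proof.
case: hW => _ _ gen P1 PM Pr w.
have /gen_prodgP[m [f fg ->]] : w \in <<[set w | rho w \in ST_gens C g]>>%g.
  by rewrite gen inE.
elim/big_ind: _ => [|u v pu pv|i _]; first by rewrite repr_mx1.
  by rewrite rhoM; apply: PM.
by have := fg i; rewrite inE => /ST_gensP[k [c [kN ->]]]; apply: Pr.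
Qed.
Lemma rho_mono w : @mono C g (rho w).
Proof.
by apply: rho_ind; [exact: mono1 | exact: monoM | move=> *; exact: mono_rfl].
Qed.
Lemma rho_unitary w : unitary (rho w).
Proof.
by apply: rho_ind;
  [exact: unitary1 | exact: unitaryM | move=> *; exact: rfl_unitary].
Qed.
Lemma zc_cube c : (zc C c) ^+ 3 = 1.
Proof. by rewrite -exprM mulnC exprM zeta3_cube expr1n. Qed.
Lemma zc_neq0 c : zc C c != 0.
Proof.
have := zc_cube c; apply: contra_eqN => /eqP->.
by rewrite expr0n eq_sym oner_eq0.
Qed.
Lemma rho_det w : \det (rho w) ^+ 3 = 1.
Proof.
apply: (@rho_ind (fun A => \det A ^+ 3 = 1)); first by rewrite det1 expr1n.
  by move=> A B; rewrite det_mulmx exprMn => -> ->; rewrite mulr1.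
by move=> c i iN; rewrite det_rfl // zc_cube.
Qed.

Definition gref c (i : 'I_N) : gT := odflt 1%g [pick w | rho w == rfl c i].
Lemma rho_gref c i : rho (gref c i) = rfl c i.
Proof.
rewrite /gref; case: pickP => [w /eqP //|h].
case: hW => _ /(_ (rfl c i)) ex _; have [|w wE] := ex.
  by apply/ST_gensP; exists i, c.
by have := h w; rewrite wE eqxx.
Qed.

Lemma dim_cV : \dim {:'cV[C]_n} = n.
Proof. by rewrite dimvf /dim /= muln1. Qed.
Lemma lactE w x : lact rho w x = rho w *m x.
Proof. by rewrite lfunE. Qed.
Lemma dim_fixv w : (\dim (fixv rho w) + \dim (limg (lact rho w - \1%VF)%R) = n)%N.
Proof.
by rewrite -[RHS]dim_cV -(limg_ker_dim (lact rho w - \1%VF)%R fullv) capfv.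
Qed.
Lemma lact1E w x : (lact rho w - \1%VF)%R x = rho w *m x - x.
Proof. by rewrite add_lfunE opp_lfunE id_lfunE lactE. Qed.
(** Rank-nullity for w - 1. *)
Lemma is_refl_rank1 w : is_refl rho w <->
  (w != 1%g /\ exists v0 : 'cV_n, forall x : 'cV[C]_n, exists a, rho w *m x - x = a *: v0).
Proof.
have d := dim_fixv w; split=> [/eqP r|[w1 [v0 v0E]]].
  have d1 : \dim (limg (lact rho w - \1%VF)%R) = 1%N.
    by apply/eqP; rewrite -(eqn_add2l (\dim (fixv rho w))) d addn1 r.
  split.
    apply: contra_eqN d1 => /eqP->.
    suff -> : (lact rho 1 - \1%VF)%R = 0 by rewrite lim0g dimv0.
    by apply/lfunP => x; rewrite lact1E zero_lfunE repr_mx1 mul1mx subrr.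
  set L := limg _ in d1; exists (vpick L) => x.
  have L0 : vpick L != 0 by rewrite vpick0 -dimv_eq0 d1.
  have LE : L = <[vpick L]>%VS.
    apply/eqP; rewrite eq_sym eqEdim -memvE memv_pick d1 dim_vline L0 //.
  have : (lact rho w - \1%VF)%R x \in L by rewrite memv_img ?memvf.
  by rewrite {1}LE lact1E => /vlineP.
have v00 : v0 != 0.
  apply: contra w1 => /eqP v00; apply/eqP/rho_inj; rewrite repr_mx1.
  apply: mx_ext => i _; have [a] := v0E (rv i).
  by rewrite v00 scaler0 mul1mx => /eqP; rewrite subr_eq0 => /eqP.
rewrite /is_refl -addn1 -[X in _ == X]d eqn_add2l eq_sym eqn_leq; apply/andP; split.
  apply: (@leq_trans (\dim <[v0]>%VS)); last by rewrite dim_vline v00.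
  apply: dimvS; apply/subvP => y /memv_imgP[x _ ->]; rewrite lact1E.
  by have [a ->] := v0E x; apply/vlineP; exists a.
rewrite lt0n dimv_eq0; apply: contra w1 => /eqP l0.
apply/eqP/rho_inj; rewrite repr_mx1; apply: mx_ext => i _; rewrite mul1mx.
have : (lact rho w - \1%VF)%R (rv i) \in limg (lact rho w - \1%VF)%R.
  by rewrite memv_img ?memvf.
by rewrite l0 memv0 lact1E subr_eq0 => /eqP.
Qed.
Lemma gref_neq1 c i : gref c i != 1%g.
Proof.
apply/eqP => /(congr1 (fun w => \det (rho w))).
by rewrite rho_gref det_rfl // repr_mx1 det1 => /eqP; rewrite (negPf (zc_neq1 _ c)).
Qed.
Lemma gref_refl c i : is_refl rho (gref c i).
Proof.
apply/is_refl_rank1; split; first exact: gref_neq1.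
by exists (rv i) => x; rewrite rho_gref; exact: rfl_rank1.
Qed.
Definition gr c i : refl rho := Sub (gref c i) (gref_refl c i).
Lemma reflP (s : refl rho) : exists c i, s = gr c i.
Proof.
have /is_refl_rank1[s1 sr] := valP s.
have [|i [c [iN sE]]] := mono_classify (rho_mono (val s)) (rho_unitary (val s)) (rho_det (val s)) sr.
  by apply: contra s1 => /eqP e; apply/eqP/rho_inj; rewrite repr_mx1.
by exists c, (Ordinal iN); apply/val_inj/rho_inj; rewrite sE /= rho_gref.
Qed.

(* true for the distinguished reflections, false for their inverses *)
Definition cls (s : refl rho) : bool := \det (rho (val s)) == w3.
Lemma cls_det (s : refl rho) : \det (rho (val s)) = zc C (cls s).
Proof.
have [c [i ->]] := reflP s; rewrite /cls /= rho_gref det_rfl //.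
have -> : w3 = zc C true by rewrite /zc expr1.
by rewrite (inj_eq (@zc_inj C)); case: c.
Qed.
Lemma cls_gr c i : cls (gr c i) = c.
Proof. by apply: (@zc_inj C); rewrite -cls_det /= rho_gref det_rfl. Qed.

Lemma fixv_gref c (i : 'I_N) x : (x \in fixv rho (gref c i)) = (ip (rv i) x == 0).
Proof.
apply/fixvP/eqP => [|x0]; rewrite rho_gref; last exact: rfl_fix.
rewrite rflE => /eqP; rewrite subr_eq addrC -subr_eq subrr eq_sym scaler_eq0.
rewrite (negPf (rv_neq0 _ _)) // orbF !mulf_eq0 invr_eq0 pnatr_eq0 orbF subr_eq0.
by rewrite eq_sym (negPf (zc_neq1 _ _)) => /eqP.
Qed.
Lemma hy_sig : {f : 'I_N -> hyp rho | forall c i, f i = hyp_of (gr c i)}.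
Proof.
exists (fun i => hyp_of (gr true i)) => c i.
by apply/val_inj/vspaceP => x; transitivity (ip (rv i) x == 0);
  [exact: fixv_gref | apply/esym; exact: fixv_gref].
Qed.
Definition hy := sval hy_sig.
Lemma hyE c i : hyp_of (gr c i) = hy i. Proof. by rewrite -(svalP hy_sig). Qed.
(* Membership in a mirror, the action and transversality are replaced by     *)
(* sealed copies inh, ha, tr, because unification would otherwise unfold     *)
(* them down to Gaussian elimination.                                        *)
Lemma inh_sig : {f : hyp rho -> 'cV[C]_n -> bool | forall H x, f H x = (x \in val H)}.
Proof. by exists (fun (H : hyp rho) (x : 'cV[C]_n) => x \in val H). Qed.
Definition inh := sval inh_sig.
Lemma inhE H x : inh H x = (x \in val H). Proof. exact: (svalP inh_sig). Qed.
Lemma mem_hy i x : inh (hy i) x = (ip (rv i) x == 0).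
Proof. by rewrite inhE -(fixv_gref true) -(hyE true). Qed.
Lemma inh_ext H G : (forall x, inh H x = inh G x) -> H = G.
Proof. by move=> h; apply/val_inj/vspaceP => x; rewrite -!inhE. Qed.
Lemma inh_fixv s x : inh (hyp_of s) x = (x \in fixv rho (val s)).
Proof. exact: inhE. Qed.
Lemma inh_capP H G K :
  reflect (forall x, inh H x -> inh G x -> inh K x) (val H :&: val G <= val K)%VS.
Proof.
apply: (iffP subvP) => h x; first by rewrite !inhE => xH xG; apply: h; rewrite memv_cap; apply/andP.
by move/memv_capP => [xH xG]; rewrite -inhE; apply: h; rewrite inhE.
Qed.
Lemma inh_hact w H x : inh (hact w H) (rho w *m x) = inh H x.
Proof.
rewrite !inhE; apply/idP/idP => [/memv_imgP[y yH]|xH]; last first.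
  by rewrite -lactE; apply: memv_img.
rewrite lactE => /(congr1 (mulmx (rho w^-1%g))).
by rewrite !mulmxA -!rhoM mulVg repr_mx1 !mul1mx => ->.
Qed.
Lemma rvn (i : 'I_N) : ip (rv i) (rv i) = 3. Proof. exact: rv_norm. Qed.
Lemma ogE (i j : 'I_N) : og i j = (ip (rv i) (rv j) == 0).
Proof. exact: og_ip. Qed.
Lemma ogP (i j : 'I_N) : og i j -> ip (rv i) (rv j) = 0.
Proof. by rewrite ogE => /eqP. Qed.
Lemma nonE (i j : 'I_N) : i != j -> ~~ og i j ->
  ip (rv i) (rv j) / 3 * ip (rv j) (rv i) = 1.
Proof.
move=> ij oij; rewrite mulrAC (non_ip C) ?(divff (three_neq0 C)) //.
by rewrite /tnon; apply/andP.
Qed.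
Lemma hy_inj : injective hy.
Proof.
move=> i j ij; apply/eqP/negPn/negP => nij.
pose x := rv j - (ip (rv i) (rv j) / 3) *: rv i.
have : inh (hy i) x.
  rewrite mem_hy; apply/eqP; rewrite ipBr ipZr rvn.
  by rewrite (divfK (three_neq0 C)) subrr.
rewrite ij mem_hy ipBr ipZr rvn.
have [ij0|ij0] := boolP (og i j).
  by rewrite (ogP ij0) mul0r mul0r subr0 (negPf (three_neq0 C)).
have -> := nonE nij ij0; have -> : 3 - 1 = 2 :> C by ring.
by rewrite pnatr_eq0.
Qed.
Lemma hyP (H : hyp rho) : exists i, H = hy i.
Proof.
have /imageP[s _ sE] := valP H; have [c [i si]] := reflP s.
by exists i; rewrite -(hyE c) -si; apply: val_inj.
Qed.

Lemma hact_hy w (j k : 'I_N) a : rho w *m rv j = a *: rv k -> a != 0 ->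
  hact w (hy j) = hy k.
Proof.
move=> e a0; apply: inh_ext => y; rewrite mem_hy.
have m x : (ip (rv k) (rho w *m x) == 0) = (ip (rv j) x == 0).
  have := rho_unitary w (rv j) x; rewrite e ipZl => <-.
  by rewrite mulf_eq0 conjC_eq0 (negPf a0).
have yE : y = rho w *m (rho w^-1%g *m y).
  by rewrite mulmxA -rhoM mulgV repr_mx1 mul1mx.
by rewrite yE inh_hact mem_hy m.
Qed.
Definition sgo c (i j : 'I_N) : 'I_N := Ordinal (sg_lt c (ltn_ord i) (ltn_ord j)).
Lemma hact_gr c i j : hact (val (gr c i)) (hy j) = hy (sgo c i j).
Proof.
apply: (@hact_hy _ _ _ (z6 ^+ un c i j)).
  by rewrite /= rho_gref rfl_act.
by rewrite expf_neq0 ?zeta6_neq0.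
Qed.

(** If the roots are not orthogonal, reflecting one in the other gives a third root in their span,
    whose mirror contains the intersection. If they are orthogonal, let x be the component of
    another root r orthogonal to both: it lies in the intersection, and its product with r is 3 - e
    - f with e, f in {0, 1}, so x is not in the mirror of r. *)
Lemma transverse_hy i j : transverse (hy i) (hy j) = og i j.
Proof.
rewrite /transverse (inj_eq hy_inj).
have [->|ij] := eqVneq i j; first by rewrite og_irrefl.
have [oij|oij] := boolP (og i j); last first.
  apply/negP => /forallP; have /negP nij := oij.
  have k0 : (1 - zc C true) / 3 * ip (rv i) (rv j) != 0.
    rewrite !mulf_neq0 ?invr_eq0 ?pnatr_eq0 // -?og_ip //.
    by rewrite subr_eq0 eq_sym zc_neq1.
  move: k0 (rflE true i (rv j)) => /=; rewrite rfl_act //.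
  set k := (_ * ip _ _) => k0 e; set m := sgo true i j.
  have rm : rv m = (z6 ^+ un true i j)^-1 *: (rv j - k *: rv i).
    by rewrite -e scalerA mulVf ?scale1r // expf_neq0 // zeta6_neq0.
  move=> /(_ (hy m)) /implyP h.
  have /h : (val (hy i) :&: val (hy j) <= val (hy m))%VS.
    apply/inh_capP => x; rewrite !mem_hy => /eqP xi /eqP xj.
    by rewrite rm ipZl ipBl ipZl xi xj !mulr0 subrr mulr0.
  rewrite !inE !(inj_eq hy_inj) => /orP[] /eqP mE.
    have hj := hact_gr true i j; rewrite -/m mE in hj.
    have hi : hact (val (gr true i)) (hy i) = hy i.
      by apply: (hact_hy _ (zc_neq0 true)); rewrite rho_gref rfl_root.
    move: hj; rewrite -[RHS]hi => /(congr1 (hact (val (gr true i))^-1%g)).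
    rewrite -!hactM mulVg !hact1 => /hy_inj/esym/eqP.
    by rewrite (negPf ij).
  have mEn : sg true i j = j by rewrite -[RHS](congr1 val mE).
  rewrite mEn in e; pose a := k^-1 * (1 - z6 ^+ un true i j).
  have aE : rv i = a *: rv j.
    rewrite -scalerA scalerBl scale1r e opprB addrC subrK.
    by rewrite scalerA mulVf // scale1r.
  have a0 : a != 0.
    by apply: contraNneq (rv_neq0 C (ltn_ord i)) => a0; rewrite aE a0 scale0r.
  case/negP: ij; apply/eqP/hy_inj/inh_ext => x.
  by rewrite !mem_hy aE ipZl mulf_eq0 conjC_eq0 (negPf a0).
apply/forallP => H; apply/implyP => /inh_capP; have [k ->] := hyP H => s.
rewrite !inE !(inj_eq hy_inj); apply/negPn/negP; rewrite negb_or => /andP[ki kj].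
have o0 := ogP oij.
have o0' : ip (rv j) (rv i) = 0 by apply: ogP; rewrite og_sym.
pose x := rv k - (ip (rv i) (rv k) / 3) *: rv i - (ip (rv j) (rv k) / 3) *: rv j.
have : inh (hy k) x.
  by apply: s; rewrite mem_hy !ipBr !ipZr !rvn ?o0 ?o0' !mulr0 ?subr0
       !(divfK (three_neq0 C)) !subrr // sub0r oppr0.
rewrite mem_hy !ipBr !ipZr rvn.
have q l : l != k -> exists2 e, ip (rv l) (rv k) / 3 * ip (rv k) (rv l) = e & e = 0 \/ e = 1.
  move=> lk; have [olk|olk] := boolP (og l k).
    by exists 0; [rewrite (ogP olk) mul0r mul0r|left].
  by exists 1; [apply: nonE|right].
rewrite eq_sym in ki; rewrite eq_sym in kj.
have [e -> e01] := q i ki; have [f -> f01] := q j kj.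
have -> : 3 - e - f = 1 + (1 - e) + (1 - f) by ring.
have ge0 e' : e' = 0 \/ e' = 1 -> 0 <= 1 - e' :> C.
  by case=> ->; rewrite ?subrr ?subr0 ?ler01.
move/eqP => h; have : 0 < 1 + (1 - e) + (1 - f).
  by rewrite -addrA ltr_wpDr ?ltr01 // addr_ge0 ?ge0.
by rewrite h ltxx.
Qed.

Lemma ha_sig : {f : gT -> hyp rho -> hyp rho | forall w H, f w H = hact w H}.
Proof. by exists (@hact _ _ _ rho). Qed.
Definition ha := sval ha_sig.
Lemma haE w H : ha w H = hact w H. Proof. exact: (svalP ha_sig). Qed.
Lemma tr_sig : {f : hyp rho -> hyp rho -> bool | forall H G, f H G = transverse H G}.
Proof. by exists (@transverse _ _ _ rho). Qed.
Definition tr := sval tr_sig.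
Lemma trE H G : tr H G = transverse H G. Proof. exact: (svalP tr_sig). Qed.
Lemma tr_hy i j : tr (hy i) (hy j) = og i j.
Proof. by rewrite trE transverse_hy. Qed.
Lemma haM u w H : ha (u * w)%g H = ha u (ha w H).
Proof. by rewrite !haE hactM. Qed.
Lemma ha1 H : ha 1%g H = H.
Proof. by rewrite haE hact1. Qed.
Lemma ha_hy w (j k : 'I_N) a : rho w *m rv j = a *: rv k -> a != 0 ->
  ha w (hy j) = hy k.
Proof. by rewrite haE; exact: hact_hy. Qed.
Lemma ha_gr c i j : ha (val (gr c i)) (hy j) = hy (sgo c i j).
Proof. by rewrite haE; exact: hact_gr. Qed.
Definition nonp (H G : hyp rho) : bool := (H != G) && ~~ tr H G.
Lemma nonp_hy i j : nonp (hy i) (hy j) = tnon (stab g) i j.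
Proof. by rewrite /nonp tr_hy (inj_eq hy_inj). Qed.
Lemma perp_sym (H G : hyp rho) : tr H G = tr G H.
Proof.
have [i ->] := hyP H; have [j ->] := hyP G.
by rewrite !tr_hy og_sym.
Qed.
Lemma perp_irr (H : hyp rho) : tr H H = false.
Proof. by have [i ->] := hyP H; rewrite tr_hy og_irrefl. Qed.
Lemma nonp_sym H G : nonp H G = nonp G H.
Proof. by rewrite /nonp perp_sym eq_sym. Qed.
Lemma nonp_neq H G : nonp H G -> H != G. Proof. by case/andP. Qed.
Lemma nonp_perp H G : nonp H G -> tr H G = false.
Proof. by case/andP => _ /negPf. Qed.
Lemma perp_nonp H G : tr H G -> nonp H G = false.
Proof. by rewrite /nonp => ->; rewrite andbF. Qed.
Lemma hypI (H G : hyp rho) : [|| H == G, tr H G | nonp H G].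
Proof. by rewrite /nonp; case: (H == G); case: (tr H G). Qed.

Lemma ha_inj w : injective (ha w).
Proof.
by move=> H G /(congr1 (ha w^-1%g)); rewrite -!haM mulVg !ha1.
Qed.
Lemma haK w (H : hyp rho) : ha w^-1%g (ha w H) = H.
Proof. by rewrite -haM mulVg ha1. Qed.
Lemma haKV w (H : hyp rho) : ha w (ha w^-1%g H) = H.
Proof. by rewrite -haM mulgV ha1. Qed.

Definition hidx (H : hyp rho) : 'I_N := odflt (Ordinal (N_gt0 g)) [pick i | hy i == H].
Lemma hidxK H : hy (hidx H) = H.
Proof.
rewrite /hidx; case: pickP => [i /eqP //|h].
by have [i Hi] := hyP H; have := h i; rewrite Hi eqxx.
Qed.
Lemma hyK i : hidx (hy i) = i.
Proof. by apply: hy_inj; rewrite hidxK. Qed.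
Lemma rt_sig : {r : hyp rho -> 'cV[C]_n | forall i, r (hy i) = rv i}.
Proof. by exists (fun H => rv (hidx H)) => i; rewrite hyK. Qed.
Definition rt := sval rt_sig.
Lemma rt_hy i : rt (hy i) = rv i. Proof. exact: (svalP rt_sig). Qed.
Lemma rt_norm H : ip (rt H) (rt H) = 3. Proof. by have [i ->] := hyP H; rewrite rt_hy rvn. Qed.
Lemma rt_perp (H G : hyp rho) : tr H G -> ip (rt H) (rt G) = 0.
Proof.
have [i ->] := hyP H; have [j ->] := hyP G.
rewrite tr_hy (rt_hy i) (rt_hy j).
by move/ogP.
Qed.
Lemma unt_sig : {f : gT -> hyp rho -> C | forall w H, exists2 u, (u < 6)%N &
  f w H = z6 ^+ u /\ rho w *m rt H = z6 ^+ u *: rt (ha w H)}.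
Proof.
exists (fun w H => ip (rt (ha w H)) (rho w *m rt H) / 3) => w H.
have [i ->] := hyP H; rewrite (rt_hy i).
have [k [u [kN u6 e]]] := rho_mono w (ltn_ord i).
have zu : z6 ^+ u != 0 by rewrite expf_neq0 // zeta6_neq0.
have hE : ha w (hy i) = hy (Ordinal kN) by apply: (ha_hy _ zu).
exists u => //; rewrite hE (rt_hy (Ordinal kN)); split=> //.
by rewrite e ipZr rvn mulfK // three_neq0.
Qed.
(** The unit by which w multiplies the root of H in reaching the root of w H; a cocycle by
    [untM]. *)
Definition unt := sval unt_sig.
Lemma unt_spec w H : exists2 u, (u < 6)%N &
  unt w H = z6 ^+ u /\ rho w *m rt H = z6 ^+ u *: rt (ha w H).
Proof. exact: (svalP unt_sig). Qed.
Lemma unt_act w H : rho w *m rt H = unt w H *: rt (ha w H).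
Proof. by have [u _ [-> ->]] := unt_spec w H. Qed.
Lemma unt_exp6 w H : unt w H ^+ 6 = 1.
Proof. by have [u _ [-> _]] := unt_spec w H; rewrite exprAC zeta6_exp6 expr1n. Qed.
Lemma rt_scaleI H a b : a *: rt H = b *: rt H -> a = b.
Proof.
move/(congr1 (ip (rt H))); rewrite !ipZr rt_norm; exact: (mulIf (three_neq0 C)).
Qed.
Lemma untM u w H : unt (u * w)%g H = unt u (ha w H) * unt w H.
Proof.
apply: (@rt_scaleI (ha (u * w)%g H)); rewrite -(unt_act (u * w)%g H).
rewrite rhoM -mulmxA (unt_act w H).
rewrite -scalemxAr (unt_act u (ha w H)) scalerA haM.
by rewrite [X in X *: _ = _]mulrC.
Qed.
Lemma unt1 H : unt 1%g H = 1.
Proof.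
have := unt_act 1%g H; rewrite ha1 repr_mx1 mul1mx -{1}[rt H]scale1r.
by move/rt_scaleI.
Qed.
Lemma unt_gr c i j : unt (val (gr c i)) (hy j) = z6 ^+ un c i j.
Proof.
have e := unt_act (val (gr c i)) (hy j).
have kE : rv (sg c i j) = rt (hy (sgo c i j)) by rewrite (rt_hy (sgo c i j)).
rewrite ha_gr (rt_hy j) rho_gref rfl_act // kE in e.
by move/esym/rt_scaleI: e.
Qed.

Lemma tr_ip H G : tr H G = (ip (rt H) (rt G) == 0).
Proof.
have [i ->] := hyP H; have [j ->] := hyP G.
by rewrite tr_hy ogE (rt_hy i) (rt_hy j).
Qed.
Lemma unt_neq0 w H : unt w H != 0.
Proof.
have := unt_exp6 w H; apply: contra_eqN => /eqP->.
by rewrite expr0n eq_sym oner_eq0.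
Qed.
Lemma tr_act w (H G : hyp rho) : tr (ha w H) (ha w G) = tr H G.
Proof.
rewrite !tr_ip; have := rho_unitary w (rt H) (rt G).
rewrite !unt_act ipZl ipZr => <-.
by rewrite !mulf_eq0 conjC_eq0 !(negPf (unt_neq0 _ _)).
Qed.
Lemma nonp_act w H G : nonp (ha w H) (ha w G) = nonp H G.
Proof. by rewrite /nonp tr_act (inj_eq (@ha_inj w)). Qed.

(** The roots of X and, up to a unit, of sX differ by a nonzero multiple of the root of s; so the
    root of P is orthogonal to the latter and fixed by s. *)
Lemma refl_fix_perp (s : refl rho) (X P : hyp rho) : ha (val s) X != X ->
  tr P X -> tr P (ha (val s) X) ->
  ha (val s) P = P /\ unt (val s) P = 1.
Proof.
have [c [i ->]] := reflP s; have [x ->] := hyP X; have [p ->] := hyP P.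
set t := val _ => sX /rt_perp pX /rt_perp pX'.
have tE y : rho t *m y = y - ((1 - zc C c) / 3 * ip (rv i) y) *: rv i.
  by rewrite /t rho_gref rflE.
have e := unt_act t (hy x); rewrite tE in e.
have k0 : (1 - zc C c) / 3 * ip (rv i) (rt (hy x)) != 0.
  apply: contra sX => /eqP k0; apply/eqP; apply: (ha_hy _ (oner_neq0 C)).
  by rewrite scale1r tE -(rt_hy x) k0 scale0r subr0.
have {e} := congr1 (ip (rt (hy p))) e.
rewrite ipBr !ipZr pX pX' mulr0 sub0r => /eqP; rewrite oppr_eq0 mulf_eq0.
rewrite (negPf k0) /= => /eqP pi.
have ip0 : ip (rv i) (rt (hy p)) = 0 by rewrite -ip_conj pi rmorph0.
have fP : rho t *m rt (hy p) = rt (hy p).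
  by rewrite tE ip0 mulr0 scale0r subr0.
have PE : ha t (hy p) = hy p.
  by apply: (ha_hy _ (oner_neq0 C)); rewrite scale1r -(rt_hy p).
split=> //; apply: (@rt_scaleI (hy p)).
by rewrite -{2}PE -unt_act fP scale1r.
Qed.

Lemma rf_sig : {f : bool -> hyp rho -> hyp rho -> refl rho |
  (forall c H G, cls (f c H G) = c) /\
  forall c (i j : 'I_N), tnon (stab g) i j -> exists k : 'I_N,
  [/\ f c (hy i) (hy j) = gr c k, k = rfi c i j :> nat &
      forall k' : 'I_N, (sg c k' i == j) = (k' == k)]}.
Proof.
exists (fun c H G => gr c (insubd (Ordinal (N_gt0 g)) (rfi c (hidx H) (hidx G)))).
split=> [c H G|c i j /andP[ij oij]]; first exact: cls_gr.
have := chk_rfT g => /allnP/(_ i (ltn_ord i))/allnP/(_ j (ltn_ord j))/allbP/(_ c).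
rewrite (negPf ij) (negPf oij) => /andP[kN /allnP h].
exists (Ordinal kN); split => // [|k'].
  rewrite !hyK; congr (gr c _); apply: val_inj.
  by rewrite val_insubd kN.
by rewrite (eqP (h k' (ltn_ord k'))).
Qed.
(* The unique reflection of class c mapping H to G, if H and G are distinct  *)
(* and not transverse, and an arbitrary one otherwise.                       *)
Definition rf := sval rf_sig.
Lemma rf_hy c (i j : 'I_N) : tnon (stab g) i j -> exists k : 'I_N,
  [/\ rf c (hy i) (hy j) = gr c k, k = rfi c i j :> nat &
      forall k' : 'I_N, (sg c k' i == j) = (k' == k)].
Proof. exact: (svalP rf_sig).2. Qed.
Lemma ha_gr_eq c k (i j : 'I_N) : (ha (val (gr c k)) (hy i) == hy j) = (sg c k i == j :> nat).
Proof. by rewrite ha_gr (inj_eq hy_inj). Qed.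
Lemma ha_rf c H G : nonp H G -> ha (val (rf c H G)) H = G.
Proof.
rewrite -(hidxK H) -(hidxK G) nonp_hy => h; have [k [-> _ kE]] := rf_hy c h.
by apply/eqP; rewrite ha_gr_eq kE.
Qed.
Lemma cls_rf c H G : cls (rf c H G) = c.
Proof. exact: (svalP rf_sig).1. Qed.
Lemma rf_uniq s H G : nonp H G -> ha (val s) H = G -> s = rf (cls s) H G.
Proof.
rewrite -(hidxK H) -(hidxK G) nonp_hy => h.
have [c [k' ->]] := reflP s; rewrite cls_gr.
have [k [-> _ kE]] := rf_hy c h.
by move/eqP; rewrite ha_gr_eq kE => /eqP->.
Qed.
Lemma refl_moves_nonp (s : refl rho) H : ha (val s) H != H -> nonp H (ha (val s) H).
Proof.
have [c [k ->]] := reflP s; rewrite -(hidxK H); set i := hidx H.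
rewrite ha_gr (inj_eq hy_inj) nonp_hy eq_sym => ij.
rewrite /tnon ij /=; apply/negP => oij.
have := chk_rfT g => /allnP/(_ i (ltn_ord i))/allnP/(_ _ (ltn_ord (sgo c k i)))/allbP/(_ c).
have -> : (i == sgo c k i :> nat) = false by apply/negbTE.
rewrite /= oij => /allnP/(_ k (ltn_ord k)).
by rewrite eqxx.
Qed.

Lemma sum_refl (V : zmodType) (F : refl rho -> V) H G : nonp H G ->
  \sum_(s : refl rho | ha (val s) H == G) F s = F (rf true H G) + F (rf false H G).
Proof.
move=> HG; rewrite (bigD1 (rf true H G)) /=; last by rewrite ha_rf.
rewrite (bigD1 (rf false H G)) /=; last first.
  rewrite ha_rf // eqxx /=; apply/eqP => /(congr1 cls).
  by rewrite !cls_rf.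
rewrite big1 ?addr0 // => s /andP[/andP[/eqP sH st] sf].
by move: st sf; rewrite (rf_uniq HG sH); case: (cls s); rewrite eqxx.
Qed.

Lemma hy_sg c (i j : 'I_N) c' (i' j' : 'I_N) : sg c i j = sg c' i' j' ->
  ha (val (gr c i)) (hy j) = ha (val (gr c' i')) (hy j').
Proof. by move=> e; rewrite !ha_gr; congr hy; apply: val_inj. Qed.

Lemma rf_pair X Y G c : tr X Y -> nonp X G -> nonp Y G ->
  [/\ ha (val (rf c X G)) Y = ha (val (rf (~~ c) Y G)) X,
      tr (ha (val (rf c X G)) Y) (ha (val (rf (~~ c) X G)) Y) &
      unt (val (rf c X G)) X * unt (val (rf c X G)) Y =
      unt (val (rf (~~ c) Y G)) X * unt (val (rf (~~ c) Y G)) Y].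
Proof.
have [x ->] := hyP X; have [y ->] := hyP Y; have [p ->] := hyP G.
rewrite tr_hy !nonp_hy => xy xp yp.
have [k [-> kE _]] := rf_hy c xp; have [l [-> lE _]] := rf_hy (~~ c) yp.
have [m [-> mE _]] := rf_hy (~~ c) xp.
have /allnP/(_ x (ltn_ord x))/allnP/(_ y (ltn_ord y))/(lazy_if xy) := chk_I2T g.
move/allnP/(_ p (ltn_ord p))/(lazy_if (introT andP (conj xp yp)))/allbP/(_ c).
rewrite -kE -lE -mE => /andP[/andP[/eqP u1 u2] /eqP u3]; split.
- exact: hy_sg.
- by rewrite !ha_gr tr_hy.
by rewrite !unt_gr -!exprD -[LHS]z6_mod u3 [LHS]z6_mod.
Qed.

Lemma rf_triple X Y Z G c : tr X Y -> tr X Z -> tr Y Z ->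
    nonp X G -> nonp Y G -> nonp Z G ->
  [/\ ha (val (rf c X G)) Y = ha (val (rf c Y G)) Z,
      ha (val (rf c X G)) Z = ha (val (rf c Y G)) X &
      unt (val (rf c X G)) X * unt (val (rf c X G)) Y * unt (val (rf c X G)) Z =
      unt (val (rf c Y G)) X * unt (val (rf c Y G)) Y * unt (val (rf c Y G)) Z].
Proof.
have [x ->] := hyP X; have [y ->] := hyP Y; have [z ->] := hyP Z.
have [p ->] := hyP G; rewrite !tr_hy !nonp_hy => xy xz yz xp yp zp.
have [k [-> kE _]] := rf_hy c xp; have [l [-> lE _]] := rf_hy c yp.
have /allnP/(_ x (ltn_ord x))/allnP/(_ y (ltn_ord y))/(lazy_if xy) := chk_I3T g.
move/allnP/(_ z (ltn_ord z))/(lazy_if (introT andP (conj xz yz))).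
move/allnP/(_ p (ltn_ord p))/(lazy_if (introT and3P (And3 xp yp zp))).
case/andP => /allbP/(_ c) + _; rewrite -kE -lE.
case/and3P => /eqP u1 /eqP u2 /eqP u3; split.
- exact: hy_sg.
- exact: hy_sg.
by rewrite !unt_gr -!exprD -[LHS]z6_mod u3 [LHS]z6_mod.
Qed.

Lemma nonp_le3 X Y Z V G : tr X Y -> tr X Z -> tr Y Z ->
    nonp X G -> nonp Y G -> nonp Z G ->
  tr V X -> tr V Y -> tr V Z -> nonp V G = false.
Proof.
have [x ->] := hyP X; have [y ->] := hyP Y; have [z ->] := hyP Z.
have [p ->] := hyP G; have [v ->] := hyP V.
rewrite !tr_hy !nonp_hy => xy xz yz xp yp zp vx vy vz.
have /allnP/(_ x (ltn_ord x))/allnP/(_ y (ltn_ord y))/(lazy_if xy) := chk_I3T g.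
move/allnP/(_ z (ltn_ord z))/(lazy_if (introT andP (conj xz yz))).
move/allnP/(_ p (ltn_ord p))/(lazy_if (introT and3P (And3 xp yp zp))).
case/andP => _ /allnP/(_ v (ltn_ord v))/(lazy_if (introT and3P (And3 vx vy vz))).
by move/negbTE.
Qed.

Lemma rf_triple2 X Y Z G1 G2 c : tr X Y -> tr X Z -> tr Y Z ->
    nonp X G1 -> nonp Y G1 -> nonp Z G1 ->
    tr G1 G2 -> nonp X G2 -> nonp Y G2 -> nonp Z G2 ->
  ha (val (rf c X G2)) Y = G1 \/ ha (val (rf c X G2)) Z = G1.
Proof.
have [x ->] := hyP X; have [y ->] := hyP Y; have [z ->] := hyP Z.
have [p ->] := hyP G1; have [q ->] := hyP G2.
rewrite !tr_hy !nonp_hy => xy xz yz xp yp zp pq xq yq zq.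
have [k [-> kE _]] := rf_hy c xq.
have /allnP/(_ x (ltn_ord x))/allnP/(_ y (ltn_ord y))/(lazy_if xy) := chk_T3T g.
move/allnP/(_ z (ltn_ord z))/(lazy_if (introT andP (conj xz yz))).
move/allnP/(_ p (ltn_ord p))/(lazy_if (introT and3P (And3 xp yp zp))).
move/allnP/(_ q (ltn_ord q))/(lazy_if (introT and4P (And4 pq xq yq zq)))/allbP/(_ c).
by rewrite -kE => /orP[] h; [left|right]; apply/eqP; rewrite ha_gr_eq.
Qed.

Lemma rf_pair2 X Y G1 G2 : tr X Y -> nonp X G1 -> nonp Y G1 ->
    tr G1 G2 -> nonp X G2 -> nonp Y G2 ->
  (exists c, ha (val (rf c X G2)) Y = G1) \/
  forall c, let s := rf c X G2 in let t1 := rf c Y G1 in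
    [/\ nonp (ha (val s) Y) G1, nonp (ha (val t1) X) G2 &
     (val (rf (~~ c) (ha (val s) Y) G1) * val s =
      val (rf (~~ c) (ha (val t1) X) G2) * val t1)%g].
Proof.
have [x ->] := hyP X; have [y ->] := hyP Y.
have [p ->] := hyP G1; have [q ->] := hyP G2.
rewrite !tr_hy !nonp_hy => xy xp yp pq xq yq.
have /allnP/(_ x (ltn_ord x))/allnP/(_ y (ltn_ord y))/(lazy_if xy) := chk_T2T g.
move/allnP/(_ p (ltn_ord p))/(lazy_if (introT andP (conj xp yp))).
move/allnP/(_ q (ltn_ord q))/(lazy_if (introT and3P (And3 pq xq yq))).
case: ifP => [h _|_ h].
  have [c ce] : exists c, sg c (rfi c x q) y = p.
    by move: h; case: ifP => [/eqP|_ /eqP]; [exists true | exists false].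
  have [k [rE kE _]] := rf_hy c xq; left; exists c; rewrite rE.
  by apply/eqP; rewrite ha_gr_eq kE ce.
right => c s t1; rewrite {}/s {}/t1.
have {h} /allbP/(_ c) := h.
have [k [-> kE _]] := rf_hy c xq; have [l [-> lE _]] := rf_hy c yp.
rewrite -kE -lE !ha_gr !nonp_hy; set y' := sgo c k y; set x' := sgo c l x.
cbv zeta; rewrite -[sg c k y]/(val y') -[sg c l x]/(val x').
case/and3P => yp' xq' /allnP h; split=> //.
have [m [-> mE _]] := rf_hy (~~ c) yp'; have [o [-> oE _]] := rf_hy (~~ c) xq'.
rewrite -mE -oE in h.
apply: rho_inj; rewrite !rhoM !rho_gref; apply: mx_ext => i i_n.
have iN := leq_trans i_n (n_leN g); have := h i i_n.
case/andP => /eqP u1 /eqP u2.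
rewrite -!mulmxA !rfl_act // -!scalemxAr !rfl_act ?sg_lt // !scalerA.
by rewrite u1 -!exprD -z6_mod u2 z6_mod.
Qed.

Lemma perp_conn H G : exists w, ha w H = G.
Proof.
have conn j : exists w, ha w (hy (Ordinal (N_gt0 g))) = hy j.
  have /allnP/(_ j (ltn_ord j))/hasP[k] := chk_connT g.
  rewrite mem_iota => kN /andP[h0 hj].
  set o := Ordinal (N_gt0 g); pose l := Ordinal (kN : (k < N)%N).
  have {}h0 : nonp (hy o) (hy l) by rewrite nonp_hy.
  have {}hj : nonp (hy l) (hy j) by rewrite nonp_hy.
  exists (val (rf true (hy l) (hy j)) * val (rf true (hy o) (hy l)))%g.
  by rewrite haM (ha_rf true h0) (ha_rf true hj).
have [i ->] := hyP H; have [j ->] := hyP G.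
have [u uE] := conn i; have [v vE] := conn j.
by exists (v * u^-1)%g; rewrite haM -uE haK.
Qed.

Lemma reflH (s : refl rho) : s = gr (cls s) (hidx (hyp_of s)).
Proof. by have [c [i ->]] := reflP s; rewrite cls_gr hyE hyK. Qed.

Definition cjr (w : gT) (s : refl rho) : refl rho :=
  Sub (w * val s * w^-1)%g (etrans (is_reflJ rho w (val s)) (valP s)).
Lemma val_cjr w s : val (cjr w s) = (w * val s * w^-1)%g. Proof. by []. Qed.
Lemma cls_cjr w s : cls (cjr w s) = cls s.
Proof.
rewrite /cls val_cjr !rhoM !det_mulmx mulrAC -det_mulmx -rhoM mulgV.
by rewrite repr_mx1 det1 mul1r.
Qed.
Lemma ha_cjr w s H : ha (val (cjr w s)) (ha w H) = ha w (ha (val s) H).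
Proof. by rewrite val_cjr !haM haK. Qed.
Lemma hyp_of_cjr w s : hyp_of (cjr w s) = ha w (hyp_of s).
Proof.
apply: inh_ext => x; rewrite haE.
have xE : x = rho w *m (rho w^-1%g *m x).
  by rewrite mulmxA -rhoM mulgV repr_mx1 mul1mx.
rewrite xE inh_hact !inh_fixv -xE val_cjr.
apply/fixvP/fixvP => e.
  by rewrite -{2}e !mulmxA -!rhoM !mulgA mulVg mul1g.
by rewrite !rhoM -!mulmxA e -xE.
Qed.
Lemma refl_fix_tr (s : refl rho) P : tr P (hyp_of s) ->
  ha (val s) P = P /\ unt (val s) P = 1.
Proof.
rewrite {1}(reflH s) hyE; set i := hidx _; rewrite (reflH s) -/i.
have [p ->] := hyP P; rewrite tr_hy og_sym // => /ogP ip0.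
set t := val _; have fP : rho t *m rt (hy p) = rt (hy p).
  by rewrite /t rho_gref (rt_hy p) rfl_fix.
have PE : ha t (hy p) = hy p.
  by apply: (ha_hy _ (oner_neq0 C)); rewrite scale1r -(rt_hy p).
split=> //; apply: (@rt_scaleI (hy p)).
by rewrite -{2}PE -unt_act fP scale1r.
Qed.
Lemma refl_mirror (s : refl rho) :
  ha (val s) (hyp_of s) = hyp_of s /\ unt (val s) (hyp_of s) = zc C (cls s).
Proof.
rewrite {2 3 5}(reflH s) hyE; set i := hidx _; rewrite {1 2}(reflH s) -/i.
set t := val _; have tE : rho t *m rv i = zc C (cls s) *: rv i.
  by rewrite /t rho_gref rfl_root.
have hE : ha t (hy i) = hy i by apply: (ha_hy tE (zc_neq0 _)).
split=> //; apply: (@rt_scaleI (hy i)).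
by rewrite -{2}hE -unt_act (rt_hy i).
Qed.
(** W is transitive on the mirrors and conjugation preserves the determinant; hence mu takes only
    two values. *)
Lemma refl_conj s s' : cls s = cls s' -> val s' \in (val s ^: [set: gT])%g.
Proof.
move=> css; have [w wE] := perp_conn (hyp_of s) (hyp_of s').
have -> : s' = cjr w s.
  by rewrite (reflH s') (reflH (cjr w s)) cls_cjr css hyp_of_cjr wE.
by apply/imsetP; exists w^-1%g; rewrite ?inE // conjgE invgK mulgA.
Qed.
End ReflectionGroups.

(** * Transverse collections and the group K_B *)

Section Collections.
Variables (C : numClosedFieldType) (g : ST_type) (gT : finGroupType).
Variable rho : mx_representation C [set: gT] (ST_rank g).
Hypothesis hW : is_ST rho.
Local Notation rf := (rf hW).
Local Notation unt := (unt hW).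
Local Notation tcol := (@transverse_collection C (ST_rank g) gT rho).
Local Notation sa := (@Defs.setact C (ST_rank g) gT rho).
Implicit Types (H G X Y Z : hyp rho) (B : {set hyp rho}) (s t : refl rho).

Lemma tcolP B :
  reflect (forall H G, H \in B -> G \in B -> H != G -> tr H G) (tcol B).
Proof.
apply: (iffP forall_inP) => h H.
  move=> G HB GB HG; have /forall_inP/(_ G GB) := h H HB.
  by rewrite HG -trE.
by move=> HB; apply/forall_inP => G GB; apply/implyP; rewrite -trE; apply: h.
Qed.
Lemma saE w B : sa w B = ha w @: B.
Proof. by apply: eq_imset => H; rewrite haE. Qed.
Lemma mem_sa w B H : (ha w H \in sa w B) = (H \in B).
Proof. by rewrite saE mem_imset //; exact: ha_inj. Qed.
Lemma saP w B H : reflect (exists2 G, G \in B & H = ha w G) (H \in sa w B).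
Proof. by rewrite saE; exact: imsetP. Qed.
Lemma saM u w B : sa (u * w)%g B = sa u (sa w B).
Proof.
rewrite !saE -imset_comp; apply: eq_imset => H /=; exact: haM.
Qed.
Lemma sa1 B : sa 1%g B = B.
Proof. by rewrite saE -[RHS]imset_id; apply: eq_imset => H; rewrite ha1. Qed.
Lemma saK w B : sa w^-1%g (sa w B) = B.
Proof. by rewrite -saM mulVg sa1. Qed.
Lemma saKV w B : sa w (sa w^-1%g B) = B.
Proof. by rewrite -saM mulgV sa1. Qed.
Lemma card_sa w B : #|sa w B| = #|B|.
Proof. by rewrite saE card_imset //; exact: ha_inj. Qed.
Lemma mem_saV w B H : (H \in sa w B) = (ha w^-1%g H \in B).
Proof. by rewrite -{1}(haKV w H) mem_sa. Qed.
Lemma tcol_act w B : tcol (sa w B) = tcol B.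
Proof.
suff imp u B' : tcol B' -> tcol (sa u B').
  by apply/idP/idP; [move/(imp w^-1%g); rewrite saK | exact: imp].
move/tcolP => t; apply/tcolP => H G /saP[H' HB ->] /saP[G' GB ->] ne.
rewrite tr_act //; apply: t => //.
by apply: contraNneq ne => ->.
Qed.
Lemma Stab_sa w B : (w \in Stab B) = (sa w B == B).
Proof. by rewrite inE. Qed.
Lemma StabP w B : w \in Stab_group B -> sa w B = B.
Proof. by rewrite Stab_sa => /eqP. Qed.

Section Fixed.
Variable B : {set hyp rho}.
Hypothesis tB : tcol B.
Lemma tcol_tr H G : H \in B -> G \in B -> H != G -> tr H G.
Proof. by move/tcolP: tB; apply. Qed.
Lemma tcol_nonp H G : H \in B -> G \in B -> nonp H G = false.
Proof.
move=> HB GB; have [->|HG] := eqVneq H G; last exact: perp_nonp (tcol_tr HB GB HG).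
by rewrite /nonp eqxx.
Qed.
(** A mirror that is moved by a reflection goes to a mirror non-transverse to it, whereas two
    distinct members of B are transverse. *)
Lemma mem_act_fixed s H : H \in B -> (H \in sa (val s) B) = (ha (val s) H == H).
Proof.
move=> HB; apply/idP/eqP => [|<-]; last by rewrite mem_sa.
case/saP => K KB HE; have [KH|KH] := eqVneq (ha (val s) K) K.
  by rewrite KH in HE; rewrite HE.
by move: (refl_moves_nonp hW KH); rewrite -HE tcol_nonp.
Qed.
Lemma moved_nonp s X H : X \in B -> H \in B -> ha (val s) X != X ->
  nonp H (ha (val s) X) = (ha (val s) H != H).
Proof.
move=> XB HB sX; have [->|HX] := eqVneq H X; first by rewrite sX refl_moves_nonp.
have HX' := tcol_tr HB XB HX.
have [sH|sH] := eqVneq (ha (val s) H) H.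
  by apply: perp_nonp; rewrite -{1}sH tr_act.
rewrite /nonp; apply/andP; split.
  apply: contraNneq sX => e; move: (mem_act_fixed s HB).
  by rewrite {1}e mem_sa XB => /esym; rewrite (negPf sH).
apply/negP => h; case/eqP: sH; exact: (refl_fix_perp hW sX HX' h).1.
Qed.

Definition genpair s t : bool :=
  [&& sa (val s) B == sa (val t) B, sa (val s) B != B &
      [forall H in B :\: sa (val s) B, ha (val s) H != ha (val t) H]].

(* The pairs of reflections defining K_B: those moving two mirrors of B have *)
(* opposite classes, those moving three of them have the same class.         *)
Variant genpair_spec s t : Prop :=
| Genpair2 c X Y G of X \in B & Y \in B & X != Y & nonp X G & nonp Y G &
    (forall H, H \in B -> H != X -> H != Y -> tr H G) &
    s = rf c X G & t = rf (~~ c) Y G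
| Genpair3 c X Y Z G of X \in B & Y \in B & Z \in B & X != Y & X != Z & Y != Z &
    nonp X G & nonp Y G & nonp Z G &
    (forall H, H \in B -> H != X -> H != Y -> H != Z -> tr H G) &
    s = rf c X G & t = rf c Y G.

Lemma rf_moves c X G : nonp X G -> ha (val (rf c X G)) X != X.
Proof. by move=> XG; rewrite ha_rf // eq_sym nonp_neq. Qed.
Lemma nonp_notin X G : X \in B -> nonp X G -> G \notin B.
Proof. by move=> XB; apply: contraL => GB; rewrite tcol_nonp. Qed.
Lemma tr_of_not_nonp H G : G \notin B -> H \in B -> ~~ nonp H G -> tr H G.
Proof.
move=> GB HB h; case/or3P: (hypI H G) => //; last by rewrite (negPf h).
by move/eqP => e; rewrite -e HB in GB.
Qed.

Lemma fix_other s X G H : X \in B -> H \in B -> H != X -> ha (val s) X = G ->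
  X != G -> tr H G -> ha (val s) H = H /\ unt (val s) H = 1.
Proof.
move=> XB HB HX sX XG HG; apply: (refl_fix_perp hW (X := X)).
- by rewrite sX eq_sym.
- exact: (tcol_tr HB XB HX).
- by rewrite sX.
Qed.
Lemma moved_notin s H : H \in B -> ha (val s) H != H -> ha (val s) H \notin B.
Proof.
move=> HB sH; apply/negP => sHB; have := mem_act_fixed s sHB.
by rewrite mem_sa HB => /esym/eqP/ha_inj/eqP; rewrite (negPf sH).
Qed.

(** Let G = sX be a new mirror; as sB = tB it is also tY for some Y in B, and the condition on s and
    t forces X <> Y. The members of B moved by s are those non-transverse to G, so there are two or
    three of them, and a wrong choice of classes contradicts [rf_pair]. *)
Lemma genpairP s t : genpair s t -> genpair_spec s t.
Proof.
case/and3P=> /eqP st sB /forall_inP df.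
have [X XB sX] : exists2 X, X \in B & ha (val s) X != X.
  apply/exists_inP; apply: contraNT sB; rewrite negb_exists_in.
  move=> /forall_inP h; rewrite eqEcard card_sa leqnn andbT.
  apply/subsetP => H /saP[K KB ->].
  by have := h K KB; rewrite negbK => /eqP->.
pose G := ha (val s) X; pose c := cls s.
have XG : nonp X G by apply: (refl_moves_nonp hW).
have sE : s = rf c X G by apply: rf_uniq.
have GB : G \notin B := nonp_notin XB XG.
have sm H : H \in B -> nonp H G = (ha (val s) H != H).
  by move=> HB; apply: moved_nonp.
have [Y YB GY] : exists2 Y, Y \in B & G = ha (val t) Y.
  by apply/saP; rewrite -st mem_sa.
have tY : ha (val t) Y != Y by rewrite -GY; apply: contraNneq GB => ->.
have sY : ha (val s) Y != Y.
  by rewrite -mem_act_fixed // st mem_act_fixed.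
have XY : X != Y.
  apply: contraTneq (df X _) => [e|]; first by rewrite e -GY -e eqxx.
  by rewrite inE XB mem_act_fixed // sX.
have YG : nonp Y G by rewrite sm.
have tE : t = rf (cls t) Y G by apply: rf_uniq.
have tXY := tcol_tr XB YB XY.
have tYX : tr Y X by rewrite (perp_sym hW).
have img H : H \in B -> nonp H G -> exists K, [/\ K \in B, nonp K G, K != Y \/ H = X &
    ha (val s) H = ha (val t) K].
  move=> HB HG; have sH : ha (val s) H != H by rewrite -sm.
  have [K KB sK] : exists2 K, K \in B & ha (val s) H = ha (val t) K.
    by apply/saP; rewrite -st mem_sa.
  have tK : ha (val t) K != K.
    by apply: contraNneq (moved_notin HB sH) => e; rewrite sK e.
  exists K; split=> //; first by rewrite GY moved_nonp.
  have [KY|] := eqVneq K Y; [right | by left].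
  by move: sK; rewrite KY -GY => /ha_inj.
have [I2 _ _] := rf_pair hW c tXY XG YG.
rewrite -sE in I2.
have [/exists_inP[Z ZB /and3P[ZX ZY ZG]]|nZ] :=
    boolP [exists Z in B, [&& Z != X, Z != Y & nonp Z G]].
  have tXZ : tr X Z by rewrite (perp_sym hW); exact: (tcol_tr ZB XB ZX).
  have tYZ : tr Y Z by rewrite (perp_sym hW); exact: (tcol_tr ZB YB ZY).
  have oth H : H \in B -> H != X -> H != Y -> H != Z -> nonp H G = false.
    move=> HB HX HY HZ; apply: (nonp_le3 hW tXY tXZ tYZ XG YG ZG).
    - exact: (tcol_tr HB XB HX).
    - exact: (tcol_tr HB YB HY).
    exact: (tcol_tr HB ZB HZ).
  have XZ : X != Z by rewrite eq_sym.
  have YZ : Y != Z by rewrite eq_sym.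
  refine (@Genpair3 _ _ c X Y Z G XB YB ZB XY XZ YZ XG YG ZG _ sE _).
    move=> H HB HX HY HZ; apply: (tr_of_not_nonp GB HB).
    exact: (negbT (oth H HB HX HY HZ)).
  suff ct : cls t = c by rewrite {1}tE ct.
  (* With opposite classes [rf_pair] gives sY = tX, which leaves only sZ = tZ, excluded by the
     condition on Z. *)
  have [//|ct] := eqVneq (cls t) c; exfalso.
  have {}ct : cls t = ~~ c by case: (cls t) ct; case: (c).
  rewrite -ct -tE in I2.
  have [K [KB KG KY sK]] := img Z ZB ZG.
  have {}KY : K != Y by case: KY => // e; rewrite e eqxx in ZX.
  have KX : K != X.
    by apply: contraNneq ZY => e; move: sK; rewrite e -I2 => /ha_inj->.
  have KZ : K = Z.
    by apply/eqP/negPn/negP => KZ; move: KG; rewrite (oth K KB KX KY KZ).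
  have ZD : Z \in B :\: sa (val s) B by rewrite inE ZB mem_act_fixed // -(sm Z ZB) ZG.
  by have := df Z ZD; rewrite sK KZ eqxx.
have oth H : H \in B -> H != X -> H != Y -> nonp H G = false.
  move=> HB HX HY; apply: contraNF nZ => HG; apply/exists_inP; exists H => //.
  exact: (introT and3P (And3 HX HY HG)).
refine (@Genpair2 _ _ c X Y G XB YB XY XG YG _ sE _).
  move=> H HB HX HY; apply: (tr_of_not_nonp GB HB).
  exact: (negbT (oth H HB HX HY)).
suff ct : cls t = ~~ c by rewrite {1}tE ct.
(* With equal classes tX would be sY, but [rf_pair] makes these two mirrors transverse. *)
have [//|ct] := eqVneq (cls t) (~~ c); exfalso.
have {}ct : cls t = c by case: (cls t) ct; case: (c).
have [K [KB KG KY sK]] := img Y YB YG.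
have {}KY : K != Y by case: KY => // e; rewrite e eqxx in XY.
have KX : K = X by apply/eqP/negPn/negP => KX; move: KG; rewrite (oth K KB KX KY).
have [_ + _] := rf_pair hW c tYX YG XG.
by rewrite -ct -tE -KX -sK ct KX -I2 (perp_irr hW).
Qed.

Lemma genpair2 c X Y G : X \in B -> Y \in B -> X != Y -> nonp X G -> nonp Y G ->
  (forall H, H \in B -> H != X -> H != Y -> tr H G) ->
  genpair (rf c X G) (rf (~~ c) Y G).
Proof.
move=> XB YB XY XG YG oth.
have [I2 _ _] := rf_pair hW c (tcol_tr XB YB XY) XG YG.
set s := rf c X G in I2 *; set t := rf _ Y G in I2 *.
have sX : ha (val s) X = G by apply: ha_rf.
have tY : ha (val t) Y = G by apply: ha_rf.
have fx H : H \in B -> H != X -> H != Y -> ha (val s) H = H /\ ha (val t) H = H.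
  move=> HB HX HY; have HG := oth H HB HX HY; split.
    exact: (fix_other XB HB HX sX (nonp_neq XG) HG).1.
  exact: (fix_other YB HB HY tY (nonp_neq YG) HG).1.
apply/and3P; split.
- rewrite eqEcard !card_sa leqnn andbT; apply/subsetP => H /saP[K KB ->].
  have [->|KX] := eqVneq K X; first by rewrite sX -tY mem_sa.
  have [->|KY] := eqVneq K Y; first by rewrite I2 mem_sa.
  by have [-> <-] := fx K KB KX KY; rewrite mem_sa.
- by apply: contraNneq (nonp_notin XB XG) => <-; rewrite -sX mem_sa.
apply/forall_inP => H; rewrite inE => /andP[Hs HB].
have [->|HX] := eqVneq H X.
  by rewrite sX -tY; apply: contraNneq XY => /ha_inj->.
have [->|HY] := eqVneq H Y.
  by rewrite tY -sX; apply: contraNneq XY => /ha_inj->.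
by case/negP: Hs; rewrite mem_act_fixed //; have [-> _] := fx H HB HX HY.
Qed.

Lemma genpair3 c X Y Z G : X \in B -> Y \in B -> Z \in B ->
  X != Y -> X != Z -> Y != Z -> nonp X G -> nonp Y G -> nonp Z G ->
  genpair (rf c X G) (rf c Y G).
Proof.
move=> XB YB ZB XY XZ YZ XG YG ZG.
have [tXY tXZ tYZ] := And3 (tcol_tr XB YB XY) (tcol_tr XB ZB XZ) (tcol_tr YB ZB YZ).
have [e1 e2 _] := rf_triple hW c tXY tXZ tYZ XG YG ZG.
set s := rf c X G in e1 e2 *; set t := rf c Y G in e1 e2 *.
have sX : ha (val s) X = G by apply: ha_rf.
have tY : ha (val t) Y = G by apply: ha_rf.
have fx H : H \in B -> H != X -> H != Y -> H != Z ->
    ha (val s) H = H /\ ha (val t) H = H.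
  move=> HB HX HY HZ; have HG : tr H G.
    apply: (tr_of_not_nonp (nonp_notin XB XG) HB).
    apply/negbT; apply: (nonp_le3 hW tXY tXZ tYZ XG YG ZG).
    - exact: (tcol_tr HB XB HX).
    - exact: (tcol_tr HB YB HY).
    exact: (tcol_tr HB ZB HZ).
  split.
    exact: (fix_other XB HB HX sX (nonp_neq XG) HG).1.
  exact: (fix_other YB HB HY tY (nonp_neq YG) HG).1.
apply/and3P; split.
- rewrite eqEcard !card_sa leqnn andbT; apply/subsetP => H /saP[K KB ->].
  have [->|KX] := eqVneq K X; first by rewrite sX -tY mem_sa.
  have [->|KY] := eqVneq K Y; first by rewrite e1 mem_sa.
  have [->|KZ] := eqVneq K Z; first by rewrite e2 mem_sa.
  by have [-> <-] := fx K KB KX KY KZ; rewrite mem_sa.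
- by apply: contraNneq (nonp_notin XB XG) => <-; rewrite -sX mem_sa.
apply/forall_inP => H; rewrite inE => /andP[Hs HB].
have [->|HX] := eqVneq H X.
  by rewrite -e2; apply: contraNneq XZ => /ha_inj->.
have [->|HY] := eqVneq H Y.
  by rewrite tY -sX; apply: contraNneq XY => /ha_inj->.
have [->|HZ] := eqVneq H Z.
  by rewrite -e1; apply: contraNneq YZ => /ha_inj->.
by case/negP: Hs; rewrite mem_act_fixed //; have [-> _] := fx H HB HX HY HZ.
Qed.
End Fixed.
End Collections.

(** * The character of the stabiliser of a collection *)

Section Characters.
Variables (C : numClosedFieldType) (g : ST_type) (gT : finGroupType).
Variable rho : mx_representation C [set: gT] (ST_rank g).
Hypothesis hW : is_ST rho.
Local Notation unt := (unt hW).
Local Notation tcol := (@transverse_collection C (ST_rank g) gT rho).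
Implicit Types (H G X Y Z : hyp rho) (s t : refl rho).

Definition hp (w : gT) : {perm hyp rho} := perm (@ha_inj _ _ _ rho w).
Lemma hpE w H : hp w H = ha w H. Proof. exact: permE. Qed.
Lemma hpM u w : hp (u * w) = (hp w * hp u)%g.
Proof. by apply/permP => H; rewrite permM !hpE haM. Qed.

Section Sign.
Variable B : {set hyp rho}.
Lemma hp_stab w : w \in Stab_group B -> hp w \in 'N(B | 'P)%g.
Proof.
move=> /StabP wB; apply/astabsP => H.
by rewrite /= /aperm hpE -{1}wB mem_sa.
Qed.
Definition rp w : {perm hyp rho} := restr_perm B (hp w).
Lemma rpE w H : w \in Stab_group B -> H \in B -> rp w H = ha w H.
Proof. by move=> wB HB; rewrite /rp restr_permE ?hp_stab // hpE. Qed.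
Lemma rp_out w H : H \notin B -> rp w H = H.
Proof. by move=> HB; apply: out_perm HB; apply: restr_perm_on. Qed.
Lemma rpM u w : u \in Stab_group B -> w \in Stab_group B ->
  rp (u * w) = (rp w * rp u)%g.
Proof.
by move=> uB wB; rewrite /rp hpM (morphM (restr_perm_morphism B)) ?hp_stab.
Qed.

(* The determinant of w on the subspace orthogonal to the roots of B *)
Definition chiC w : C :=
  \det (rho w) * (-1) ^+ odd_perm (rp w) / \prod_(H in B) unt w H.
Lemma prod_unt_act w u : w \in Stab_group B ->
  \prod_(H in B) unt u (ha w H) = \prod_(H in B) unt u H.
Proof.
move=> wB; rewrite [RHS](reindex_inj (@ha_inj _ _ _ rho w)) /=.
by apply: eq_bigl => H; rewrite -{2}(StabP wB) mem_sa.
Qed.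
Lemma chiCM u w : u \in Stab_group B -> w \in Stab_group B ->
  chiC (u * w)%g = chiC u * chiC w.
Proof.
move=> uB wB; rewrite /chiC rpM // odd_permM signr_addb rhoM det_mulmx.
have -> : \prod_(H in B) unt (u * w)%g H =
    (\prod_(H in B) unt u H) * (\prod_(H in B) unt w H).
  rewrite -(prod_unt_act u wB) -big_split /=; apply: eq_bigr => H _; exact: untM.
rewrite invfM; move: (\prod_(H in B) _)^-1 (\prod_(H in B) unt w H)^-1 => p q.
move: (\det _) (\det _) ((-1) ^+ _) ((-1) ^+ _) => a b c d; ring.
Qed.
Lemma chiC6 w : chiC w ^+ 6 = 1.
Proof.
have d6 : \det (rho w) ^+ 6 = 1 by rewrite (exprM _ 3 2) (rho_det hW) expr1n.
have s6 (b : bool) : ((-1) ^+ b : C) ^+ 6 = 1.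
  by case: b; rewrite ?expr0 ?expr1n // expr1 (exprM _ 2 3) sqrrN !expr1n.
have u6 : (\prod_(H in B) unt w H) ^+ 6 = 1.
  by rewrite -prodrXl big1 // => H _; exact: unt_exp6.
by rewrite /chiC exprMn exprVn exprMn d6 s6 u6 mulr1 invr1 mulr1.
Qed.
Lemma chiC_fix w : (forall H, H \in B -> ha w H = H) ->
  chiC w = \det (rho w) / \prod_(H in B) unt w H.
Proof.
move=> fx; have wB : w \in Stab_group B.
  rewrite Stab_sa; apply/eqP/setP => H; rewrite mem_saV.
  apply/idP/idP => HB; first by rewrite -(haKV w H) fx.
  by rewrite -{1}(fx H HB) haK.
have rp1 : rp w = 1%g.
  apply/permP => H; rewrite perm1; have [HB|HB] := boolP (H \in B).
    by rewrite rpE ?fx.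
  exact: rp_out.
by rewrite /chiC rp1 odd_perm1 mulr1.
Qed.
Lemma chiC1 : chiC 1%g = 1.
Proof.
rewrite chiC_fix => [|H _]; last exact: ha1.
by rewrite repr_mx1 det1 big1 ?divr1 // => H _; exact: unt1.
Qed.
Hypothesis tB : tcol B.
Lemma chiC_refl s : hyp_of s \in B -> chiC (val s) = 1.
Proof.
move=> sB; have fx H : H \in B -> H != hyp_of s -> ha (val s) H = H /\ unt (val s) H = 1.
  by move=> HB Hs; apply: refl_fix_tr; exact: (tcol_tr tB HB sB Hs).
have [m1 m2] := refl_mirror hW s.
rewrite chiC_fix => [|H HB].
  rewrite (bigD1 (hyp_of s) sB) /= m2 big1 ?mulr1 => [|H /andP[HB Hs]].
    by rewrite cls_det // divff // zc_neq0.
  exact: (fx H HB Hs).2.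
have [->|Hs] := eqVneq H (hyp_of s); first exact: m1.
exact: (fx H HB Hs).1.
Qed.

Lemma genpair_stab s t : genpair B s t -> ((val t)^-1 * val s)%g \in Stab_group B.
Proof. by case/and3P => /eqP e _ _; rewrite Stab_sa saM e saK. Qed.
(** By the cocycle rule the product of the units of t^-1 s over B is 1, so only determinants and a
    sign remain. *)
Lemma chiC_genE s t : genpair B s t ->
  \prod_(H in B) unt (val s) H = \prod_(H in B) unt (val t) H ->
  chiC ((val t)^-1 * val s)%g =
   \det (rho (val s)) / \det (rho (val t)) *
   (-1) ^+ odd_perm (rp ((val t)^-1 * val s)%g).
Proof.
move=> gp e; set k := ((val t)^-1 * val s)%g; have kB := genpair_stab gp.
have tk : (val t * k)%g = val s by rewrite mulKVg.
have pk : \prod_(H in B) unt k H = 1.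
  have n0 : \prod_(H in B) unt (val t) H != 0.
    by apply/prodf_neq0 => H _; exact: unt_neq0.
  apply: (mulfI n0); rewrite mulr1 -[RHS]e -tk -(prod_unt_act (val t) kB).
  by rewrite -big_split /=; apply: eq_bigr => H _; rewrite untM.
rewrite /chiC pk divr1 -tk rhoM det_mulmx; congr (_ * _).
rewrite mulrC mulKf //; apply: contraTneq (oner_neq0 C) => d0.
by rewrite -(rho_det hW (val t)) d0 expr0n eqxx.
Qed.
Lemma prod_two (F : hyp rho -> C) X Y : X \in B -> Y \in B -> X != Y ->
  (forall H, H \in B -> H != X -> H != Y -> F H = 1) ->
  \prod_(H in B) F H = F X * F Y.
Proof.
move=> XB YB XY o; have YX : Y != X by rewrite eq_sym.
rewrite (bigD1 X XB) /= (bigD1 Y (introT andP (conj YB YX))) /=.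
rewrite big1 ?mulr1 // => H /andP[/andP[HB HX] HY]; exact: (o H HB HX HY).
Qed.
Lemma prod_three (F : hyp rho -> C) X Y Z : X \in B -> Y \in B -> Z \in B ->
  X != Y -> X != Z -> Y != Z ->
  (forall H, H \in B -> H != X -> H != Y -> H != Z -> F H = 1) ->
  \prod_(H in B) F H = F X * F Y * F Z.
Proof.
move=> XB YB ZB XY XZ YZ o; have YX : Y != X by rewrite eq_sym.
have ZX : Z != X by rewrite eq_sym.
have ZY : Z != Y by rewrite eq_sym.
rewrite (bigD1 X XB) /= (bigD1 Y (introT andP (conj YB YX))) /=.
rewrite (bigD1 Z (introT andP (conj (introT andP (conj ZB ZX)) ZY))) /=.
rewrite big1 ?mulr1 ?mulrA // => H /andP[/andP[/andP[HB HX] HY] HZ].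
exact: (o H HB HX HY HZ).
Qed.

(** For two mirrors, t^-1 s swaps X and Y, hence the sign -1 and a ratio of opposite determinants;
    for three it is an even 3-cycle and the determinants agree. *)
Lemma chiC_gen s t : genpair B s t -> chiC ((val t)^-1 * val s)%g =
  if cls s == cls t then 1 else - zc C (cls t).
Proof.
move=> gp; have kB := genpair_stab gp; set k := (_ * _)%g in kB *.
have kE H K : ha (val s) H = ha (val t) K -> ha k H = K.
  by move=> e; rewrite haM e haK.
case: (genpairP hW tB gp) => [c X Y G XB YB XY XG YG oth sE tE|
                              c X Y Z G XB YB ZB XY XZ YZ XG YG ZG oth sE tE].
  have tXY := tcol_tr tB XB YB XY.
  have [I2 _ u2] := rf_pair hW c tXY XG YG; rewrite -sE -tE in I2 u2.
  have sX : ha (val s) X = G by rewrite sE; apply: ha_rf.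
  have tY : ha (val t) Y = G by rewrite tE; apply: ha_rf.
  have fs H : H \in B -> H != X -> H != Y -> ha (val s) H = H /\ unt (val s) H = 1.
    by move=> HB HX HY; apply: (fix_other hW tB XB HB HX sX (nonp_neq XG) (oth H HB HX HY)).
  have ft H : H \in B -> H != X -> H != Y -> ha (val t) H = H /\ unt (val t) H = 1.
    by move=> HB HX HY; apply: (fix_other hW tB YB HB HY tY (nonp_neq YG) (oth H HB HX HY)).
  have kX : ha k X = Y by apply: kE; rewrite sX tY.
  have kY : ha k Y = X by apply: kE.
  rewrite chiC_genE //; last first.
    rewrite (prod_two XB YB XY) => [|H HB HX HY]; last exact: (fs H HB HX HY).2.
    by rewrite (prod_two XB YB XY) // => H HB HX HY; exact: (ft H HB HX HY).2.
  have -> : rp k = tperm X Y.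
    apply/permP => H; case: tpermP => [->|->|/eqP HX /eqP HY].
    - by rewrite (rpE kB XB).
    - by rewrite (rpE kB YB).
    have [HB|HB] := boolP (H \in B); last exact: rp_out.
    rewrite (rpE kB HB); apply: kE.
    by rewrite (fs H HB HX HY).1 (ft H HB HX HY).1.
  rewrite odd_tperm XY !cls_det // sE tE !cls_rf expr1.
  have -> : (c == ~~ c) = false by case: (c).
  have z0 := zc_neq0 C; have e := zcN C c.
  have -> : (zc C (~~ c))^-1 = zc C c by apply: (mulfI (z0 (~~ c))); rewrite mulfV // mulrC.
  rewrite mulrN1 zcNE -expr2; congr (- _); apply/eqP; rewrite -subr_eq0.
  by rewrite -(zc_sum C c); apply/eqP; ring.
have [tXY tXZ tYZ] := And3 (tcol_tr tB XB YB XY) (tcol_tr tB XB ZB XZ) (tcol_tr tB YB ZB YZ).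
have [e1 e2 u3] := rf_triple hW c tXY tXZ tYZ XG YG ZG; rewrite -sE -tE in e1 e2 u3.
have sX : ha (val s) X = G by rewrite sE; apply: ha_rf.
have tY : ha (val t) Y = G by rewrite tE; apply: ha_rf.
have fs H : H \in B -> H != X -> H != Y -> H != Z -> ha (val s) H = H /\ unt (val s) H = 1.
  by move=> HB HX HY HZ; apply: (fix_other hW tB XB HB HX sX (nonp_neq XG) (oth H HB HX HY HZ)).
have ft H : H \in B -> H != X -> H != Y -> H != Z -> ha (val t) H = H /\ unt (val t) H = 1.
  by move=> HB HX HY HZ; apply: (fix_other hW tB YB HB HY tY (nonp_neq YG) (oth H HB HX HY HZ)).
have kX : ha k X = Y by apply: kE; rewrite sX tY.
have kY : ha k Y = Z by apply: kE.
have kZ : ha k Z = X by apply: kE.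
rewrite chiC_genE //; last first.
  rewrite (prod_three XB YB ZB XY XZ YZ) => [|H HB HX HY HZ]; last exact: (fs H HB HX HY HZ).2.
  by rewrite (prod_three XB YB ZB XY XZ YZ) // => H HB HX HY HZ; exact: (ft H HB HX HY HZ).2.
have -> : odd_perm (rp k) = false.
  have -> : odd_perm (rp k) = odd_perm (rp k * rp k * rp k)%g.
    by rewrite !odd_permM; case: odd_perm.
  have -> : (rp k * rp k * rp k)%g = 1%g; last exact: odd_perm1.
  apply/permP => H; rewrite !permM perm1.
  have [->|HX] := eqVneq H X; first by rewrite (rpE kB XB) kX (rpE kB YB) kY (rpE kB ZB).
  have [->|HY] := eqVneq H Y; first by rewrite (rpE kB YB) kY (rpE kB ZB) kZ (rpE kB XB).
  have [->|HZ] := eqVneq H Z; first by rewrite (rpE kB ZB) kZ (rpE kB XB) kX (rpE kB YB).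
  have [HB|HB] := boolP (H \in B); last by rewrite !rp_out.
  have kH : rp k H = H.
    rewrite (rpE kB HB); apply: kE.
    by rewrite (fs H HB HX HY HZ).1 (ft H HB HX HY HZ).1.
  by rewrite !kH.
rewrite mulr1 !cls_det // sE tE !cls_rf eqxx divff //; exact: zc_neq0.
Qed.
End Sign.
End Characters.

(** * Relations in the Brauer-Chen algebra *)

Section CommutingProducts.
Variables (T : eqType) (A : pzRingType) (f : T -> A).
Definition comm_seq (s : seq T) := {in s &, forall x y, f x * f y = f y * f x}.
Lemma prod_rem s x : comm_seq s -> x \in s ->
  \prod_(y <- s) f y = f x * \prod_(y <- rem x s) f y.
Proof.
elim: s => //= a s IHs cs xs; rewrite big_cons; case: eqP => [->//|ax].
have {}xs : x \in s by move: xs; rewrite inE => /orP[/eqP e|//]; case: ax.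
rewrite big_cons IHs //; last first.
  by move=> y z ys zs; apply: cs; rewrite inE ?ys ?zs orbT.
by rewrite !mulrA [f a * _]cs // inE ?eqxx ?xs ?orbT.
Qed.
Lemma prod_perm s t : comm_seq s -> perm_eq s t ->
  \prod_(y <- s) f y = \prod_(y <- t) f y.
Proof.
elim: s t => [|a s IHs] t cs st.
  by move: st; rewrite perm_sym => /perm_nilP->.
have ct : comm_seq t by move=> y z yt zt; apply: cs; rewrite (perm_mem st).
have at' : a \in t by rewrite -(perm_mem st) mem_head.
rewrite big_cons (prod_rem ct at'); congr (_ * _); apply: IHs.
  by move=> y z ys zs; apply: cs; rewrite inE ?ys ?zs orbT.
by rewrite -(perm_cons a); apply: (perm_trans st); exact: perm_to_rem.
Qed.
End CommutingProducts.

Section KCharacter.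
Variables (C : numClosedFieldType) (g : ST_type) (gT : finGroupType).
Variable rho : mx_representation C [set: gT] (ST_rank g).
Hypothesis hW : is_ST rho.
Variables (R : comPzRingType) (m1 m2 m : R).
Hypotheses (m12 : m1 * m = m2) (m6 : m ^+ 6 = 1).
Local Notation z6 := (zeta6 C).
Definition mr (c : bool) : R := if c then m1 else m2.
(** Discrete logarithm to base [zeta6]. It transports sixth roots of unity to powers of m,
    multiplicatively since m^6 = 1. *)
Definition lg (z : C) : 'I_6 := odflt ord0 [pick i : 'I_6 | z6 ^+ i == z].
Lemma lgE i : m ^+ lg (z6 ^+ i) = m ^+ i.
Proof.
rewrite /lg; case: pickP => [j /eqP|/(_ (Ordinal (ltn_pmod i (isT : 0 < 6)%N)))] /=.
  move/eqP; rewrite (eq_prim_root_expr (zeta6_prim C)) => /eqP e.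
  by rewrite -(expr_mod i m6) -e expr_mod.
by rewrite z6_mod eqxx.
Qed.
Lemma root6 (z : C) : z ^+ 6 = 1 -> exists i, z = z6 ^+ i.
Proof. by case/(prim_rootP (zeta6_prim C)) => i ->; exists i. Qed.

Definition chi (B : {set hyp rho}) (w : gT) : R := m ^+ lg (chiC hW B w).
Section Collection.
Variable B : {set hyp rho}.
Hypothesis tB : transverse_collection B.
Lemma chiM u w : u \in Stab_group B -> w \in Stab_group B ->
  chi B (u * w)%g = chi B u * chi B w.
Proof.
move=> uB wB; rewrite /chi chiCM //.
have [i ->] := root6 (chiC6 hW B u); have [j ->] := root6 (chiC6 hW B w).
by rewrite -exprD !lgE exprD.
Qed.
Lemma chi1 : chi B 1%g = 1.
Proof. by rewrite /chi chiC1 // -(expr0 z6) lgE. Qed.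
Lemma chi_refl s : hyp_of s \in B -> chi B (val s) = 1.
Proof. by move=> sB; rewrite /chi chiC_refl // -(expr0 z6) lgE. Qed.
Lemma chi_gen s t : genpair B s t ->
  mr (cls s) * chi B ((val t)^-1 * val s)%g = mr (cls t).
Proof.
move=> gp; rewrite /chi (chiC_gen hW tB gp); have [<-|] := eqVneq (cls s) (cls t).
  by rewrite -(expr0 z6) lgE mulr1.
case: (cls s); case: (cls t) => // _ /=.
  (* With s distinguished the exponent is 1, which turns mu_1 into mu_2; in the other case it is 5,
     that is -1. *)
  have -> : - zc C false = z6 ^+ 1 by rewrite expr1.
  by rewrite lgE expr1.
have -> : - zc C true = z6 ^+ 5.
  by rewrite (exprD _ 3 2) zeta6_cube zeta6_sq mulN1r /zc expr1.
by rewrite lgE -m12 -mulrA -exprS m6 mulr1.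
Qed.
End Collection.
End KCharacter.

Section GroupKB.
Variables (C : numClosedFieldType) (g : ST_type) (gT : finGroupType).
Variable rho : mx_representation C [set: gT] (ST_rank g).
Hypothesis hW : is_ST rho.
Local Notation tcol := (@transverse_collection C (ST_rank g) gT rho).
Implicit Types (B : {set hyp rho}) (s t : refl rho).
Lemma refl_stab B s : tcol B -> hyp_of s \in B -> val s \in Stab_group B.
Proof.
move=> tB sB; rewrite Stab_sa eqEcard card_sa leqnn andbT.
apply/subsetP => H /saP[K KB ->]; have [->|Ks] := eqVneq K (hyp_of s).
  by rewrite (refl_mirror hW s).1.
by rewrite (refl_fix_tr hW (tcol_tr tB KB sB Ks)).1.
Qed.

(** Membership in the stabiliser is carried along because [chi] is multiplicative only there. *)
Lemma KB_ind B (P : gT -> Prop) : tcol B -> P 1%g ->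
  (forall u w, u \in Stab_group B -> w \in Stab_group B -> P u -> P w -> P (u * w)%g) ->
  (forall s, hyp_of s \in B -> P (val s)) ->
  (forall s t, genpair B s t -> P ((val t)^-1 * val s)%g) ->
  forall k, k \in KB B -> k \in Stab_group B /\ P k.
Proof.
move=> tB P1 PM Pr Pg k /gen_prodgP[j [c cE ->]].
apply: (big_ind (fun k => k \in Stab_group B /\ P k)).
- by split=> //; exact: group1.
- by move=> u w [uB Pu] [wB Pw]; split; [exact: groupM | exact: PM].
move=> i _; have := cE i; case/setUP => /imsetP[].
  move=> s; rewrite inE => sB ->; split; [exact: refl_stab | exact: Pr].
move=> [s t] /=; rewrite inE /= => gp0 ->.
have gp : genpair B s t.
  case/and3P: gp0 => g1 g2 /forall_inP g3; rewrite /genpair g1 g2 /=.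
  by apply/forall_inP => H /g3; rewrite !haE.
by split; [exact: (genpair_stab gp) | exact: Pg].
Qed.
Lemma KB_stab B k : tcol B -> k \in KB B -> k \in Stab_group B.
Proof. by move=> tB /(@KB_ind B (fun=> True) tB)[]. Qed.
Lemma transversal_dec (K X : {set gT}) (G : {group gT}) w : K = G ->
  is_transversal X (lcosets K [set: gT]) [set: gT] ->
  exists2 x, x \in X & exists2 k, k \in G & w = (x * k)%g.
Proof.
move=> -> /and3P[_ _ /forall_inP/(_ (w *: G)%g)].
have wl : (w *: G)%g \in lcosets G [set: gT] by apply/lcosetsP; exists w; rewrite ?inE.
move/(_ wl)/cards1P => [x xE].
have : x \in X :&: (w *: G)%g by rewrite xE set11.
rewrite inE mem_lcoset => /andP[xX xw]; exists x => //.
by exists (x^-1 * w)%g; rewrite ?mulKVg // -groupV invMg invgK.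
Qed.
End GroupKB.

Section BrauerRelations.
Variables (C : numClosedFieldType) (g : ST_type) (gT : finGroupType).
Variable rho : mx_representation C [set: gT] (ST_rank g).
Hypothesis hW : is_ST rho.
Local Notation rf := (rf hW).
Local Notation tcol := (@transverse_collection C (ST_rank g) gT rho).
Local Notation sa := (@Defs.setact C (ST_rank g) gT rho).
Variables (R : comNzRingType) (A : algType R) (d m1 m2 : R).
Variables (iw : gT -> A) (ie : hyp rho -> A).
Local Notation mr := (mr m1 m2).
(* [br_non] is (B5): R_{H -> G} contains one reflection of each class. *)
Record brauer_rel : Prop := BrauerRel {
  br_iw1 : iw 1%g = 1;
  br_iwM : forall u w, iw (u * w)%g = iw u * iw w;
  br_ee : forall H, ie H * ie H = d *: ie H;
  br_we : forall w H, iw w * ie H = ie (ha w H) * iw w;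
  br_fix : forall s : refl rho, iw (val s) * ie (hyp_of s) = ie (hyp_of s);
  br_comm : forall H G, tr H G -> ie H * ie G = ie G * ie H;
  br_non : forall H G, nonp H G -> ie G * ie H =
    (m1 *: iw (val (rf true H G)) + m2 *: iw (val (rf false H G))) * ie H }.
Hypothesis br : brauer_rel.

Definition eB (B : {set hyp rho}) : A := \prod_(H in B) ie H.
Lemma eB_perm B s : tcol B -> perm_eq s (enum B) -> eB B = \prod_(H <- s) ie H.
Proof.
move=> tB sB; have -> : eB B = \prod_(H <- enum B) ie H.
  by rewrite /eB -big_filter [index_enum _]unlock.
apply: prod_perm; last by rewrite perm_sym.
move=> H G; rewrite !mem_enum => HB GB; have [->//|HG] := eqVneq H G.
exact: (br_comm br (tcol_tr tB HB GB HG)).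
Qed.
Lemma eBU H B : tcol (H |: B) -> H \notin B -> eB (H |: B) = ie H * eB B.
Proof.
move=> tHB HB; have tB : tcol B.
  apply/tcolP => G K GB KB; apply: (tcol_tr tHB); exact: setU1r.
rewrite (@eB_perm _ (H :: enum B)) //.
  by rewrite big_cons -(eB_perm tB (perm_refl _)).
apply: uniq_perm; rewrite /= ?mem_enum ?HB ?enum_uniq // => G.
by rewrite mem_enum in_setU1 in_cons mem_enum.
Qed.
Lemma tcolU H (B : {set hyp rho}) : tcol B -> (forall G, G \in B -> tr H G) -> tcol (H |: B).
Proof.
move=> tB HB; apply/tcolP => G K /setU1P[->|GB] /setU1P[->|KB].
- by rewrite eqxx.
- by move=> _; exact: HB.
- by move=> _; rewrite (perp_sym hW); exact: HB.
exact: (tcol_tr tB GB KB).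
Qed.
Lemma tr_notin H (B : {set hyp rho}) : (forall G, G \in B -> tr H G) -> H \notin B.
Proof. by move=> h; apply/negP => /h; rewrite (perp_irr hW). Qed.
Lemma ie_eB_in B H : tcol B -> H \in B -> ie H * eB B = d *: eB B.
Proof.
move=> tB HB; have BE : H |: (B :\ H) = B := setD1K HB.
have HN : H \notin B :\ H by rewrite setD11.
rewrite -BE in tB *; rewrite (eBU tB HN) mulrA (br_ee br).
by rewrite -scalerAl.
Qed.
Lemma ie_eB_tr B H : tcol B -> (forall G, G \in B -> tr H G) ->
  ie H * eB B = eB (H |: B).
Proof. by move=> tB HB; rewrite (eBU (tcolU tB HB) (tr_notin HB)). Qed.
Lemma iw_eB w B : tcol B -> iw w * eB B = eB (sa w B) * iw w.
Proof.
move=> tB; have tw : tcol (sa w B) by rewrite tcol_act.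
rewrite (eB_perm tB (perm_refl _)) (@eB_perm _ (map (ha w) (enum B)) tw); last first.
  apply: uniq_perm; rewrite ?enum_uniq // ?map_inj_uniq ?enum_uniq //; first exact: ha_inj.
  move=> G; rewrite mem_enum saE; apply/mapP/imsetP.
    by case=> K; rewrite mem_enum => KB ->; exists K.
  by case=> K KB ->; exists K; rewrite ?mem_enum.
elim: (enum B) => [|H s IHs] /=; first by rewrite !big_nil mulr1 mul1r.
by rewrite !big_cons mulrA (br_we br) -mulrA IHs mulrA.
Qed.
Lemma ie_eB_non B H G : tcol B -> H \in B -> nonp H G -> ie G * eB B =
  (m1 *: iw (val (rf true H G)) + m2 *: iw (val (rf false H G))) * eB B.
Proof.
move=> tB HB HG; have BE : H |: (B :\ H) = B := setD1K HB.
have HN : H \notin B :\ H by rewrite setD11.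
by rewrite -BE in tB *; rewrite (eBU tB HN) mulrA (br_non br HG) -mulrA.
Qed.
Lemma ie_eB_nonc c B H G : tcol B -> H \in B -> nonp H G -> ie G * eB B =
  mr c *: (iw (val (rf c H G)) * eB B) +
  mr (~~ c) *: (iw (val (rf (~~ c) H G)) * eB B).
Proof.
move=> tB HB HG; rewrite (ie_eB_non tB HB HG) mulrDl -!scalerAl.
by case: c => //=; rewrite addrC.
Qed.
Lemma iw_refl_eB B s : tcol B -> hyp_of s \in B -> iw (val s) * eB B = eB B.
Proof.
move=> tB HB; have BE := setD1K HB; have HN : hyp_of s \notin B :\ hyp_of s by rewrite setD11.
by rewrite -BE in tB *; rewrite (eBU tB HN) mulrA (br_fix br).
Qed.

Lemma ie_act_in w B Q : tcol B -> Q \in sa w B ->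
  ie Q * (iw w * eB B) = d *: (iw w * eB B).
Proof.
move=> tB QB; rewrite (iw_eB _ tB) mulrA.
by rewrite ie_eB_in ?tcol_act // -scalerAl.
Qed.

Local Notation idx := ({set hyp rho} * gT)%type.
Definition bas (p : idx) : A := iw p.2 * eB p.1.
Definition spn (P : pred idx) (x : A) := exists c : idx -> R, x = \sum_(p | P p) c p *: bas p.
Section Span.
Variable P : pred idx.
Lemma spn0 : spn P 0.
Proof. by exists (fun=> 0); rewrite big1 // => p _; rewrite scale0r. Qed.
Lemma spnD x y : spn P x -> spn P y -> spn P (x + y).
Proof.
move=> [c ->] [c' ->]; exists (fun p => c p + c' p).
by rewrite -big_split; apply: eq_bigr => p _; rewrite scalerDl.
Qed.
Lemma spnZ a x : spn P x -> spn P (a *: x).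
Proof.
move=> [c ->]; exists (fun p => a * c p).
by rewrite scaler_sumr; apply: eq_bigr => p _; rewrite scalerA.
Qed.
Lemma spn_bas p : P p -> spn P (bas p).
Proof.
move=> Pp; exists (fun q => (q == p)%:R).
rewrite (bigD1 p) //= eqxx scale1r big1 ?addr0 // => q /andP[_ /negPf->].
by rewrite scale0r.
Qed.
Lemma spn_sum (I : Type) (r : seq I) (Q : pred I) (F : I -> A) :
  (forall i, Q i -> spn P (F i)) -> spn P (\sum_(i <- r | Q i) F i).
Proof. by move=> h; elim/big_ind: _ => //; [exact: spn0 | exact: spnD]. Qed.
Lemma spnN x : spn P x -> spn P (- x).
Proof. by rewrite -scaleN1r; exact: spnZ. Qed.
Lemma spnB x y : spn P x -> spn P y -> spn P (x - y).
Proof. by move=> xP /spnN; exact: spnD. Qed.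
End Span.
Lemma spn_trans (P Q : pred idx) x : (forall p, P p -> spn Q (bas p)) -> spn P x -> spn Q x.
Proof. by move=> h [c ->]; apply: spn_sum => p /h; exact: spnZ. Qed.
Lemma spn_ind (P : pred idx) (Q : A -> Prop) : Q 0 -> (forall x y, Q x -> Q y -> Q (x + y)) ->
  (forall a x, Q x -> Q (a *: x)) -> (forall p, P p -> Q (bas p)) ->
  forall x, spn P x -> Q x.
Proof. by move=> Q0 QD QZ Qb x [c ->]; elim/big_ind: _ => // p /Qb/QZ. Qed.

(** The filtration by size; its steps are stable under left multiplication by W and by the e_H
    ([spn_iw], [spn_ie]). *)
Definition lvl (k : nat) : pred idx := fun p => tcol p.1 && (k <= #|p.1|)%N.
Lemma spn_iw k u x : spn (lvl k) x -> spn (lvl k) (iw u * x).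
Proof.
elim/spn_ind: x / => [|x y|a x|[B w] /= Bk]; rewrite ?mulr0 ?mulrDr -?scalerAr.
- exact: spn0.
- exact: spnD.
- exact: spnZ.
rewrite /bas /= mulrA -(br_iwM br).
by have := @spn_bas (lvl k) (B, (u * w)%g); apply.
Qed.
Lemma spn_eB k B u : tcol B -> (k <= #|B|)%N -> spn (lvl k) (iw u * eB B).
Proof.
move=> tB kB; have := @spn_bas (lvl k) (B, u); apply.
by rewrite /lvl /= tB.
Qed.
Lemma spn_ie k H x : spn (lvl k) x -> spn (lvl k) (ie H * x).
Proof.
elim/spn_ind: x / => [|x y|a x|[B w] /= /andP[/= tB Bk]]; rewrite ?mulr0 ?mulrDr -?scalerAr.
- exact: spn0.
- exact: spnD.
- exact: spnZ.
rewrite /bas /= mulrA -{1}(haKV w H) -(br_we br) -mulrA; apply: spn_iw.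
set K := ha _ H; have [KB|KB] := boolP (K \in B).
  rewrite (ie_eB_in tB KB); apply: spnZ.
  by rewrite -[eB B]mul1r -(br_iw1 br); exact: spn_eB.
have [/exists_inP[G GB GK]|nG] := boolP [exists G in B, nonp G K].
  rewrite (ie_eB_nonc true tB GB GK); apply: spnD; apply: spnZ; exact: spn_eB.
have KT G : G \in B -> tr K G.
  move=> GB; rewrite (perp_sym hW); apply: (tr_of_not_nonp KB GB).
  by apply: contra nG => h; apply/exists_inP; exists G.
rewrite (ie_eB_tr tB KT) -[eB _]mul1r -(br_iw1 br); apply: spn_eB.
  exact: tcolU.
by rewrite cardsU1 (tr_notin KT) (leq_trans Bk) // leq_addl.
Qed.

Section Generators.
Variables (dV m1V m2V : R).
Hypotheses (d1 : d * dV = 1) (m11 : m1 * m1V = 1) (m21 : m2 * m2V = 1).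
Lemma scale_d_inj (x y : A) : d *: x = d *: y -> x = y.
Proof. by move/(congr1 ( *:%R dV)); rewrite !scalerA mulrC d1 !scale1r. Qed.
Lemma mr_inj c (x y : A) : mr c *: x = mr c *: y -> x = y.
Proof.
case: c => /=; [move/(congr1 ( *:%R m1V)) | move/(congr1 ( *:%R m2V))];
  by rewrite !scalerA mulrC ?m11 ?m21 !scale1r.
Qed.

Section Pair.
Variables (B : {set hyp rho}) (c : bool) (X Y G : hyp rho).
Hypotheses (tB : tcol B) (XB : X \in B) (YB : Y \in B) (XY : X != Y).
Hypotheses (XG : nonp X G) (YG : nonp Y G).
Hypothesis oth : forall H, H \in B -> H != X -> H != Y -> tr H G.
Local Notation Q := (ha (val (rf (~~ c) X G)) Y).
(** Q is the image of Y under the reflection of the other class carrying X to G; it is transverse to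
    the image of Y under the first one by [rf_pair]. *)
Lemma Q_tr H : H \in sa (val (rf c X G)) B -> tr Q H.
Proof.
have tXY := tcol_tr tB XB YB XY.
have [_ I2 _] := rf_pair hW c tXY XG YG.
have sX := ha_rf hW c XG; have bX := ha_rf hW (~~ c) XG.
case/saP => K KB ->; have [->|KX] := eqVneq K X.
  by rewrite sX -{2}bX tr_act // (perp_sym hW).
have [->|KY] := eqVneq K Y; first by rewrite (perp_sym hW).
have [-> _] := fix_other hW tB XB KB KX sX (nonp_neq XG) (oth KB KX KY).
have [e _] := fix_other hW tB XB KB KX bX (nonp_neq XG) (oth KB KX KY).
by rewrite -e tr_act // (perp_sym hW); apply: (tcol_tr tB KB YB KY).
Qed.
(** Expanding e_G e_B by (B5) through X and through Y gives two sums of two terms. Their comparison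
    rewrites y with the other two reflections, and Q belongs to both of the corresponding translates
    of B, so that e_Q acts on y by d. *)
Lemma br_pair : let y := mr c *: (iw (val (rf c X G)) * eB B) -
    mr (~~ c) *: (iw (val (rf (~~ c) Y G)) * eB B) in
  d *: y = ie Q * y.
Proof.
move=> y; have tXY := tcol_tr tB XB YB XY.
have tYX : tr Y X by rewrite (perp_sym hW).
have [I2 _ _] := rf_pair hW (~~ c) tXY XG YG; rewrite negbK in I2.
have yE : y = mr c *: (iw (val (rf c Y G)) * eB B) -
              mr (~~ c) *: (iw (val (rf (~~ c) X G)) * eB B).
  have := ie_eB_nonc c tB XB XG; rewrite (ie_eB_nonc c tB YB YG) => e.
  apply/eqP; rewrite /y subr_eq addrAC eq_sym subr_eq -e.
  by rewrite addrC.
rewrite yE mulrBr -!scalerAr !ie_act_in ?scalerBr ?scalerA ?[d * _]mulrC //.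
  by rewrite mem_sa.
by rewrite I2 mem_sa.
Qed.
(** As originally written, y involves translates of B transverse to Q, so e_Q y has one more mirror;
    and y = d^-1 e_Q y. *)
Lemma br_pair_spn : spn (lvl #|B|.+1)
  (mr c *: (iw (val (rf c X G)) * eB B) - mr (~~ c) *: (iw (val (rf (~~ c) Y G)) * eB B)).
Proof.
set y := (X in spn _ X).
have -> : y = dV *: (ie Q * y).
  by rewrite -br_pair scalerA mulrC d1 scale1r.
have gp := genpair2 hW tB c XB YB XY XG YG oth.
have sB : sa (val (rf c X G)) B = sa (val (rf (~~ c) Y G)) B.
  by case/and3P: gp => /eqP.
have QT H : H \in sa (val (rf (~~ c) Y G)) B -> tr Q H by rewrite -sB; exact: Q_tr.
have step (r : refl rho) : (forall H, H \in sa (val r) B -> tr Q H) ->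
    spn (lvl #|B|.+1) (ie Q * (iw (val r) * eB B)).
  move=> h; have tr' : tcol (sa (val r) B) by rewrite tcol_act.
  rewrite (iw_eB _ tB) mulrA (ie_eB_tr tr' h).
  have tQ := tcolU tr' h; set B' := Q |: _ in tQ *.
  have QB : (#|B|.+1 <= #|B'|)%N by rewrite cardsU1 (tr_notin h) card_sa.
  rewrite -[B'](saKV (val r)) -iw_eB ?tcol_act //.
  by apply: spn_eB; rewrite ?tcol_act // card_sa.
apply: spnZ; rewrite mulrBr -!scalerAr; apply: spnB; apply: spnZ; apply: step => //.
exact: Q_tr.
Qed.
End Pair.

(** With three mirrors the relation is exact. The transverse mirrors G and G2 = sY satisfy e_G2 e_G
    e_B = d e_G e_B and e_G e_G2 e_B = d e_G2 e_B, so e_G e_B = e_G2 e_B; their expansions share a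
    term, and cancelling it leaves the equality. *)
Lemma br_triple B c X Y Z G : tcol B -> X \in B -> Y \in B -> Z \in B ->
    X != Y -> X != Z -> Y != Z -> nonp X G -> nonp Y G -> nonp Z G ->
  iw (val (rf c X G)) * eB B = iw (val (rf c Y G)) * eB B.
Proof.
move=> tB XB YB ZB XY XZ YZ XG YG ZG.
have [tXY tXZ tYZ] := And3 (tcol_tr tB XB YB XY) (tcol_tr tB XB ZB XZ) (tcol_tr tB YB ZB YZ).
have [e1 e2 _] := rf_triple hW c tXY tXZ tYZ XG YG ZG.
set s := rf c X G in e1 e2 *; set t := rf c Y G in e1 e2 *.
have [e3 e4 _] := rf_triple hW c tXZ tXY (etrans (perp_sym hW Z Y) tYZ) XG ZG YG.
have [b1 _ _] := rf_pair hW (~~ c) tXY XG YG.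
have [b2 _ _] := rf_pair hW (~~ c) tXZ XG ZG.
rewrite negbK in b1 b2; set b := rf (~~ c) X G in b1 b2.
have sX : ha (val s) X = G by apply: ha_rf.
have tY : ha (val t) Y = G by apply: ha_rf.
have bX : ha (val b) X = G by apply: ha_rf.
pose G2 := ha (val s) Y.
have bZ : ha (val b) Z = G2 by rewrite b2 /G2 e4.
have tZ : ha (val t) Z = G2 by rewrite -e1.
have ZG2 : nonp Z G2.
  rewrite -tZ; apply: (refl_moves_nonp hW).
  have <- := moved_nonp hW tB YB ZB (rf_moves hW c YG).
  by rewrite -/t tY.
have tGG : tr G2 G by rewrite -sX tr_act // (perp_sym hW).
have E1 := ie_eB_nonc c tB XB XG; rewrite -/s -/b in E1.
have tE := rf_uniq hW ZG2 tZ; rewrite cls_rf in tE.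
have bE := rf_uniq hW ZG2 bZ; rewrite cls_rf in bE.
have E2 := ie_eB_nonc c tB ZB ZG2; rewrite -tE -bE in E2.
have F1 : ie G2 * (ie G * eB B) = d *: (ie G * eB B).
  rewrite E1 mulrDr -!scalerAr !ie_act_in ?scalerDr ?scalerA ?[d * _]mulrC //.
    by rewrite -bZ mem_sa.
  by rewrite /G2 mem_sa.
have F2 : ie G * (ie G2 * eB B) = d *: (ie G2 * eB B).
  rewrite E2 mulrDr -!scalerAr !ie_act_in ?scalerDr ?scalerA ?[d * _]mulrC //.
    by rewrite -bX mem_sa.
  by rewrite -tY mem_sa.
have : ie G * eB B = ie G2 * eB B.
  by apply: scale_d_inj; rewrite -F1 -F2 !mulrA (br_comm br tGG).
by rewrite E1 E2 => /addIr/mr_inj.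
Qed.

Lemma br_genpair B s t : tcol B -> genpair B s t -> spn (lvl #|B|.+1)
  (mr (cls s) *: (iw (val s) * eB B) - mr (cls t) *: (iw (val t) * eB B)).
Proof.
move=> tB gp.
case: (genpairP hW tB gp) => [c X Y G XB YB XY XG YG oth -> ->|
    c X Y Z G XB YB ZB XY XZ YZ XG YG ZG oth -> ->]; rewrite !cls_rf.
  exact: (br_pair_spn c tB XB YB XY XG YG oth).
by rewrite (br_triple c tB XB YB ZB XY XZ YZ XG YG ZG) subrr; exact: spn0.
Qed.

Definition mrV (c : bool) := if c then m1V else m2V.
Lemma mrVK c : mrV c * mr c = 1.
Proof. by case: c; rewrite /= mulrC. Qed.
Variable m : R.
Hypotheses (m12 : m1 * m = m2) (m6 : m ^+ 6 = 1).
Local Notation chi := (@chi C g gT rho hW R m).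

(** [chi_gen] matches the coefficients of [br_genpair]; the multiplicativity of [chi] then extends
    the congruence from the generators to K_B. *)
Lemma br_KB B k : tcol B -> k \in KB B ->
  spn (lvl #|B|.+1) (iw k * eB B - chi B k *: eB B).
Proof.
move=> tB kK; pose P k := spn (lvl #|B|.+1) (iw k * eB B - chi B k *: eB B).
suff [] : k \in Stab_group B /\ P k by [].
apply: (KB_ind hW (P := P)) kK => {k} //.
- by rewrite /P (br_iw1 br) mul1r (chi1 hW m6) scale1r subrr; exact: spn0.
- move=> u w uB wB uP wP; rewrite /P (br_iwM br) (chiM hW m6 uB wB).
  have -> : iw u * iw w * eB B - (chi B u * chi B w) *: eB B =
    iw u * (iw w * eB B - chi B w *: eB B) +
    chi B w *: (iw u * eB B - chi B u *: eB B).
    by rewrite mulrBr scalerBr mulrA -scalerAr addrA subrK scalerA mulrC.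
  by apply: spnD; [exact: spn_iw | exact: spnZ].
- move=> s sB; rewrite /P (iw_refl_eB tB sB) (chi_refl hW m6 tB sB) scale1r subrr.
  exact: spn0.
move=> s t gp; have ce := chi_gen hW m12 m6 tB gp.
have := spn_iw (val t)^-1%g (br_genpair tB gp).
rewrite mulrBr -!scalerAr !mulrA -!(br_iwM br) mulVg (br_iw1 br) mul1r -ce.
rewrite /P; set k := (_ * _)%g => e.
have -> : iw k * eB B - chi B k *: eB B = mrV (cls s) *:
    (mr (cls s) *: (iw k * eB B) - (mr (cls s) * chi B k) *: eB B).
  rewrite scalerBr !scalerA mulrA mrVK.
  by rewrite scale1r mul1r.
exact: spnZ.
Qed.

(** Descending induction on the size: writing w = xu with u in K_B replaces w e_B by chi_B(u) x e_B
    plus terms of larger size, and there are none beyond the number of mirrors. *)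
Lemma br_span (X : {set hyp rho} -> {set gT}) :
  (forall B, tcol B -> is_transversal (X B) (lcosets (KB B) [set: gT]) [set: gT]) ->
  forall x, spn (lvl 0) x -> spn (fun p => tcol p.1 && (p.2 \in X p.1)) x.
Proof.
move=> XP; set Q := (fun p => _).
suff h (j k : nat) : (k + j = #|{: hyp rho}|.+1)%N -> forall x, spn (lvl k) x -> spn Q x.
  exact: (h _ 0%N (add0n _)).
elim: j k => [|j IHj] k kj x.
  rewrite addn0 in kj; case=> c ->; rewrite big_pred0; first exact: spn0.
  move=> [B w]; apply/negbTE; rewrite /lvl /= kj negb_and orbC -leqNgt.
  by rewrite max_card.
apply: spn_trans => -[B w] /andP[/= tB]; rewrite leq_eqVlt => /orP[/eqP kB|kB]; last first.
  apply: (IHj k.+1); first by rewrite addSnnS.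
  by apply: spn_bas; rewrite /lvl /= tB.
have [x0 xX [u uK ->]] := transversal_dec w (erefl : KB B = <<_>>%G) (XP B tB).
have -> : bas (B, (x0 * u)%g) = iw x0 * (iw u * eB B - chi B u *: eB B) +
    chi B u *: bas (B, x0).
  by rewrite /bas /= (br_iwM br) mulrBr -scalerAr mulrA subrK.
apply: spnD; last by apply: spnZ; apply: spn_bas; rewrite /Q /= tB.
apply: (IHj k.+1); first by rewrite addSnnS.
by rewrite kB; apply: spn_iw; exact: br_KB.
Qed.
End Generators.
End BrauerRelations.

(** * Sector modules *)

Section Sectors.
Variables (C : numClosedFieldType) (g : ST_type) (gT : finGroupType).
Variable rho : mx_representation C [set: gT] (ST_rank g).
Hypothesis hW : is_ST rho.
Local Notation rf := (rf hW).
Local Notation tcol := (@transverse_collection C (ST_rank g) gT rho).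
Local Notation sa := (@Defs.setact C (ST_rank g) gT rho).
Variables (R : comNzRingType) (S : algType R) (d m1 m2 : R).
Local Notation mr := (mr m1 m2).
Implicit Types (B : {set hyp rho}) (X Y Z H G : hyp rho) (s t : refl rho).
Variables (L : gT -> S) (pi : {set hyp rho} -> S).
Hypotheses (L1 : L 1%g = 1) (LM : forall u w, L (u * w)%g = L u * L w).
Hypothesis pi_orth : forall B B', pi B * pi B' = if B == B' then pi B else 0.
Hypothesis L_pi : forall w B, L w * pi B = pi (sa w B) * L w.
Hypothesis pi_tcol : forall B, ~~ tcol B -> pi B = 0.
Hypothesis pi_refl : forall B s, hyp_of s \in B -> L (val s) * pi B = pi B.
Hypothesis pi_gen : forall B s t, tcol B -> genpair B s t ->
  mr (cls s) *: (L (val s) * pi B) = mr (cls t) *: (L (val t) * pi B).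

(** The action forced by (B1) and (B5) on the sector of B. On that sector the mirror chosen by
    [pick] is immaterial, by [sop_indep]. *)
Definition sop (G : hyp rho) (B : {set hyp rho}) : S :=
  if G \in B then d%:A else
  if [pick H in B | nonp H G] is Some H
  then m1 *: L (val (rf true H G)) + m2 *: L (val (rf false H G)) else 0.
Definition sE (G : hyp rho) : S := \sum_B sop G B * pi B.
Local Notation E := sE.

Lemma sE_pi G B : E G * pi B = sop G B * pi B.
Proof.
rewrite /sE mulr_suml (bigD1 B) //= -mulrA pi_orth eqxx big1 ?addr0 // => B' BB.
by rewrite -mulrA pi_orth (negPf BB) mulr0.
Qed.
Lemma sE_sum G : E G = \sum_B E G * pi B.
Proof. by apply: eq_bigr => B _; rewrite sE_pi. Qed.
Lemma sE_in G B : G \in B -> E G * pi B = d *: pi B.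
Proof. by move=> GB; rewrite sE_pi /sop GB -scalerAl mul1r. Qed.
Lemma pi_pair c B X Y G : tcol B -> X \in B -> Y \in B -> X != Y ->
    nonp X G -> nonp Y G -> (forall H, H \in B -> H != X -> H != Y -> tr H G) ->
  mr c *: (L (val (rf c X G)) * pi B) = mr (~~ c) *: (L (val (rf (~~ c) Y G)) * pi B).
Proof.
move=> tB XB YB XY XG YG oth.
by have := pi_gen tB (genpair2 hW tB c XB YB XY XG YG oth); rewrite !cls_rf.
Qed.
Lemma pi_triple c B X Y Z G : tcol B -> X \in B -> Y \in B -> Z \in B ->
    X != Y -> X != Z -> Y != Z -> nonp X G -> nonp Y G -> nonp Z G ->
  mr c *: (L (val (rf c X G)) * pi B) = mr c *: (L (val (rf c Y G)) * pi B).
Proof.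
move=> tB XB YB ZB XY XZ YZ XG YG ZG.
by have := pi_gen tB (genpair3 hW tB c XB YB ZB XY XZ YZ XG YG ZG); rewrite !cls_rf.
Qed.
(** A change from X to Y preserves each term when a third member of B is non-transverse to G, and
    exchanges the two terms otherwise. *)
Lemma sop_indep B X Y G : tcol B -> X \in B -> Y \in B -> nonp X G -> nonp Y G ->
  mr true *: (L (val (rf true X G)) * pi B) + mr false *: (L (val (rf false X G)) * pi B) =
  mr true *: (L (val (rf true Y G)) * pi B) + mr false *: (L (val (rf false Y G)) * pi B).
Proof.
move=> tB XB YB XG YG; have [->//|XY] := eqVneq X Y.
have [/exists_inP[Z ZB /and3P[ZX ZY ZG]]|nZ] :=
    boolP [exists Z in B, [&& Z != X, Z != Y & nonp Z G]].
  rewrite eq_sym in ZX; rewrite eq_sym in ZY.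
  by congr (_ + _); apply: (pi_triple _ tB XB YB ZB XY ZX ZY XG YG ZG).
have oth H : H \in B -> H != X -> H != Y -> tr H G.
  move=> HB HX HY; apply: (tr_of_not_nonp (nonp_notin tB XB XG) HB).
  apply: contra nZ => HG; apply/exists_inP; exists H => //.
  exact: (introT and3P (And3 HX HY HG)).
rewrite (pi_pair true tB XB YB XY XG YG oth) (pi_pair false tB XB YB XY XG YG oth).
exact: addrC.
Qed.
Lemma sE_non c B X G : tcol B -> X \in B -> nonp X G ->
  E G * pi B = mr c *: (L (val (rf c X G)) * pi B) + mr (~~ c) *: (L (val (rf (~~ c) X G)) * pi B).
Proof.
move=> tB XB XG.
suff -> : E G * pi B = mr true *: (L (val (rf true X G)) * pi B) +
    mr false *: (L (val (rf false X G)) * pi B) by case: c => //=; rewrite addrC.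
rewrite sE_pi /sop (negPf (nonp_notin tB XB XG)).
case: pickP => [Y /andP[YB YG]|/(_ X)]; last by rewrite XB XG.
by rewrite -(sop_indep tB YB XB YG XG) mulrDl -!scalerAl.
Qed.
Lemma sE_0 B G : G \notin B -> (forall H, H \in B -> tr H G) -> E G * pi B = 0.
Proof.
move=> GB HG; rewrite sE_pi /sop (negPf GB); case: pickP => [H /andP[HB]|_].
  by rewrite (perp_nonp (HG H HB)).
by rewrite mul0r.
Qed.
(* The image of [sE G] lies in the sectors containing [G]. *)
Lemma sE_ext G u v : (forall B, tcol B -> G \in B -> u * pi B = v * pi B) -> u * E G = v * E G.
Proof.
move=> uv; rewrite sE_sum !mulr_sumr; apply: eq_bigr => B _.
have [tB|/pi_tcol->] := boolP (tcol B); last by rewrite !mulr0.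
have [GB|GB] := boolP (G \in B); first by rewrite sE_in // -!scalerAr uv.
have [/exists_inP[H HB HG]|nH] := boolP [exists H in B, nonp H G].
  have step c : u * (L (val (rf c H G)) * pi B) = v * (L (val (rf c H G)) * pi B).
    rewrite L_pi !mulrA uv ?tcol_act //.
    by rewrite -{1}(ha_rf hW c HG) mem_sa.
  by rewrite (sE_non true tB HB HG) !mulrDr -!scalerAr !step.
rewrite sE_0 ?mulr0 // => H HB; apply: (tr_of_not_nonp GB HB).
by apply: contra nH => HG; apply/exists_inP; exists H.
Qed.
Lemma rf_cjr w c H G : nonp H G -> cjr w (rf c H G) = rf c (ha w H) (ha w G).
Proof.
move=> HG; have wHG : nonp (ha w H) (ha w G) by rewrite nonp_act.
rewrite (rf_uniq hW (s := cjr w (rf c H G)) wHG) ?cls_cjr ?cls_rf //.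
by rewrite ha_cjr ha_rf.
Qed.
Lemma L_sE w G : L w * E G = E (ha w G) * L w.
Proof.
rewrite (sE_sum G) mulr_sumr [in RHS](sE_sum (ha w G)) mulr_suml.
rewrite [RHS](reindex_inj (can_inj (saK w))) /=; apply: eq_bigr => B _.
rewrite -mulrA -L_pi.
have [tB|/pi_tcol->] := boolP (tcol B); last by rewrite !mulr0.
have tw : tcol (sa w B) by rewrite tcol_act.
have [GB|GB] := boolP (G \in B).
  by rewrite sE_in // L_pi mulrA sE_in ?mem_sa // -scalerAr -scalerAl L_pi.
have [/exists_inP[H HB HG]|nH] := boolP [exists H in B, nonp H G].
  have wHG : nonp (ha w H) (ha w G) by rewrite nonp_act.
  have wHB : ha w H \in sa w B by rewrite mem_sa.
  rewrite [in RHS]L_pi [RHS]mulrA (sE_non true tw wHB wHG) (sE_non true tB HB HG).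
  rewrite mulrDl mulrDr -!scalerAl -!scalerAr -!rf_cjr // !val_cjr.
  by rewrite -!mulrA -!L_pi !mulrA -!LM !mulgKV.
have HG H : H \in B -> tr H G.
  move=> HB; apply: (tr_of_not_nonp GB HB).
  by apply: contra nH => HG; apply/exists_inP; exists H.
rewrite sE_0 // mulr0 L_pi mulrA sE_0 ?mul0r ?mem_sa // => K /saP[H HB ->].
by rewrite tr_act //; exact: HG.
Qed.
Lemma sE_B1 G : E G * E G = d *: E G.
Proof.
rewrite -[in RHS](mul1r (E G)) scalerAl; apply: sE_ext => B _ GB.
by rewrite sE_in // -scalerAl mul1r.
Qed.
Lemma sE_B3 s : L (val s) * E (hyp_of s) = E (hyp_of s).
Proof.
rewrite -[in RHS](mul1r (E _)); apply: sE_ext => B _ GB.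
by rewrite pi_refl // mul1r.
Qed.
Lemma sE_B5 H G : nonp H G -> E G * E H =
  (m1 *: L (val (rf true H G)) + m2 *: L (val (rf false H G))) * E H.
Proof.
move=> HG; apply: sE_ext => B tB HB.
by rewrite (sE_non true tB HB HG) mulrDl -!scalerAl.
Qed.

Lemma sE_L w G x : ha w G = G -> E G * (L w * x) = L w * (E G * x).
Proof. by move=> wG; rewrite !mulrA L_sE wG. Qed.
Lemma rf_fix c X G P : nonp X G -> tr P X -> tr P G -> ha (val (rf c X G)) P = P.
Proof.
move=> XG PX PG; apply: (refl_fix_perp hW (rf_moves hW c XG) PX _).1.
by rewrite ha_rf.
Qed.

Section Commutation.
Variable B : {set hyp rho}.
Hypothesis tB : tcol B.

Lemma all_tr G : G \notin B -> ~~ [exists H in B, nonp H G] -> forall H, H \in B -> tr H G.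
Proof.
move=> GB nH H HB; apply: (tr_of_not_nonp GB HB).
by apply: contra nH => HG; apply/exists_inP; exists H.
Qed.
Lemma comm_stay G1 G2 H : H \in B -> nonp H G2 ->
  (forall c, G1 \in sa (val (rf c H G2)) B) ->
  E G1 * (E G2 * pi B) = d *: (E G2 * pi B).
Proof.
move=> HB HG G1B; rewrite (sE_non true tB HB HG).
have st c : E G1 * (L (val (rf c H G2)) * pi B) = d *: (L (val (rf c H G2)) * pi B).
  by rewrite L_pi mulrA sE_in // -scalerAl.
by rewrite mulrDr -!scalerAr !st scalerDr !scalerA ![d * _]mulrC.
Qed.
Lemma comm_in G1 G2 : tr G1 G2 -> G1 \in B -> E G1 * (E G2 * pi B) = d *: (E G2 * pi B).
Proof.
move=> tG GB; have [G2B|G2B] := boolP (G2 \in B).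
  by rewrite !sE_in // -scalerAr sE_in.
have [/exists_inP[H HB HG]|nH] := boolP [exists H in B, nonp H G2].
  apply: (comm_stay HB HG) => c.
  have HG1 : G1 != H by apply: contraTneq tG => ->; rewrite nonp_perp.
  by rewrite -(rf_fix c HG (tcol_tr tB GB HB HG1) tG) mem_sa.
by rewrite (sE_0 G2B (all_tr G2B nH)) mulr0 scaler0.
Qed.
Lemma comm_0 G1 G2 : tr G1 G2 -> G1 \notin B -> (forall H, H \in B -> tr H G1) ->
  E G1 * (E G2 * pi B) = 0.
Proof.
move=> tG GB HG1; have [G2B|G2B] := boolP (G2 \in B).
  by rewrite sE_in // -scalerAr sE_0 // scaler0.
have [/exists_inP[H HB HG]|nH] := boolP [exists H in B, nonp H G2].
  have G1H : tr G1 H by rewrite (perp_sym hW); exact: HG1.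
  rewrite (sE_non true tB HB HG) mulrDr -!scalerAr.
  by rewrite !sE_L ?sE_0 ?mulr0 ?scaler0 ?addr0 //; exact: (rf_fix _ HG G1H tG).
by rewrite (sE_0 G2B (all_tr G2B nH)) mulr0.
Qed.
(** The reflections carrying K to G2 fix H, and those carrying H to G1 fix G2, so both products
    expand into the same four terms. *)
Lemma comm_sep G1 G2 H K : tr G1 G2 -> H \in B -> nonp H G1 -> tr H G2 ->
  K \in B -> nonp K G2 -> E G1 * (E G2 * pi B) = E G2 * (E G1 * pi B).
Proof.
move=> tG HB HG1 HG2 KB KG2; have HK : H != K.
  by apply: contraTneq HG2 => ->; rewrite nonp_perp.
have t21 : tr G2 H by rewrite (perp_sym hW).
have t22 : tr G2 G1 by rewrite (perp_sym hW).
rewrite (sE_non true tB HB HG1) mulrDr -!scalerAr.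
rewrite !(fun c => sE_L (pi B) (rf_fix c HG1 t21 t22)).
rewrite (sE_non true tB KB KG2).
have st c : E G1 * (L (val (rf c K G2)) * pi B) =
    m1 *: (L (val (rf true H G1)) * (L (val (rf c K G2)) * pi B)) +
    m2 *: (L (val (rf false H G1)) * (L (val (rf c K G2)) * pi B)).
  rewrite L_pi mulrA; set B' := sa _ B.
  have tB' : tcol B' by rewrite /B' tcol_act.
  have HB' : H \in B'.
    by rewrite -(rf_fix c KG2 (tcol_tr tB HB KB HK) HG2) mem_sa.
  by rewrite (sE_non true tB' HB' HG1) mulrDl -!scalerAl !mulrA.
rewrite mulrDr -!scalerAr !st /= !mulrDr -!scalerAr !scalerDr !scalerA.
by rewrite addrACA [m2 * m1]mulrC.
Qed.
(** After E G2 the mirror X has been replaced by G2, and all mirrors of the new sector are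
    transverse to G1. *)
Lemma comm_one G1 G2 X : tr G1 G2 -> X \in B -> nonp X G1 -> nonp X G2 ->
  (forall H, H \in B -> H != X -> tr H G1 /\ tr H G2) -> E G1 * (E G2 * pi B) = 0.
Proof.
move=> tG XB XG1 XG2 oth; rewrite (sE_non true tB XB XG2).
have G1B := nonp_notin tB XB XG1.
have st c : E G1 * (L (val (rf c X G2)) * pi B) = 0.
  have Hs H : H \in sa (val (rf c X G2)) B -> tr H G1.
    case/saP => K KB ->; have [->|KX] := eqVneq K X.
      by rewrite ha_rf // (perp_sym hW).
    have [KG1 KG2] := oth K KB KX.
    by rewrite (rf_fix c XG2 (tcol_tr tB KB XB KX) KG2).
  rewrite L_pi mulrA sE_0 ?mul0r //.
  apply/negP => /Hs; by rewrite (perp_irr hW).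
by rewrite mulrDr -!scalerAr !st !scaler0 addr0.
Qed.
(** Each reflection carrying X to G2 carries Y or Z to G1 ([rf_triple2]), so both products are d
    times a single action; [pi_triple] identifies these two. *)
Lemma comm_three G1 G2 X Y Z : tr G1 G2 -> X \in B -> Y \in B -> Z \in B ->
  X != Y -> X != Z -> Y != Z -> nonp X G1 -> nonp Y G1 -> nonp Z G1 ->
  nonp X G2 -> nonp Y G2 -> nonp Z G2 ->
  E G1 * (E G2 * pi B) = E G2 * (E G1 * pi B).
Proof.
move=> tG XB YB ZB XY XZ YZ X1 Y1 Z1 X2 Y2 Z2.
have [tXY tXZ tYZ] := And3 (tcol_tr tB XB YB XY) (tcol_tr tB XB ZB XZ) (tcol_tr tB YB ZB YZ).
have tG' : tr G2 G1 by rewrite (perp_sym hW).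
rewrite (comm_stay XB X2); last first.
  move=> c; case: (rf_triple2 hW c tXY tXZ tYZ X1 Y1 Z1 tG X2 Y2 Z2) => <-;
  by rewrite mem_sa.
rewrite (comm_stay XB X1); last first.
  move=> c; case: (rf_triple2 hW c tXY tXZ tYZ X2 Y2 Z2 tG' X1 Y1 Z1) => <-;
  by rewrite mem_sa.
congr (_ *: _); rewrite (sE_non true tB XB X1) (sE_non true tB XB X2).
have st c : mr c *: (L (val (rf c X G2)) * pi B) = mr c *: (L (val (rf c X G1)) * pi B).
  have ZY : Z != Y by rewrite eq_sym.
  case: (rf_triple2 hW c tXY tXZ tYZ X1 Y1 Z1 tG X2 Y2 Z2) => e.
    have := rf_uniq hW Y1 e; rewrite cls_rf => ->.
    by rewrite (pi_triple c tB XB YB ZB XY XZ YZ X1 Y1 Z1).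
  have := rf_uniq hW Z1 e; rewrite cls_rf => ->.
  by rewrite (pi_triple c tB XB ZB YB XZ XY ZY X1 Z1 Y1).
by rewrite !st.
Qed.

Section Two.
Variables (X Y : hyp rho).
Hypotheses (XB : X \in B) (YB : Y \in B) (XY : X != Y).
Let tXY : tr X Y := tcol_tr tB XB YB XY.
(** The sector reached with class c contains G1, which gives the factor d; in the sector reached
    with the other class every mirror is transverse to G1, which gives 0. *)
Lemma comm_two_a G1 G2 c : tr G1 G2 -> nonp X G1 -> nonp Y G1 -> nonp X G2 -> nonp Y G2 ->
  (forall H, H \in B -> H != X -> H != Y -> tr H G1 /\ tr H G2) ->
  ha (val (rf c X G2)) Y = G1 ->
  E G1 * (E G2 * pi B) = d *: (mr c *: (L (val (rf c X G2)) * pi B)).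
Proof.
move=> tG X1 Y1 X2 Y2 oth sY; rewrite (sE_non c tB XB X2) mulrDr -!scalerAr.
have [_ tt _] := rf_pair hW c tXY X2 Y2.
have -> : E G1 * (L (val (rf c X G2)) * pi B) = d *: (L (val (rf c X G2)) * pi B).
  by rewrite L_pi mulrA sE_in -?scalerAl // -sY mem_sa.
have Hs H : H \in sa (val (rf (~~ c) X G2)) B -> tr H G1.
  case/saP => K KB ->; have [->|KX] := eqVneq K X.
    by rewrite ha_rf // (perp_sym hW).
  have [->|KY] := eqVneq K Y; first by rewrite -sY (perp_sym hW).
  have [KG1 KG2] := oth K KB KX KY.
  by rewrite (rf_fix _ X2 (tcol_tr tB KB XB KX) KG2).
have -> : E G1 * (L (val (rf (~~ c) X G2)) * pi B) = 0.
  rewrite L_pi mulrA sE_0 ?mul0r //.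
  by apply/negP => /Hs; rewrite (perp_irr hW).
by rewrite scaler0 addr0 !scalerA mulrC.
Qed.
Lemma comm_two_b G1 G2 : nonp X G2 ->
  (forall c, nonp (ha (val (rf c X G2)) Y) G1) ->
  E G1 * (E G2 * pi B) = \sum_c \sum_e (mr c * mr e) *:
    (L (val (rf e (ha (val (rf c X G2)) Y) G1) * val (rf c X G2))%g * pi B).
Proof.
move=> X2 nn; rewrite (sE_non true tB XB X2) mulrDr -!scalerAr [RHS]big_bool.
have st c : mr c *: (E G1 * (L (val (rf c X G2)) * pi B)) = \sum_e (mr c * mr e) *:
    (L (val (rf e (ha (val (rf c X G2)) Y) G1) * val (rf c X G2))%g * pi B).
  rewrite L_pi mulrA (sE_non true _ _ (nn c)) ?tcol_act ?mem_sa //.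
  by rewrite big_bool mulrDl scalerDr -!scalerAl !scalerA -!mulrA -!L_pi !LM !mulrA.
by congr (_ + _); exact: st.
Qed.
End Two.
Lemma comm_two_eq G1 G2 X Y c : X \in B -> Y \in B -> X != Y -> tr G1 G2 ->
  nonp X G1 -> nonp Y G1 -> nonp X G2 -> nonp Y G2 ->
  (forall H, H \in B -> H != X -> H != Y -> tr H G1 /\ tr H G2) ->
  ha (val (rf c X G2)) Y = G1 -> E G1 * (E G2 * pi B) = E G2 * (E G1 * pi B).
Proof.
move=> XB YB XY tG X1 Y1 X2 Y2 oth sY.
have [rX _ _] := rf_pair hW c (tcol_tr tB XB YB XY) X2 Y2; rewrite sY in rX.
have rE := rf_uniq hW X1 (esym rX); rewrite cls_rf in rE.
rewrite (comm_two_a XB YB XY tG X1 Y1 X2 Y2 oth sY).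
have tG' : tr G2 G1 by rewrite (perp_sym hW).
have oth' H : H \in B -> H != X -> H != Y -> tr H G2 /\ tr H G1.
  by move=> HB HX HY; have [] := oth H HB HX HY.
have rY : ha (val (rf (~~ c) X G1)) Y = G2 by rewrite -rE ha_rf.
rewrite (comm_two_a XB YB XY tG' X2 Y2 X1 Y1 oth' rY) -rE.
congr (_ *: _); apply: (pi_pair c tB XB YB XY X2 Y2) => H HB HX HY.
exact: (oth H HB HX HY).2.
Qed.
Lemma comm_two G1 G2 X Y : X \in B -> Y \in B -> X != Y -> tr G1 G2 ->
  nonp X G1 -> nonp Y G1 -> nonp X G2 -> nonp Y G2 ->
  (forall H, H \in B -> H != X -> H != Y -> tr H G1 /\ tr H G2) ->
  E G1 * (E G2 * pi B) = E G2 * (E G1 * pi B).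
Proof.
move=> XB YB XY tG X1 Y1 X2 Y2 oth; have tXY := tcol_tr tB XB YB XY.
have tYX : tr Y X by rewrite (perp_sym hW).
case: (rf_pair2 hW tXY X1 Y1 tG X2 Y2) => [[c]|qXY].
  exact: comm_two_eq.
case: (rf_pair2 hW tYX Y1 X1 tG Y2 X2) => [[c sX]|qYX].
  have [e _ _] := rf_pair hW c tYX Y2 X2.
  by rewrite sX in e; apply: (comm_two_eq XB YB XY tG X1 Y1 X2 Y2 oth (esym e)).
have o1 H : H \in B -> H != X -> H != Y -> tr H G1.
  by move=> HB HX HY; exact: (oth H HB HX HY).1.
have o2 H : H \in B -> H != X -> H != Y -> tr H G2.
  by move=> HB HX HY; exact: (oth H HB HX HY).2.
rewrite (comm_two_b XB YB X2) => [|c]; last by have [] := qXY c.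
rewrite (comm_two_b YB XB Y1) => [|c]; last by have [] := qXY c.
have sb e (F F' : bool -> S) : F e = F' e -> F (~~ e) = F' (~~ e) ->
    \sum_i F i = \sum_i F' i.
  by case: e => /= e1 e2; apply: eq_bigr => -[].
(* Four terms on each side. Those with opposite classes agree by the identity in W of [qXY]; those
   with equal classes need X and Y exchanged by [pi_pair], and then [qYX]. *)
apply: eq_bigr => c _; apply: (sb c); last by have [_ _ ->] := qXY c.
have [V _ _] := rf_pair hW c tXY X2 Y2.
have [V' _ _] := rf_pair hW (~~ c) tXY X1 Y1; rewrite negbK in V'.
have fac a b u v : (a * b) *: (L (u * v)%g * pi B) = a *: (L u * (b *: (L v * pi B))).
  by rewrite LM -mulrA -scalerAr scalerA.
have p1 := pi_pair c tB XB YB XY X2 Y2 o2.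
have p2 := pi_pair (~~ c) tB XB YB XY X1 Y1 o1; rewrite negbK in p2.
rewrite !fac p1 -p2 V -V' -!fac; congr (_ *: (L _ * _)).
by have [_ _] := qYX (~~ c); rewrite negbK => ->.
Qed.
(** Outside the easy cases exactly the same members of B are non-transverse to G1 and to G2; the
    proof splits according to whether there are one, two, or at least three of them. *)
Lemma comm_pi G1 G2 : tr G1 G2 -> E G1 * (E G2 * pi B) = E G2 * (E G1 * pi B).
Proof.
move=> tG; have tG' : tr G2 G1 by rewrite (perp_sym hW).
have [G1B|G1B] := boolP (G1 \in B).
  by rewrite comm_in // [in RHS]sE_in // -scalerAr.
have [G2B|G2B] := boolP (G2 \in B).
  by rewrite [RHS]comm_in // [in LHS]sE_in // -scalerAr.
have [/exists_inP[H HB H1]|n1] := boolP [exists H in B, nonp H G1]; last first.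
  by rewrite (comm_0 tG G1B (all_tr G1B n1)) (sE_0 G1B (all_tr G1B n1)) mulr0.
have [/exists_inP[K KB K2]|n2] := boolP [exists H in B, nonp H G2]; last first.
  by rewrite (comm_0 tG' G2B (all_tr G2B n2)) (sE_0 G2B (all_tr G2B n2)) mulr0.
have [/exists_inP[P PB /andP[P1 P2]]|s1] := boolP [exists P in B, nonp P G1 && tr P G2].
  exact: (comm_sep tG PB P1 P2 KB K2).
have [/exists_inP[P PB /andP[P2 P1]]|s2] := boolP [exists P in B, nonp P G2 && tr P G1].
  by rewrite (comm_sep tG' PB P2 P1 HB H1).
have same P : P \in B -> nonp P G1 = nonp P G2.
  move=> PB; apply/idP/idP => h; apply: contraT => h'.
    case/negP: s1; apply/exists_inP; exists P => //.
    by rewrite h (tr_of_not_nonp G2B PB h').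
  case/negP: s2; apply/exists_inP; exists P => //.
  by rewrite h (tr_of_not_nonp G1B PB h').
have trs P : P \in B -> ~~ nonp P G1 -> tr P G1 /\ tr P G2.
  move=> PB h; split; first exact: (tr_of_not_nonp G1B PB h).
  by apply: (tr_of_not_nonp G2B PB); rewrite -(same P PB).
have H2 : nonp H G2 by rewrite -same.
have [/exists_inP[Y YB /andP[YH Y1]]|nY] :=
    boolP [exists Y in B, (Y != H) && nonp Y G1]; last first.
  have oth P : P \in B -> P != H -> tr P G1 /\ tr P G2.
    move=> PB PH; apply: (trs P PB); apply: contra nY => h.
    by apply/exists_inP; exists P; rewrite ?PH.
  rewrite (comm_one tG HB H1 H2 oth) (comm_one tG' HB H2 H1) // => P PB PH.
  by have [] := oth P PB PH.
have Y2 : nonp Y G2 by rewrite -same.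
have HY : H != Y by rewrite eq_sym.
have [/exists_inP[Z ZB /and3P[ZH ZY Z1]]|nZ] :=
    boolP [exists Z in B, [&& Z != H, Z != Y & nonp Z G1]].
  have Z2 : nonp Z G2 by rewrite -same.
  rewrite eq_sym in ZH; rewrite eq_sym in ZY.
  exact: (comm_three tG HB YB ZB HY ZH ZY H1 Y1 Z1 H2 Y2 Z2).
apply: (comm_two HB YB HY tG H1 Y1 H2 Y2) => P PB PH PY; apply: (trs P PB).
apply: contra nZ => h; apply/exists_inP; exists P => //.
exact: (introT and3P (And3 PH PY h)).
Qed.
End Commutation.
Lemma sE_B4 G1 G2 : tr G1 G2 -> E G1 * E G2 = E G2 * E G1.
Proof.
move=> tG; rewrite [in LHS](sE_sum G2) [in RHS](sE_sum G1) !mulr_sumr.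
apply: eq_bigr => B _; have [tB|/pi_tcol->] := boolP (tcol B); last by rewrite !mulr0.
exact: comm_pi.
Qed.
Lemma sector_brauer : brauer_rel hW d m1 m2 L E.
Proof.
split; [exact: L1 | exact: LM | exact: sE_B1 | exact: L_sE | exact: sE_B3 |
  exact: sE_B4 | exact: sE_B5].
Qed.
Definition spi : S := \sum_B pi B.
Local Notation P := spi.
Lemma pi_spi B : pi B * P = pi B.
Proof.
rewrite /P mulr_sumr (bigD1 B) //= pi_orth eqxx big1 ?addr0 // => B' BB.
by rewrite pi_orth eq_sym (negPf BB).
Qed.
Lemma spi_pi B : P * pi B = pi B.
Proof.
rewrite /P mulr_suml (bigD1 B) //= pi_orth eqxx big1 ?addr0 // => B' BB.
by rewrite pi_orth (negPf BB).
Qed.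
Lemma spi_idem : P * P = P.
Proof. by rewrite {2}/P mulr_sumr; apply: eq_bigr => B _; exact: spi_pi. Qed.
Lemma L_spi w : L w * P = P * L w.
Proof.
rewrite mulr_sumr mulr_suml [RHS](reindex_inj (can_inj (saK w))) /=.
by apply: eq_bigr => B _; exact: L_pi.
Qed.
Lemma sE_spi G : E G * P = E G.
Proof. by rewrite mulr_sumr -sE_sum. Qed.
Lemma spi_sE G : P * E G = E G.
Proof.
rewrite /sE mulr_sumr; apply: eq_bigr => B _; rewrite mulrA.
have -> : P * sop G B = sop G B * P.
  rewrite /sop; case: ifP => _; first by rewrite -scalerAl -scalerAr mul1r mulr1.
  case: pickP => [H _|_]; last by rewrite mulr0 mul0r.
  by rewrite mulrDl mulrDr -!scalerAl -!scalerAr !L_spi.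
by rewrite -mulrA spi_pi.
Qed.
(** The image of [E G] lies in the sectors containing G, and sectors are orthogonal. *)
Lemma pi_sE G B : G \notin B -> pi B * E G = 0.
Proof.
move=> GB; rewrite sE_sum mulr_sumr big1 // => B' _.
have [tB|/pi_tcol->] := boolP (tcol B'); last by rewrite !mulr0.
have z B1 : G \in B1 -> pi B * pi B1 = 0.
  by move=> G1; rewrite pi_orth; case: eqP => // e; rewrite e G1 in GB.
have [G1|G1] := boolP (G \in B'); first by rewrite sE_in // -scalerAr z ?scaler0.
have [/exists_inP[H HB HG]|nH] := boolP [exists H in B', nonp H G].
  have st c : pi B * (L (val (rf c H G)) * pi B') = 0.
    by rewrite L_pi mulrA z ?mul0r // -{1}(ha_rf hW c HG) mem_sa.
  by rewrite (sE_non true tB HB HG) mulrDr -!scalerAr !st !scaler0 addr0.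
rewrite sE_0 ?mulr0 // => H HB; apply: (tr_of_not_nonp G1 HB).
by apply: contra nH => HG; apply/exists_inP; exists H.
Qed.
Lemma pi_eB B B' : tcol B' -> ~~ (B' \subset B) -> pi B * eB E B' = 0.
Proof.
move=> tB /subsetPn[H HB' HB]; have BE := setD1K HB'.
have HN : H \notin B' :\ H by rewrite setD11.
rewrite -BE in tB *.
by rewrite (eBU sector_brauer tB HN) mulrA pi_sE // mul0r.
Qed.
Lemma spi_eB B : P * eB E B = eB E B * P.
Proof.
rewrite /eB; elim/big_rec: _ => [|H x _ IHx]; first by rewrite mulr1 mul1r.
by rewrite mulrA spi_sE -mulrA -IHx mulrA sE_spi.
Qed.
End Sectors.

(** * Matrices of the sector modules *)

Section Kernels.
Variables (gT : finGroupType) (R : comNzRingType).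
(** The order of the group, written as a successor so that square matrices form a nonzero ring. *)
Local Notation n := (#|gT|.-1.+1).
Definition gel (i : 'I_n) : gT := nth 1%g (enum gT) i.
Lemma card_gT : n = size (enum gT).
Proof. by rewrite -cardE prednK //; apply/card_gt0P; exists 1%g. Qed.
Lemma gel_bij : bijective gel.
Proof.
have gi : injective gel.
  move=> i j /eqP; rewrite nth_uniq ?enum_uniq -?card_gT // => /eqP e.
  exact: val_inj.
by apply: (inj_card_bij gi); rewrite card_ord card_gT -cardE.
Qed.
Definition kmx (F : gT -> gT -> R) : 'M[R]_n := \matrix_(i, j) F (gel i) (gel j).
Lemma kmxM F F' : kmx F *m kmx F' = kmx (fun x z => \sum_y F x y * F' y z).
Proof.
apply/matrixP => i j; rewrite !mxE (reindex gel) /=; last exact: onW_bij gel_bij.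
by apply: eq_bigr => k _; rewrite !mxE.
Qed.
Lemma eq_kmx F F' : (forall x z, F x z = F' x z) -> kmx F = kmx F'.
Proof. by move=> e; apply/matrixP => i j; rewrite !mxE e. Qed.
Lemma kmx0 : kmx (fun _ _ => 0) = 0.
Proof. by apply/matrixP => i j; rewrite !mxE. Qed.
Definition kL (w : gT) : 'M[R]_n := kmx (fun x z => (x == w * z)%g%:R).
Lemma kL_l w F : kL w *m kmx F = kmx (fun x z => F (w^-1 * x)%g z).
Proof.
rewrite kmxM; apply: eq_kmx => x z; rewrite (bigD1 (w^-1 * x)%g) //= mulKVg eqxx mul1r.
rewrite big1 ?addr0 // => y yx; case: eqP => [e|]; last by rewrite mul0r.
by case/eqP: yx; rewrite e mulKg.
Qed.
Lemma kL_r w F : kmx F *m kL w = kmx (fun x z => F x (w * z)%g).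
Proof.
rewrite kmxM; apply: eq_kmx => x z; rewrite (bigD1 (w * z)%g) //= eqxx mulr1.
by rewrite big1 ?addr0 // => y /negPf->; rewrite mulr0.
Qed.
Lemma kL1 : kL 1%g = 1.
Proof.
apply/matrixP => i j; rewrite !mxE mul1g (inj_eq (bij_inj gel_bij)).
by [].
Qed.
Lemma kLM u w : kL (u * w)%g = kL u * kL w.
Proof.
rewrite -[RHS]/(kL u *m kL w) kL_l; apply: eq_kmx => x z.
by rewrite -mulgA; congr (nat_of_bool _)%:R; apply/eqP/eqP => [->|<-]; rewrite ?mulKg ?mulKVg.
Qed.
End Kernels.

Section SectorMatrices.
Variables (C : numClosedFieldType) (g : ST_type) (gT : finGroupType).
Variable rho : mx_representation C [set: gT] (ST_rank g).
Hypothesis hW : is_ST rho.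
Local Notation tcol := (@transverse_collection C (ST_rank g) gT rho).
Local Notation sa := (@Defs.setact C (ST_rank g) gT rho).
Variables (R : comNzRingType) (m1 m2 m : R).
Hypotheses (m12 : m1 * m = m2) (m6 : m ^+ 6 = 1).
Local Notation mr := (mr m1 m2).
Local Notation chi := (@chi C g gT rho hW R m).
Variable B0 : {set hyp rho}.
Hypothesis tB0 : tcol B0.
Variable iN : R.
Hypothesis iNK : iN * #|KB B0|%:R = 1.
Implicit Types (B : {set hyp rho}) (s t : refl rho).

Lemma KB_refl s : hyp_of s \in B0 -> val s \in KB B0.
Proof.
by move=> sB; apply: mem_gen; apply/setUP; left; apply/imsetP; exists s; rewrite ?inE.
Qed.
Lemma KB_genpair s t : genpair B0 s t -> ((val t)^-1 * val s)%g \in KB B0.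
Proof.
case/and3P=> g1 g2 /forall_inP g3; apply: mem_gen; apply/setUP; right.
apply/imsetP; exists (s, t) => //; rewrite inE /= g1 g2 /=.
by apply/forall_inP => H /g3; rewrite !haE.
Qed.
Lemma genpair_conj w B s t : genpair B s t -> genpair (sa w B) (cjr w s) (cjr w t).
Proof.
have ac r : sa (val (cjr w r)) (sa w B) = sa w (sa (val r) B).
  by rewrite -!saM val_cjr mulgKV.
case/and3P => /eqP e ne /forall_inP h; apply/and3P; split.
- by rewrite !ac e.
- by rewrite ac; apply: contra ne => /eqP/(congr1 (sa w^-1%g)); rewrite !saK => ->.
apply/forall_inP => K; rewrite ac inE => /andP[Ks /saP[H HB HE]].
rewrite HE !ha_cjr (inj_eq (@ha_inj _ _ _ rho w)); apply: h.
by rewrite inE HB andbT; apply: contra Ks; rewrite HE mem_sa.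
Qed.

(** Divided by |K_B0|, this function is the idempotent e of the group algebra of K_B0 such that k e
    = chi(k) e. *)
Definition kern (k : gT) : R := if k \in KB B0 then chi B0 k^-1%g else 0.
Lemma kern_mul k x : k \in KB B0 -> kern (x * k)%g = chi B0 k^-1%g * kern x.
Proof.
move=> kK; rewrite /kern (groupMr _ kK) //; case: ifP => xK; last by rewrite mulr0.
rewrite invMg (chiM hW m6) //; apply: groupVr; exact: (KB_stab hW tB0).
Qed.
Lemma chiV k : k \in KB B0 -> chi B0 k * chi B0 k^-1%g = 1.
Proof.
move=> kK; have kS := KB_stab hW tB0 kK.
by rewrite -(chiM hW m6) ?groupV // mulgV (chi1 hW m6).
Qed.
(* Projection on the sector of B, the coset of x belonging to the sector of  *)
(* x B0, in the right ideal of the idempotent of chi B0.                     *)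
Definition kpi B : 'M[R]_(#|gT|.-1.+1) :=
  kmx (fun x z => if sa x B0 == B then iN * kern (z^-1 * x)%g else 0).
Lemma KB_sa x k : k \in KB B0 -> sa (x * k)%g B0 = sa x B0.
Proof. by move=> kK; rewrite saM (StabP (KB_stab hW tB0 kK)). Qed.
Lemma kpi_orth B B' : kpi B * kpi B' = if B == B' then kpi B else 0.
Proof.
rewrite -[LHS]/(kpi B *m kpi B') kmxM.
have -> : (if B == B' then kpi B else 0) = kmx (fun x z => if B == B' then
    if sa x B0 == B then iN * kern (z^-1 * x)%g else 0 else 0).
  by case: eqP => // _; rewrite kmx0.
(* With y = x k^-1 only k in K_B0 contributes, always by the same amount, and [iN] cancels the
   number of terms. *)
apply: eq_kmx => x z; rewrite (reindex_inj (inj_comp (mulgI x) invg_inj)) /=.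
have E k : (if sa x B0 == B then iN * kern ((x * k^-1)^-1 * x)%g else 0) *
    (if sa (x * k^-1)%g B0 == B' then iN * kern (z^-1 * (x * k^-1))%g else 0) =
    if k \in KB B0 then
      if B == B' then if sa x B0 == B then iN * (iN * kern (z^-1 * x)%g) else 0 else 0
    else 0.
  rewrite invMg invgK mulgKV; have [kK|kK] := boolP (k \in KB B0); last first.
    by rewrite {1}/kern (negPf kK) mulr0 if_same mul0r.
  rewrite {1}/kern kK.
  have kV : k^-1%g \in KB B0 by rewrite groupV.
  rewrite KB_sa // mulgA kern_mul //; have [->|nB] := eqVneq B B'.
    case: ifP => _; last by rewrite mul0r.
    rewrite invgK; move: (chiV kK) (kern _) => e a.
    by rewrite -[in RHS](mul1r a) -e; ring.
  by case: eqP => [->|_]; rewrite ?mul0r // (negPf nB) mulr0.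
rewrite (eq_bigr _ (fun k _ => E k)) -big_mkcond sumr_const; case: ifP => _; last by rewrite mul0rn.
case: ifP => _; last by rewrite mul0rn.
by rewrite mulrCA -mulrnAr -mulrnAl -[iN *+ _]mulr_natr iNK mul1r.
Qed.
Local Notation L := (@kL gT R).
Lemma kL_pi w B : L w * kpi B = kpi (sa w B) * L w.
Proof.
rewrite -[LHS]/(L w *m kpi B) -[RHS]/(kpi _ *m L w) kL_l kL_r; apply: eq_kmx => x z.
rewrite invMg -!mulgA; congr (if _ then _ else _).
by rewrite saM; apply/eqP/eqP => [<-|->]; rewrite ?saKV ?saK.
Qed.
Lemma kpi_tcol B : ~~ tcol B -> kpi B = 0.
Proof.
move=> tB; rewrite -[RHS]kmx0; apply: eq_kmx => x z.
by case: eqP => // e; rewrite -e tcol_act // tB0 in tB.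
Qed.
Lemma kpi_card B : #|B| != #|B0| -> kpi B = 0.
Proof.
move=> cB; rewrite -[RHS]kmx0; apply: eq_kmx => x z.
by case: eqP => // e; rewrite -e card_sa eqxx in cB.
Qed.
Lemma kpi_refl B s : hyp_of s \in B -> L (val s) * kpi B = kpi B.
Proof.
move=> sB; rewrite -[LHS]/(L _ *m kpi B) kL_l; apply: eq_kmx => x z.
pose k := val (cjr x^-1%g s); have xk : ((val s)^-1 * x = x * k^-1)%g.
  by rewrite /k val_cjr invgK !invMg invgK !mulgA mulgV mul1g.
rewrite xk mulgA; case: (sa x B0 =P B) => [xB|xB].
  have kB : hyp_of (cjr x^-1%g s) \in B0 by rewrite hyp_of_cjr // -mem_saV xB.
  have kK := KB_refl kB; have kV : k^-1%g \in KB B0 by rewrite groupV.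
  by rewrite KB_sa // xB eqxx kern_mul // invgK (chi_refl hW m6 tB0 kB) mul1r.
case: eqP => // e; case: xB.
have sS : val s \in Stab_group B.
  have tB : tcol B by rewrite -e tcol_act.
  exact: (refl_stab hW tB sB).
by rewrite -(StabP sS) -e -saM -xk mulKVg.
Qed.
(** With y = s^-1 x one has t^-1 x = y k, where k is the generator of K_B0 attached to the pair
    conjugated by y^-1; [kern_mul] brings out chi(k^-1) and [chi_gen] compensates it. *)
Lemma kpi_gen B s t : tcol B -> genpair B s t ->
  mr (cls s) *: (L (val s) * kpi B) = mr (cls t) *: (L (val t) * kpi B).
Proof.
move=> tB gp; have [/eqP st _ _] := and3P gp.
rewrite -[L (val s) * _]/(L _ *m kpi B) -[L (val t) * _]/(L _ *m kpi B) !kL_l.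
apply/matrixP => i j; rewrite !mxE; set x := gel i; set z := gel j.
pose y := ((val s)^-1 * x)%g; rewrite -/y.
have e1 : (sa y B0 == B) = (sa ((val t)^-1 * x)%g B0 == B).
  by rewrite !saM; apply/eqP/eqP => e; [rewrite -(saK (val t) B) -st -e saKV |
    rewrite -(saK (val s) B) st -e saKV].
rewrite -e1; case: eqP => [yB|_]; last by rewrite !mulr0.
have gp0 : genpair B0 (cjr y^-1%g s) (cjr y^-1%g t).
  by rewrite -(saK y B0) yB; apply: genpair_conj.
have := chi_gen hW m12 m6 tB0 gp0; have := KB_genpair gp0; set k := (_ * _)%g.
have -> : ((val t)^-1 * x = y * k)%g.
  have -> : k = (y^-1 * ((val t)^-1 * (val s * y)))%g.
    by rewrite /k !val_cjr; move: (y) => v; rewrite !invMg !invgK -!mulgA mulKVg.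
  by rewrite mulKVg /y mulKVg.
move=> kK; rewrite !cls_cjr => <-; rewrite (mulgA z^-1 y k)%g (kern_mul _ kK).
move: (kern _) (chiV kK) => a e; rewrite -[in LHS](mul1r a) -e; ring.
Qed.
Definition kE := sE hW 1 m1 m2 L kpi.
Lemma kE_brauer : brauer_rel hW 1 m1 m2 L kE.
Proof.
apply: sector_brauer; [exact: kL1 | exact: kLM | exact: kpi_orth | exact: kL_pi |
  exact: kpi_tcol | exact: kpi_refl | exact: kpi_gen].
Qed.
End SectorMatrices.

Section BrauerMorphism.
Variables (C : numClosedFieldType) (g : ST_type) (gT : finGroupType).
Variable rho : mx_representation C [set: gT] (ST_rank g).
Hypothesis hW : is_ST rho.
Lemma brauer_rel_map (R R' : comNzRingType) (f : R -> R') (S : algType R) (S' : algType R')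
    (F : S -> S') d m1 m2 iw ie :
  F 1 = 1 -> {morph F : x y / x + y} -> {morph F : x y / x * y} ->
  (forall a x, F (a *: x) = f a *: F x) ->
  @brauer_rel C g gT rho hW R S d m1 m2 iw ie ->
  brauer_rel hW (f d) (f m1) (f m2) (F \o iw) (F \o ie).
Proof.
move=> F1 FD FM FZ [h1 hM hee hwe hfix hcomm hnon]; split=> /=.
- by rewrite h1.
- by move=> u w; rewrite hM FM.
- by move=> H; rewrite -FM hee FZ.
- by move=> w H; rewrite -FM hwe FM.
- by move=> s; rewrite -FM hfix.
- by move=> H G HG; rewrite -!FM hcomm.
by move=> H G HG; rewrite -!FM hnon // FM FD !FZ.
Qed.
(** Rescaling the e_H multiplies all parameters at once, so delta may be normalised to 1. *)
Lemma brauer_rel_scale (R : comNzRingType) (S : algType R) (a d m1 m2 : R)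
    (iw : gT -> S) (ie : hyp rho -> S) :
  brauer_rel hW d m1 m2 iw ie ->
  brauer_rel hW (a * d) (a * m1) (a * m2) iw (fun H => a *: ie H).
Proof.
case=> h1 hM hee hwe hfix hcomm hnon; split => //.
- by move=> H; rewrite -scalerAl -scalerAr hee !scalerA mulrAC.
- by move=> w H; rewrite -scalerAr hwe scalerAl.
- by move=> s; rewrite -scalerAr hfix.
- by move=> H G HG; rewrite -!scalerAl -!scalerAr hcomm.
by move=> H G HG; rewrite -!scalerA -scalerDr -!scalerAl -!scalerAr hnon.
Qed.
Lemma eB_scale (R : comNzRingType) (S : algType R) (a : R) (ie : hyp rho -> S) B :
  eB (fun H => a *: ie H) B = a ^+ #|B| *: eB ie B.
Proof. by rewrite /eB scaler_prod prodr_const. Qed.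
Lemma eB_map (R R' : comNzRingType) (S : algType R) (S' : algType R')
    (F : {rmorphism S -> S'}) (ie : hyp rho -> S) B : eB (F \o ie) B = F (eB ie B).
Proof. by rewrite /eB rmorph_prod. Qed.
End BrauerMorphism.

(** * Independence by specialisation at 1 / delta = 0 *)

Section SectorIndependence.
Variables (T gT : finType) (R : comNzRingType) (S : algType R) (k : nat).
Variables (L : gT -> S) (pi e : {set T} -> S) (inv : S).
Let P := \sum_B pi B.
Let Phi := \sum_(B : {set T} | #|B| == k) pi B * e B + (1 - P).
Hypothesis pi_orth : forall B B' : {set T}, pi B * pi B' = if B == B' then pi B else 0.
Hypothesis L_P : forall w, L w * P = P * L w.
Hypothesis pi_card : forall B : {set T}, #|B| != k -> pi B = 0.
Hypothesis PhiV : Phi * inv = 1.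
(** The projection P kills e_B on its left when |B| > k and turns it into pi(B) Phi when |B| = k.
    Hence the projected relation can be divided by Phi and then restricted to one sector. *)
Lemma sector_indep (I : eqType) (s : seq I) (b : I -> {set T}) (w : I -> gT) (c : I -> R) :
  (forall p (B : {set T}), p \in s -> ~~ (b p \subset B) -> pi B * e (b p) = 0) ->
  (forall p, p \in s -> c p != 0 -> (k <= #|b p|)%N) ->
  \sum_(p <- s) c p *: (L (w p) * e (b p)) = 0 ->
  forall B, \sum_(p <- s | b p == B) c p *: (L (w p) * pi B) = 0.
Proof.
move=> pe sk s0 B1.
have piP B : pi B * (1 - P) = 0.
  rewrite mulrBr mulr1 mulr_sumr (bigD1 B) //= pi_orth eqxx big1 ?addr0 ?subrr // => B' BB.
  by rewrite pi_orth eq_sym (negPf BB).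
have Pe p : p \in s -> c p != 0 -> P * e (b p) = pi (b p) * Phi.
  move=> ps /(sk p ps) kp; rewrite /Phi mulrDr piP addr0 mulr_suml mulr_sumr.
  rewrite (bigD1 (b p)) //= big1 ?addr0 => [|B' BB]; last first.
    have [sub|/(pe p B' ps)//] := boolP (b p \subset B').
    have [e'|/pi_card->] := eqVneq #|B'| k; last by rewrite mul0r.
    by case/eqP: BB; apply/esym/eqP; rewrite eqEcard sub e' kp.
  have [e'|/pi_card->] := eqVneq #|b p| k; last first.
    by rewrite mul0r big1 // => B' _; rewrite mul0r.
  rewrite (bigD1 (b p)) /=; last by rewrite e' eqxx.
  rewrite mulrA pi_orth eqxx big1 ?addr0 // => B' /andP[_ BB].
  by rewrite mulrA pi_orth eq_sym (negPf BB) mul0r.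
have r0 : \sum_(p <- s) c p *: (L (w p) * pi (b p)) = 0.
  rewrite -[LHS]mulr1 -PhiV mulrA mulr_suml.
  have -> : \sum_(i <- s) c i *: (L (w i) * pi (b i)) * Phi =
      P * (\sum_(p <- s) c p *: (L (w p) * e (b p))).
    rewrite mulr_sumr big_seq [RHS]big_seq; apply: eq_bigr => p ps.
    have [->|cp] := eqVneq (c p) 0; first by rewrite !scale0r mulr0 mul0r.
    by rewrite -scalerAl -scalerAr -mulrA -Pe // !mulrA L_P.
  by rewrite s0 mulr0 mul0r.
have /(congr1 (fun x => x * pi B1)) := r0; rewrite mul0r mulr_suml => e0.
rewrite -[RHS]e0 big_mkcond; apply: eq_bigr => p _ /=.
by rewrite -scalerAl -mulrA pi_orth; case: eqP => [->|_] //; rewrite mulr0 scaler0.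
Qed.
End SectorIndependence.

Section PolynomialSector.
Variables (C : numClosedFieldType) (g : ST_type) (gT : finGroupType).
Variable rho : mx_representation C [set: gT] (ST_rank g).
Hypothesis hW : is_ST rho.
Local Notation tcol := (@transverse_collection C (ST_rank g) gT rho).
Variables (k : fieldType) (c1 c2 m iN : k).
Hypotheses (m12 : c1 * m = c2) (m6 : m ^+ 6 = 1).
Variable B0 : {set hyp rho}.
Hypothesis tB0 : tcol B0.
Hypothesis iNK : iN * #|KB B0|%:R = 1.
(* 'X stands for 1 / delta, the generators e_H being divided by delta. *)
Let m1' : {poly k} := 'X * c1%:P.
Let m2' : {poly k} := 'X * c2%:P.
Let m' : {poly k} := m%:P.
Let iN' : {poly k} := iN%:P.
Let m12' : m1' * m' = m2'. Proof. by rewrite -mulrA -polyCM m12. Qed.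
Let m6' : m' ^+ 6 = 1. Proof. by rewrite -polyC_exp m6. Qed.
Let iNK' : iN' * #|KB B0|%:R = 1. Proof. by rewrite -polyC_natr -polyCM iNK. Qed.
Local Notation n := (#|gT|.-1.+1).
Definition pL (w : gT) : 'M[{poly k}]_n := kL {poly k} w.
Definition ppi := kpi hW m' B0 iN'.
Definition pE := kE hW m1' m2' m' B0 iN'.
Definition pPhi : 'M[{poly k}]_n :=
  \sum_(B : {set hyp rho} | #|B| == #|B0|) ppi B * eB pE B + (1 - \sum_B ppi B).
Let po := kpi_orth hW m6' tB0 iNK'.
Let pLp := kL_pi hW m' B0 iN'.
Let pt := kpi_tcol hW m' tB0 iN'.
Let pr := kpi_refl hW m6' tB0 iN'.
Let pg := kpi_gen hW m12' m6' tB0 iN'.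
Lemma pE_brauer : brauer_rel hW 1 m1' m2' pL pE.
Proof. exact: kE_brauer. Qed.
Let ev0 : {rmorphism {poly k} -> k} := horner_eval 0.
Local Notation F0 := (map_mx ev0).
(** The parameters m1' and m2' are multiples of 'X, so at 0 the non-transverse terms disappear. *)
Lemma F0_E G B : F0 (pE G) * F0 (ppi B) = (G \in B)%:R *: F0 (ppi B).
Proof.
rewrite -[LHS]/(_ *m _) -map_mxM -[pE G *m _]/(pE G * ppi B).
have [tB|nB] := boolP (tcol B); last by rewrite [ppi B]pt // mulr0 map_mx0 scaler0.
have [GB|GB] := boolP (G \in B).
  by rewrite [pE G * _](sE_in hW 1 m1' m2' pL po) // !scale1r.
have z c (x : 'M[{poly k}]_n) : F0 (mr m1' m2' c *: x) = 0.
  rewrite map_mxZ; have -> : ev0 (mr m1' m2' c) = 0.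
    by rewrite /ev0 /= /horner_eval; case: c; rewrite /= hornerM hornerX mul0r.
  by rewrite scale0r.
rewrite scale0r; have [/exists_inP[H HB HG]|nH] := boolP [exists H in B, nonp H G].
  by rewrite [pE G * _](sE_non hW 1 po pg true tB HB HG) map_mxD !z addr0.
by rewrite [pE G * _](sE_0 hW 1 m1' m2' pL po) ?map_mx0 //; exact: all_tr.
Qed.
(** At 0, e_B projects on the sectors of the collections containing B; among those of the size of B
    this is the sector of B alone. *)
Lemma F0_Phi : F0 pPhi = 1.
Proof.
pose P := \sum_B ppi B.
have PE : \sum_B ppi B = P by [].
have piP B : ppi B * (1 - P) = 0 by rewrite mulrBr mulr1 (pi_spi po) subrr.
have Ppi B : P * ppi B = ppi B := spi_pi po B.
have PeB B : P * eB pE B = eB pE B * P := spi_eB hW 1 m1' m2' po pLp B.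
have pi0 (B : {set hyp rho}) : #|B| != #|B0| -> ppi B = 0 := @kpi_card _ _ _ _ hW _ m' B0 iN' B.
have F0eB B B' : F0 (eB pE B) * F0 (ppi B') = (B \subset B')%:R *: F0 (ppi B').
  have [/subsetP sB|/subsetPn[H HB HB']] := boolP (B \subset B').
    rewrite scale1r /eB rmorph_prod; elim/big_rec: _ => [|H x HB IHx]; first by rewrite mul1r.
    by rewrite -mulrA IHx F0_E sB // scale1r.
  have -> : F0 (eB pE B) * F0 (ppi B') = (\prod_(G in B) (G \in B')%:R) *: F0 (ppi B').
    rewrite /eB rmorph_prod; elim/big_rec2: _ => [|G x y GB IHx]; first by rewrite mul1r scale1r.
    by rewrite -mulrA IHx -scalerAr F0_E scalerA mulrC.
  by rewrite (bigD1 H) //= (negPf HB') mul0r.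
have F0P B' : F0 pPhi * F0 (ppi B') = F0 (ppi B').
  have [cB|/pi0->] := eqVneq #|B'| #|B0|; last by rewrite rmorph0 mulr0.
  rewrite /pPhi PE rmorphD mulrDl -[F0 (1 - P) * _]rmorphM mulrBl mul1r Ppi subrr.
  rewrite rmorph0 addr0 rmorph_sum mulr_suml (bigD1 B') /=; last by rewrite cB.
  rewrite big1 ?addr0 => [|B /andP[/eqP cB' BB]].
    by rewrite rmorphM -mulrA F0eB subxx scale1r -rmorphM (po B' B') eqxx.
  rewrite rmorphM -mulrA F0eB -scalerAr -rmorphM (po B B') (negPf BB).
  by rewrite rmorph0 scaler0.
have F0Q : F0 pPhi * F0 (1 - P) = F0 (1 - P).
  rewrite -rmorphM; congr F0; rewrite /pPhi PE mulrDl mulr_suml big1 ?add0r => [|B _].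
    by rewrite mulrBl mul1r mulrBr mulr1 (spi_idem po) subrr subr0.
  have PC : eB pE B * (1 - P) = (1 - P) * eB pE B.
    by rewrite mulrBr mulrBl mulr1 mul1r PeB.
  by rewrite -mulrA PC mulrA piP mul0r.
have one : 1 = F0 (1 - P) + \sum_B F0 (ppi B).
  by rewrite -rmorph_sum -rmorphD /= PE subrK rmorph1.
rewrite -[LHS]mulr1 [X in _ * X]one mulrDr F0Q mulr_sumr.
by rewrite (eq_bigr _ (fun B _ => F0P B)) -one.
Qed.
Variables (K : fieldType) (ev : {rmorphism {poly k} -> K}).
Hypothesis ev_neq0 : forall p : {poly k}, p.[0] != 0 -> ev p != 0.
Variable dl : K.
Hypothesis dlX : dl * ev 'X = 1.
Local Notation F := (map_mx ev).
Definition fL w := F (pL w).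
Definition fE G := dl *: F (pE G).
Lemma fE_brauer : brauer_rel hW dl (ev c1%:P) (ev c2%:P) fL fE.
Proof.
have e c : ev c%:P = dl * ev ('X * c%:P) by rewrite rmorphM mulrA dlX mul1r.
have := brauer_rel_scale dl (brauer_rel_map (rmorph1 F) (rmorphD F) (rmorphM F)
  (fun a x => map_mxZ ev a x) pE_brauer).
by rewrite rmorph1 mulr1 -!e.
Qed.
Lemma sector_relation (I : eqType) (s : seq I) (b : I -> {set hyp rho}) (w : I -> gT) (c : I -> K) :
  (forall p, p \in s -> tcol (b p)) ->
  (forall p, p \in s -> c p != 0 -> (#|B0| <= #|b p|)%N) ->
  \sum_(p <- s) c p *: (fL (w p) * eB fE (b p)) = 0 ->
  forall u, \sum_(p <- s | b p == B0) c p * ev (kern hW m' B0 ((w p)^-1 * u)%g) = 0.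
Proof.
move=> st sk s0 u.
have PhiU : F pPhi \in unitmx.
  rewrite unitmxE det_map_mx unitfE; apply: ev_neq0.
  have -> : (\det pPhi).[0] = ev0 (\det pPhi) by [].
  by rewrite -det_map_mx F0_Phi det1 oner_neq0.
have PhiE : F pPhi = \sum_(B : {set hyp rho} | #|B| == #|B0|) F (ppi B) * F (eB pE B) +
    (1 - \sum_B F (ppi B)).
  rewrite /pPhi rmorphD rmorph_sum rmorphB rmorph1 rmorph_sum; congr (_ + _).
  by apply: eq_bigr => B _; rewrite rmorphM.
have r1 : \sum_(p <- s) (c p * dl ^+ #|b p|) *: (fL (w p) * F (eB pE (b p))) = 0.
  rewrite -[RHS]s0; apply: eq_bigr => p _.
  by rewrite eB_scale -(eB_map F) -scalerAr scalerA.
have Fo B B' : F (ppi B) * F (ppi B') = if B == B' then F (ppi B) else 0.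
  by rewrite -rmorphM (po B B'); case: eqP; rewrite ?rmorph0.
have FL x : fL x * (\sum_B F (ppi B)) = (\sum_B F (ppi B)) * fL x.
  by rewrite -rmorph_sum -!rmorphM; congr F; exact: (L_spi pLp x).
have Fc (B : {set hyp rho}) : #|B| != #|B0| -> F (ppi B) = 0.
  by move/(@kpi_card _ _ _ _ hW _ m' B0 iN' B) => e; rewrite [ppi B]e rmorph0.
have Finv : (\sum_(B : {set hyp rho} | #|B| == #|B0|) F (ppi B) * F (eB pE B) +
    (1 - \sum_B F (ppi B))) * invmx (F pPhi) = 1 by rewrite -PhiE; exact: mulmxV.
have Fe p (B : {set hyp rho}) : p \in s -> ~~ (b p \subset B) ->
    F (ppi B) * F (eB pE (b p)) = 0.
  move=> ps sB; rewrite -rmorphM.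
  by rewrite [_ * _](pi_eB hW 1 (kL1 _ _) (@kLM _ _) po pLp pt pr pg (st p ps) sB) rmorph0.
have sk' p : p \in s -> c p * dl ^+ #|b p| != 0 -> (#|B0| <= #|b p|)%N.
  by move=> ps; rewrite mulf_eq0 negb_or => /andP[/(sk p ps)].
have r2 := sector_indep (e := F \o eB pE) Fo FL Fc Finv Fe sk' r1 B0.
have [h _ hK] := gel_bij gT.
have dl0 : dl != 0 by apply: contra_eq_neq dlX => ->; rewrite mul0r eq_sym oner_neq0.
have iN0 : ev iN' != 0.
  apply: ev_neq0; rewrite hornerC; apply: contra_eq_neq iNK => ->.
  by rewrite mul0r eq_sym oner_neq0.
(* The column of 1 holds the images of the generating vector of the induced module. *)
have/matrixP/(_ (h u) (h 1%g)) := r2; rewrite summxE mxE => r3.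
have fac : dl ^+ #|B0| * ev iN' != 0 by rewrite mulf_neq0 ?expf_neq0.
have ent x : (fL x * F (ppi B0)) (h u) (h 1%g) = ev iN' * ev (kern hW m' B0 (x^-1 * u)%g).
  rewrite -[RHS]rmorphM -rmorphM mxE [pL x * _]kL_l mxE !hK invg1 mul1g; congr (ev _).
  case: eqP => // nB; rewrite /kern; case: ifP => [xK|]; last by rewrite mulr0.
  by case: nB; exact: (StabP (KB_stab hW tB0 xK)).
apply: (mulfI fac); rewrite mulr0 -[RHS]r3 mulr_sumr; apply: eq_bigr => p /eqP pB.
by rewrite mxE ent pB; move: (c p) (dl ^+ _) (ev iN') (ev _) => a1 a2 a3 a4; ring.
Qed.
End PolynomialSector.

(** * The presented algebra *)

Section BrauerAlgebra.
Variables (C : numClosedFieldType) (g : ST_type) (gT : finGroupType).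
Variable rho : mx_representation C [set: gT] (ST_rank g).
Hypothesis hW : is_ST rho.
Variables s1 s2 : refl rho.
Hypotheses (cs1 : cls s1 = true) (cs2 : cls s2 = false).
Local Notation A := (parRing rho).
Lemma mu_cls (s s' : refl rho) : cls s = cls s' -> mu s = mu s'.
Proof. by move=> e; apply/ptm_eq/pcong_rel/par_conj; exact: (refl_conj hW). Qed.
Lemma muVK (s : refl rho) : mu s * muV s = 1.
Proof. by rewrite -ptmM; apply/ptm_eq/pcong_rel/par_mu. Qed.
Lemma deltaVK : delta rho * ptm _ (Gen (gdeltaV rho)) = 1.
Proof. by rewrite -ptmM; apply/ptm_eq/pcong_rel/par_delta. Qed.
Lemma brw1 : brw rho 1%g = 1.
Proof. exact/ptm_eq/pcong_rel/br_one. Qed.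
Lemma brwM u w : brw rho (u * w)%g = brw rho u * brw rho w.
Proof. by rewrite -ptmM; apply/esym/ptm_eq/pcong_rel/br_mul. Qed.
Lemma ptm_CstM a t : ptm (br_rel (rho := rho)) (Mul (Cst a) t) = a *: ptm _ t.
Proof. by rewrite [RHS]pscaleE. Qed.
Lemma nonpE (H G : hyp rho) : nonp H G = (H != G) && ~~ transverse H G.
Proof. by rewrite /nonp trE. Qed.
Lemma Br_brauer : brauer_rel hW (delta rho) (mu s1) (mu s2) (brw rho) (@bre _ _ _ rho).
Proof.
split.
- exact: brw1.
- exact: brwM.
- move=> H; rewrite -ptmM -ptm_CstM; exact/ptm_eq/pcong_rel/br_B1.
- move=> w H.
  have -> : bre (ha w H) = brw rho w * bre H * brw rho w^-1%g.
    by rewrite haE -[brw rho w * bre H]ptmM -ptmM; apply/esym/ptm_eq/pcong_rel/br_B2.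
  by rewrite -[RHS]mulrA -[brw rho w^-1 * _]brwM mulVg brw1 mulr1.
- move=> s; rewrite -ptmM; apply/ptm_eq/pcong_rel/br_B3; exact: subvv.
- move=> H G HG; rewrite -!ptmM; apply/ptm_eq/pcong_rel/br_B4; by rewrite -trE.
move=> H G HG; have := HG; rewrite (nonp_sym hW) nonpE => /andP[GH nt].
have -> : bre G * bre H = \sum_(s : refl rho | ha (val s) H == G) mu s *: (brw rho (val s) * bre H).
  rewrite -ptmM; apply: etrans (proj2 (ptm_eq _ _ _) (pcong_rel (br_B5 GH nt))) _.
  rewrite (big_morph (ptm (br_rel (rho := rho))) (@ptmD _ _ _) (erefl _)).
  rewrite (eq_bigl (fun s => ha (val s) H == G)) => [|s]; last by rewrite haE.
  by apply: eq_bigr => s _; rewrite scalerAl ptmM ptm_CstM.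
rewrite (sum_refl hW _ HG) mulrDl -!scalerAl.
by rewrite (@mu_cls (rf hW true H G) s1) ?(@mu_cls (rf hW false H G) s2) ?cls_rf ?cs1 ?cs2.
Qed.

(** Counting dimensions, (B3) only concerns the identity and the reflections with mirror H. *)
Lemma fix_hyp (w : gT) (H : hyp rho) : (val H <= fixv rho w)%VS ->
  w = 1%g \/ exists2 s : refl rho, val s = w & hyp_of s = H.
Proof.
move=> Hw; have /imageP[s0 _ sH] := valP H.
have := valP s0; rewrite /is_refl -sH => /eqP dH.
have := dimvS Hw; rewrite leq_eqVlt => /orP[/eqP dw|dw].
  have rw : is_refl rho w by rewrite /is_refl -dw dH.
  have e : val H = fixv rho w by apply/eqP; rewrite eqEdim Hw dw leqnn.
  right; exists (Sub w rw) => //; apply: inh_ext => x.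
  by rewrite inh_fixv inhE e.
left; apply: (rho_inj hW); rewrite repr_mx1.
have full : fixv rho w = fullv.
  by apply/eqP; rewrite eqEdim subvf dim_cV /= -[X in (X <= _)%N]dH.
apply: mx_ext => i _; rewrite mul1mx; apply: (elimT (fixvP _ _ _)).
by rewrite full memvf.
Qed.
Section Lift.
Variables (R : comNzRingType) (S : algType R) (phi : {rmorphism A -> R}).
Variables (iw : gT -> S) (ie : hyp rho -> S).
Hypothesis br : brauer_rel hW (phi (delta rho)) (phi (mu s1)) (phi (mu s2)) iw ie.
Let f : {rmorphism A -> S} := GRing.RMorphism.clone _ _ (GRing.in_alg S \o phi) _.
Let gen (x : brGen rho) : S := match x with gw w => iw w | ge H => ie H end.
Let f_central a s : f a * s = s * f a.
Proof. by rewrite /= -scalerAl -scalerAr mul1r mulr1. Qed.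
Let gen_rel t u : br_rel t u -> peval f gen t = peval f gen u.
Proof.
case=> {t u} /=.
- by rewrite rmorph1 scale1r (br_iw1 br).
- by move=> u w; rewrite (br_iwM br).
- by move=> H; rewrite (br_ee br) -scalerAl mul1r.
- move=> w H; rewrite -haE (br_we br) -mulrA -(br_iwM br) mulgV (br_iw1 br).
  exact: mulr1.
- move=> w H /fix_hyp[->|[s <- <-]]; last exact: (br_fix br).
  by rewrite (br_iw1 br) mul1r.
- by move=> H G; rewrite -trE; exact: (br_comm br).
move=> H G HG nt; have GH : nonp G H by rewrite (nonp_sym hW) nonpE HG.
rewrite (br_non br GH).
have -> : peval f gen (\big[@Add _ _/Cst 0]_(s : refl rho | hact (val s) G == H)
    Mul (Mul (Cst (mu s)) (Gen (gw rho (val s)))) (Gen (ge G))) =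
  \sum_(s : refl rho | ha (val s) G == H) phi (mu s) *: (iw (val s) * ie G).
  rewrite (big_morph (peval f gen) (id1 := 0) (op1 := +%R)) //=; last first.
    by rewrite rmorph0 scale0r.
  rewrite (eq_bigl (fun s => ha (val s) G == H)) => [|s]; last by rewrite haE.
  by apply: eq_bigr => s _; rewrite -!scalerAl mul1r.
rewrite (sum_refl hW _ GH) mulrDl -!scalerAl.
by rewrite (@mu_cls (rf hW true G H) s1) ?(@mu_cls (rf hW false G H) s2) ?cls_rf ?cs1 ?cs2.
Qed.
Definition blift : Br rho -> S := plift f gen.
Let bliftE t : blift (ptm _ t) = peval f gen t.
Proof. exact: pliftE. Qed.
Lemma blift_w w : blift (brw rho w) = iw w. Proof. exact: bliftE. Qed.
Lemma blift_e H : blift (bre H) = ie H. Proof. exact: bliftE. Qed.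
Lemma bliftD : {morph blift : x y / x + y}.
Proof. by elim/ptmW=> t; elim/ptmW=> u; rewrite -ptmD !bliftE. Qed.
Lemma bliftM : {morph blift : x y / x * y}.
Proof. by elim/ptmW=> t; elim/ptmW=> u; rewrite -ptmM !bliftE. Qed.
Lemma bliftZ a x : blift (a *: x) = phi a *: blift x.
Proof. by elim/ptmW: x => t; rewrite -ptm_CstM !bliftE /= -scalerAl mul1r. Qed.
Lemma blift1 : blift 1 = 1.
Proof. by rewrite -brw1 blift_w (br_iw1 br). Qed.
Lemma blift_eB B : blift (breB B) = eB ie B.
Proof.
rewrite /breB /eB (big_morph blift bliftM blift1).
by apply: eq_bigr => H _; exact: blift_e.
Qed.
End Lift.

Section ScalarLift.
Variables (R R' : comNzRingType) (phi : {rmorphism A -> R}) (F : {rmorphism R -> R'}).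
Variables (S : algType R') (iw : gT -> S) (ie : hyp rho -> S).
Hypothesis br : brauer_rel hW (F (phi (delta rho))) (F (phi (mu s1))) (F (phi (mu s2))) iw ie.
Let Fphi : {rmorphism A -> R'} := GRing.RMorphism.clone _ _ (F \o phi) _.
Let bl := @blift R' S Fphi iw ie.
Let tl (r : R) (b : Br rho) : S := F r *: bl b.
Let tlDl x x' y : tl (x + x') y = tl x y + tl x' y.
Proof. by rewrite /tl rmorphD scalerDl. Qed.
Let tlDr x y y' : tl x (y + y') = tl x y + tl x y'.
Proof. by rewrite /tl /bl (bliftD (phi := Fphi) br) scalerDr. Qed.
Let tlbal x a y : tl (x * phi a) y = tl x (a *: y).
Proof. by rewrite /tl /bl (bliftZ (phi := Fphi) br) rmorphM scalerA. Qed.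
(** The scalars are pushed along F, so that an algebra over R acts on sectors defined over a
    field. *)
Definition brlift (u : BrR phi) : S := tlift tl u.
Lemma brliftD : {morph brlift : x y / x + y}.
Proof. by move=> u v; exact: (tliftD tlDl tlDr tlbal). Qed.
Lemma brlift0 : brlift 0 = 0.
Proof. exact: (tlift0 tlDl tlDr tlbal). Qed.
Lemma brliftZ c b : brlift (c *: toBrR phi b) = F c *: bl b.
Proof. by rewrite -sctensE; exact: (tlift_tens tlDl tlDr tlbal). Qed.
Lemma brlift_sum (I : Type) (s : seq I) (c : I -> R) (w : I -> gT) (B : I -> {set hyp rho}) :
  brlift (\sum_(p <- s) c p *: toBrR phi (brw rho (w p) * breB (B p))) =
  \sum_(p <- s) F (c p) *: (iw (w p) * eB ie (B p)).
Proof.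
rewrite (big_morph brlift brliftD brlift0); apply: eq_bigr => p _.
rewrite brliftZ /bl (bliftM (phi := Fphi) br) (blift_w (phi := Fphi) br).
by rewrite (blift_eB (phi := Fphi) br).
Qed.
End ScalarLift.

Section BaseChangedAlgebra.
Variables (R : comNzRingType) (phi : {rmorphism A -> R}).
Local Notation tB := (toBrR phi).
Lemma toBrR1 : tB 1 = 1. Proof. by []. Qed.
Lemma toBrRD : {morph tB : x y / x + y}.
Proof. by move=> x y; exact: sctensDr. Qed.
Lemma toBrRM : {morph tB : x y / x * y}.
Proof. by move=> x y; rewrite /toBrR [RHS]scmulE mulr1. Qed.
Lemma toBrRZ a x : tB (a *: x) = phi a *: tB x.
Proof. by rewrite -[RHS]sctensE /toBrR -sctens_bal mul1r. Qed.
Lemma BrR_brauer : brauer_rel hW (phi (delta rho)) (phi (mu s1)) (phi (mu s2))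
  (tB \o brw rho) (tB \o @bre _ _ _ rho).
Proof. exact: (brauer_rel_map toBrR1 toBrRD toBrRM toBrRZ Br_brauer). Qed.
Lemma toBrR_breB B : tB (breB B) = eB (tB \o @bre _ _ _ rho) B.
Proof. exact: (big_morph tB toBrRM toBrR1). Qed.
Lemma toBrR_bas p : tB (brw rho p.2 * breB p.1) =
  bas (tB \o brw rho) (tB \o @bre _ _ _ rho) p.
Proof. by rewrite toBrRM toBrR_breB. Qed.
(** The span contains 1 and is stable under left multiplication by the generators. *)
Lemma BrR_span x : spn (tB \o brw rho) (tB \o @bre _ _ _ rho)
  (lvl (rho := rho) 0) x.
Proof.
pose sp := spn (tB \o brw rho) (tB \o @bre _ _ _ rho) (lvl (rho := rho) 0).
have sp1 : sp 1.
  have -> : 1 = bas (tB \o brw rho) (tB \o @bre _ _ _ rho) (set0, 1%g).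
    by rewrite /bas /= brw1 toBrR1 mul1r /eB big_set0.
  apply: spn_bas; rewrite /lvl /= andbT.
  by apply/tcolP => H G; rewrite inE.
have spt t : forall y, sp y -> sp (tB (ptm _ t) * y).
  elim: t => [a|[w|H]|t IHt u IHu|t IHt u IHu] y sy.
  - by rewrite ptmC toBrRZ toBrR1 -scalerAl mul1r; exact: spnZ.
  - exact: (spn_iw BrR_brauer w sy).
  - exact: (spn_ie BrR_brauer H sy).
  - by rewrite ptmD toBrRD mulrDl; apply: spnD; [exact: IHt | exact: IHu].
  by rewrite ptmM toBrRM -mulrA; apply: IHt; exact: IHu.
elim/scextW: x => [|u v|r b]; [exact: spn0 | exact: spnD |].
rewrite sctensE; apply: spnZ; elim/ptmW: b => t.
by rewrite -[sctens _ _ _]mulr1; exact: spt.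
Qed.
End BaseChangedAlgebra.
End BrauerAlgebra.

(** * Bases after base change *)

Lemma kern_map (C : numClosedFieldType) (g : ST_type) (gT : finGroupType)
    (rho : mx_representation C [set: gT] (ST_rank g)) (hW : is_ST rho)
    (R R' : comNzRingType) (f : {rmorphism R -> R'}) (m : R) B w :
  f (kern hW m B w) = kern hW (f m) B w.
Proof. by rewrite /kern; case: ifP; rewrite ?rmorph0 // /chi rmorphXn. Qed.

Section Independence.
Variables (C : numClosedFieldType) (g : ST_type) (gT : finGroupType).
Variable rho : mx_representation C [set: gT] (ST_rank g).
Hypothesis hW : is_ST rho.
Variables s1 s2 : refl rho.
Hypotheses (cs1 : cls s1 = true) (cs2 : cls s2 = false).
Local Notation A := (parRing rho).
Local Notation tcol := (@transverse_collection C (ST_rank g) gT rho).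
Variables (k K : fieldType) (iota : {rmorphism k -> K}).
Variables (R : comNzRingType) (phi : {rmorphism A -> R}) (F : {rmorphism R -> K}).
Variables (c1 c2 m : k).
Hypotheses (c1E : iota c1 = F (phi (mu s1))) (c2E : iota c2 = F (phi (mu s2))).
Hypotheses (m12 : c1 * m = c2) (m6 : m ^+ 6 = 1).
Hypothesis dtr : ~ algebraicOver iota (F (phi (delta rho))).
Hypothesis ch0 : forall n, (0 < n)%N -> n%:R != 0 :> k.
Let d := F (phi (delta rho)).
Let iN (B : {set hyp rho}) : k := (#|KB B|%:R)^-1.
Lemma card_KB (B : {set hyp rho}) : (0 < #|KB B|)%N.
Proof. by apply/card_gt0P; exists 1%g; exact: group1. Qed.
Let iNK B : iN B * #|KB B|%:R = 1.
Proof. by rewrite mulVf // ch0 // card_KB. Qed.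
Let d0 : d != 0.
Proof.
apply/eqP => d0; apply: dtr; rewrite -/d d0.
by exists 'X; rewrite ?polyX_eq0 // map_polyX rootX.
Qed.
Let cfu : commr_rmorph iota d^-1. Proof. by move=> x; exact: mulrC. Qed.
Let ev : {rmorphism {poly k} -> K} := GRing.RMorphism.clone _ _ (horner_morph cfu) _.
Let evC c : ev c%:P = iota c. Proof. exact: horner_morphC. Qed.
Let evX : d * ev 'X = 1. Proof. by rewrite /= horner_morphX mulfV. Qed.
Let ev_neq0 (p : {poly k}) : p.[0] != 0 -> ev p != 0.
Proof.
move=> p0; apply/eqP => e; apply: dtr; rewrite -[F _]invrK.
apply: algebraic_inv; exists p; last exact/eqP.
by apply: contraNneq p0 => ->; rewrite horner0.
Qed.
(** The relation is evaluated in the sector module of B0, with 'X sent to 1 / delta; transcendence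
    of delta keeps the determinant of [pPhi] nonzero. *)
Lemma BrR_relation (B0 : {set hyp rho}) (I : eqType) (s : seq I) (b : I -> {set hyp rho})
    (w : I -> gT) (c : I -> R) : tcol B0 ->
  (forall p, p \in s -> tcol (b p)) ->
  (forall p, p \in s -> c p != 0 -> (#|B0| <= #|b p|)%N) ->
  \sum_(p <- s) c p *: toBrR phi (brw rho (w p) * breB (b p)) = 0 ->
  forall u, \sum_(p <- s | b p == B0) F (c p) * kern hW (iota m) B0 ((w p)^-1 * u)%g = 0.
Proof.
move=> tB0 st sk s0 u.
have br := fE_brauer hW m12 m6 tB0 (iNK B0) evX.
rewrite /d !evC c1E c2E in br.
have := brlift_sum cs1 cs2 br s c w b; rewrite s0 (brlift0 cs1 cs2 br) => /esym r1.
have sk' p : p \in s -> F (c p) != 0 -> (#|B0| <= #|b p|)%N.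
  by move=> ps Fc; apply: sk => //; apply: contraNneq Fc => ->; rewrite rmorph0.
have := sector_relation (hW := hW) m12 m6 tB0 (iNK B0) ev_neq0 evX st sk' r1 u.
by under eq_bigr do rewrite kern_map evC.
Qed.
End Independence.

(** * Admissibility of every transverse collection *)

Section Admissibility.
Variables (C : numClosedFieldType) (g : ST_type) (gT : finGroupType).
Variable rho : mx_representation C [set: gT] (ST_rank g).
Hypothesis hW : is_ST rho.
Variables s1 s2 : refl rho.
Hypotheses (cs1 : cls s1 = true) (cs2 : cls s2 = false).
Local Notation A := (parRing rho).
Local Notation tcol := (@transverse_collection C (ST_rank g) gT rho).
Variables (k K : fieldType) (iota : {rmorphism k -> K}) (phi : {rmorphism A -> K}).
Variables (c1 c2 m : k).
Hypotheses (c1E : iota c1 = phi (mu s1)) (c2E : iota c2 = phi (mu s2)).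
Hypotheses (m12 : c1 * m = c2) (m6 : m ^+ 6 = 1).
Hypothesis dtr : ~ algebraicOver iota (phi (delta rho)).
Hypothesis ch0 : forall n, (0 < n)%N -> n%:R != 0 :> k.
Let mK : K := iota m.
Let mK6 : mK ^+ 6 = 1. Proof. by rewrite -rmorphXn m6 rmorph1. Qed.
Variable B : {set hyp rho}.
Hypothesis tB : tcol B.
Definition chi_mx (w : gT) : 'M[K]_1 := (chi hW mK B w)%:M.
Lemma chi_repr : mx_repr (Stab_group B) chi_mx.
Proof.
split; first by rewrite /chi_mx (chi1 hW mK6).
by move=> u w uB wB; rewrite /chi_mx (chiM hW mK6 uB wB) scalar_mxM.
Qed.
Definition chi_rep : mx_representation K (Stab_group B) 1 := MxRepresentation chi_repr.
Let iN : K := (#|KB B|%:R)^-1.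
Let iNK : iN * #|KB B|%:R = 1.
Proof.
rewrite mulVf // -(rmorph_nat iota) fmorph_eq0; exact: (ch0 (card_KB B)).
Qed.
Let ke (w : gT) : K := iN * kern hW mK B w.
Let kx : grpalg K gT := [ffun w => ke w].
Let kx_supp : [forall w, (kx w != 0) ==> (w \in Stab_group B)].
Proof.
apply/forallP => w; apply/implyP; rewrite ffunE /ke /kern.
case: ifP => [wK _|_]; last by rewrite mulr0 eqxx.
exact: (KB_stab hW tB wK).
Qed.
Let e : subgrpalg K (Stab_group B) := exist _ kx kx_supp.
Let e_act v : gaact chi_rep e v = v.
Proof.
rewrite /gaact /= (eq_bigr (fun w => (if w \in KB B then iN else 0) *: v)) => [|w wB]; last first.
  rewrite /chi_mx mul_scalar_mx scalerA ffunE /ke /kern; case: ifP => wK; last first.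
    by rewrite mulr0 mul0r.
  by rewrite -mulrA [_ * chi _ _ _ _]mulrC (chiV hW mK6 tB wK) mulr1.
rewrite -scaler_suml -big_mkcondr /=.
rewrite (eq_bigl (fun w => w \in KB B)) => [|w]; last first.
  by rewrite andb_idl //; exact: (KB_stab hW tB).
by rewrite sumr_const -mulr_natr iNK scale1r.
Qed.
(** Take for V the line on which Stab(B) acts by chi_B. The idempotent e of K_B acts on it as 1, so
    x (x) v = xe (x) v; and [BrR_relation] says exactly that xe = 0 when x annihilates e_B. *)
Lemma tcol_admissible : admissible phi B.
Proof.
exists 1%N, chi_rep; split=> // x v; rewrite /annih => ann.
rewrite indact_hat -(e_act v) /indtens -tens_bal.
suff -> : gamul x (val e) = 0 by exact: tens0l.
apply/ffunP => u; rewrite !ffunE /=.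
have r0 : \sum_(w : gT) x w *: toBrR phi (brw rho w * breB B) = 0.
  rewrite -[RHS]ann /KWtoBr mulr_suml; apply: eq_bigr => w _.
  by rewrite -scalerAl toBrRM.
have e0 : \sum_w x w * kern hW mK B (w^-1 * u)%g = 0.
  rewrite -[RHS](BrR_relation (s := index_enum gT) (b := fun=> B) (w := id) (c := x)
    (F := idfun) hW cs1 cs2 c1E c2E m12 m6 dtr ch0 tB (fun _ _ => tB)
    (fun _ _ _ => leqnn _) r0 u).
  by apply: eq_bigl => w; rewrite eqxx.
transitivity (iN * \sum_w x w * kern hW mK B (w^-1 * u)%g); last by rewrite e0 mulr0.
rewrite mulr_sumr; apply: eq_bigr => w _.
by rewrite ffunE /ke mulrCA.
Qed.
End Admissibility.

Section MuClasses.
Variables (C : numClosedFieldType) (g : ST_type) (gT : finGroupType).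
Variable rho : mx_representation C [set: gT] (ST_rank g).
Hypothesis hW : is_ST rho.
(** The root of s is orthogonal to its mirror, and s scales it by its determinant. *)
Lemma distinguished_cls (s : refl rho) : distinguished s -> cls s = true.
Proof.
move=> ds; have [sH sU] := refl_mirror hW s; have := unt_act hW (val s) (hyp_of s).
rewrite sH sU ds.
  move/rt_scaleI => e; apply: (@zc_inj C); rewrite -e.
  by rewrite /zc expr1.
move=> u; rewrite -inh_fixv; have [i ->] := hyP hW (hyp_of s).
rewrite mem_hy rt_hy => /eqP ip0.
apply/matrixP => p q; rewrite !ord1 [RHS]mxE -[LHS]/(ip u _) -ip_conj ip0.
exact: rmorph0.
Qed.
Lemma inv_distinguished_cls (s : refl rho) : inv_distinguished s -> cls s = false.
Proof.
case=> t /distinguished_cls ct st; have := cls_det hW s; have := cls_det hW t.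
rewrite ct => dt; case: (cls s) => // ds.
have := det1 C (ST_rank g); rewrite -(repr_mx1 rho) -(mulgV (val t)) -st rhoM.
rewrite det_mulmx dt ds => e; have := zcN C true; rewrite -e.
by move/(mulfI (zc_neq0 C true))/(@zc_inj C).
Qed.
End MuClasses.

Section BaseChangeBasis.
Variables (C : numClosedFieldType) (g : ST_type) (gT : finGroupType).
Variable rho : mx_representation C [set: gT] (ST_rank g).
Hypothesis hW : is_ST rho.
Local Notation tcol := (@transverse_collection C (ST_rank g) gT rho).
Lemma transversal_uniq (K X : {set gT}) (G : {group gT}) x y : K = G ->
  is_transversal X (lcosets K [set: gT]) [set: gT] ->
  x \in X -> y \in X -> (x^-1 * y)%g \in G -> x = y.
Proof.
move=> -> /and3P[_ _ /forall_inP/(_ (x *: G)%g)].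
have xl : (x *: G)%g \in lcosets G [set: gT] by apply/lcosetsP; exists x; rewrite ?inE.
move/(_ xl)/cards1P => [z zE] xX yX xy.
have : x \in [set z] by rewrite -zE inE xX lcoset_refl.
have : y \in [set z] by rewrite -zE inE yX mem_lcoset.
by rewrite !inE => /eqP-> /eqP->.
Qed.
Variables (R : idomainType) (phi : {rmorphism parRing rho -> R}) (s1 s2 : refl rho).
Hypothesis pr : proper_ring phi.
Hypotheses (ds1 : distinguished s1) (ds2 : inv_distinguished s2).
Hypothesis ratio6 : phi (mu_ratio s1 s2) ^+ 6 = 1.
Variable phiK : {rmorphism parRing rho -> {fraction R}}.
Hypothesis phiKE : forall a, phiK a = tofrac (phi a).
Variable X : {set hyp rho} -> {set gT}.
Hypothesis XP : forall B, B \in Cadm phiK ->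
  is_transversal (X B) (lcosets (KB B) [set: gT]) [set: gT].
Let cs1 := distinguished_cls hW ds1.
Let cs2 := inv_distinguished_cls hW ds2.
Lemma mu_phi_ratio : phi (mu s1) = phi (mu s2) * phi (mu_ratio s1 s2).
Proof.
rewrite /mu_ratio rmorphM mulrCA -rmorphM [phi (_ * _)](_ : _ = 1) ?mulr1 //.
by rewrite muVK rmorph1.
Qed.
(** The elements mu_1, mu_2 and m = mu_2 / mu_1 are found in the subfield k_R, over which delta is
    transcendental. *)
Lemma proper_setup : exists (k : fieldType) (iota : {rmorphism k -> {fraction R}})
    (c1 c2 m : k),
  [/\ iota c1 = tofrac (phi (mu s1)), iota c2 = tofrac (phi (mu s2)),
      c1 * m = c2, m ^+ 6 = 1 & ~ algebraicOver iota (tofrac (phi (delta rho)))] /\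
  forall n, (0 < n)%N -> n%:R != 0 :> k.
Proof.
have [ch [k [iota [muk _ dtr _]]]] := pr.
have [c1 c1E] := muk s1; have [c2 c2E] := muk s2.
have tV (s : refl rho) : tofrac (phi (mu s)) != 0.
  rewrite tofrac_eq0; apply/eqP => e.
  have := congr1 phi (muVK s); rewrite rmorphM e mul0r rmorph1 => /esym/eqP.
  by rewrite oner_eq0.
have c10 : c1 != 0 by rewrite -(fmorph_eq0 iota) c1E.
have c20 : c2 != 0 by rewrite -(fmorph_eq0 iota) c2E.
exists k, iota, c1, c2, (c2 / c1); split; last first.
  move=> n n0; rewrite -(fmorph_eq0 iota) rmorph_nat -(rmorph_nat (@tofrac R)) tofrac_eq0.
  by rewrite ((pcharf0P R).1 ch) -lt0n.
have r6 : (c1 / c2) ^+ 6 = 1.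
  apply: (fmorph_inj iota); rewrite rmorphXn rmorphM fmorphV c1E c2E rmorph1.
  rewrite mu_phi_ratio rmorphM mulrAC (mulfV (tV s2)) mul1r -rmorphXn ratio6.
  exact: rmorph1.
split=> //; first by rewrite mulrC divfK.
by rewrite -invf_div exprVn r6 invr1.
Qed.
Lemma CadmE B : (B \in Cadm phiK) = tcol B.
Proof.
rewrite inE; apply: andb_idr => tB; apply/asboolP.
have [k [iota [c1 [c2 [m [[e1 e2 m12 m6 dtr] ch0]]]]]] := proper_setup.
rewrite -!phiKE in e1 e2 dtr.
exact: (tcol_admissible hW cs1 cs2 e1 e2 m12 m6 dtr ch0 tB).
Qed.
Let D (p : {set hyp rho} * gT) := p.1 \in Cadm phiK /\ p.2 \in X p.1.
(** By induction on the size of B, the coefficients on smaller collections already vanish;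
    [BrR_relation] at u = w then isolates one coefficient, since distinct elements of a transversal
    lie in distinct cosets of K_B. *)
Lemma basis_free (s : seq ({set hyp rho} * gT)) (c : {set hyp rho} * gT -> R) :
  uniq s -> (forall i, i \in s -> D i) ->
  \sum_(i <- s) c i *: toBrR phi (brw rho i.2 * breB i.1) = 0 ->
  forall i, i \in s -> c i = 0.
Proof.
move=> us sD s0; have [k [iota [c1 [c2 [m [[e1 e2 m12 m6 dtr] ch0]]]]]] := proper_setup.
suff h n : forall i, i \in s -> (#|i.1| <= n)%N -> c i = 0.
  by move=> i si; exact: (h _ i si (leqnn _)).
elim/ltn_ind: n => n IHn i si sn.
have [B_adm xX] := sD i si; have tB : tcol i.1 by rewrite -CadmE.
have st p : p \in s -> tcol p.1 by move=> ps; rewrite -CadmE; case: (sD p ps).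
have sk p : p \in s -> c p != 0 -> (#|i.1| <= #|p.1|)%N.
  move=> ps; apply: contraR; rewrite -ltnNge => lt.
  by rewrite (IHn #|p.1| (leq_trans lt sn) p ps (leqnn _)).
pose tofracR : {rmorphism R -> {fraction R}} := GRing.RMorphism.clone _ _ (@tofrac R) _.
have mK6 : (iota m) ^+ 6 = 1 by rewrite -rmorphXn m6 rmorph1.
have := BrR_relation (F := tofracR) (w := snd) hW cs1 cs2 e1 e2 m12 m6 dtr ch0 tB st sk s0 i.2.
rewrite big_mkcond (bigD1_seq i si us) /= eqxx big1_seq ?addr0 => [|p /andP[pi ps]].
  rewrite mulVg /kern group1 invg1 (chi1 hW mK6) mulr1.
  by move/eqP; rewrite tofrac_eq0 => /eqP.
case: eqP => // pB; rewrite /kern; case: ifP => pK; last by rewrite mulr0.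
have pX : p.2 \in X i.1 by rewrite -pB; case: (sD p ps).
case/eqP: pi; rewrite (surjective_pairing p) (surjective_pairing i) pB; congr (_, _).
exact: (transversal_uniq (erefl : KB i.1 = <<_>>%G) (XP B_adm) pX xX pK).
Qed.
Lemma basis_span (x : BrR phi) : exists (s : seq ({set hyp rho} * gT))
    (c : {set hyp rho} * gT -> R), (forall i, i \in s -> D i) /\
  x = \sum_(i <- s) c i *: toBrR phi (brw rho i.2 * breB i.1).
Proof.
(* The fifth power is the inverse of mu_1 / mu_2, as the sixth one is 1. *)
pose m := phi (mu_ratio s1 s2) ^+ 5.
have m12 : phi (mu s1) * m = phi (mu s2).
  by rewrite mu_phi_ratio -mulrA -exprS ratio6 mulr1.
have m6 : m ^+ 6 = 1 by rewrite -exprM mulnC exprM ratio6 expr1n.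
have d1 : phi (delta rho) * phi (ptm _ (Gen (gdeltaV rho))) = 1.
  by rewrite -rmorphM deltaVK rmorph1.
have mV (s : refl rho) : phi (mu s) * phi (muV s) = 1 by rewrite -rmorphM muVK rmorph1.
have XP' (B : {set hyp rho}) : tcol B ->
    is_transversal (X B) (lcosets (KB B) [set: gT]) [set: gT].
  by rewrite -CadmE; exact: XP.
have [c ->] := br_span (BrR_brauer hW cs1 cs2 phi) d1 (mV s1) (mV s2) m12 m6 XP'
  (BrR_span hW cs1 cs2 x).
exists [seq p <- index_enum _ | tcol p.1 && (p.2 \in X p.1)], c; split.
  by move=> p; rewrite mem_filter /D CadmE => /andP[/andP[]].
by rewrite big_filter; apply: eq_bigr => p _; rewrite toBrR_bas.
Qed.
Lemma base_change_basis : is_basis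
  (fun p : {set hyp rho} * gT => p.1 \in Cadm phiK /\ p.2 \in X p.1)
  (fun p => toBrR phi (brw rho p.2 * breB p.1)).
Proof. by split; [exact: basis_free | exact: basis_span]. Qed.
End BaseChangeBasis.

(** * Torsion *)

Section Frame.
(** The first [ST_rank g] mirrors are the coordinate hyperplanes. The collection used is the frame
    without its last mirror P, which is the only mirror transverse to all the others of the
    frame. *)
Definition chk_frame (g : ST_type) (T : table) : bool :=
  let n := ST_rank g in let N := nmir g in
  [&& alln n (fun i => alln n (fun j => (i == j) || og T i j)),
      has (fun q => [&& tnon T 0 q, tnon T 1 q & alln n.-1 (fun i => (i < 2)%N || og T i q)])
        (iota 0 N) &
      alln N (fun v => alln n.-1 (fun i => og T v i) ==> (v == n.-1))].
Lemma chk_frameT g : chk_frame g (stab g).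
Proof. by rewrite stabE; case: g; vm_compute. Qed.

Variables (C : numClosedFieldType) (g : ST_type) (gT : finGroupType).
Variable rho : mx_representation C [set: gT] (ST_rank g).
Hypothesis hW : is_ST rho.
Local Notation tcol := (@transverse_collection C (ST_rank g) gT rho).
Local Notation n := (ST_rank g).
Variant frame_spec : Prop :=
| FrameSpec (B : {set hyp rho}) (X Y G P : hyp rho) of tcol B & X \in B & Y \in B &
    X != Y & nonp X G & nonp Y G &
    (forall H, H \in B -> H != X -> H != Y -> tr H G) &
    (forall V, (forall H, H \in B -> tr V H) <-> V = P).
Lemma frame_exists : frame_spec.
Proof.
have /and3P[/allnP o /hasP[q qN qc] /allnP u] := chk_frameT g.
move: qN qc; rewrite mem_iota => qN /and3P[q0 q1 /allnP q2].
have nN i : (i < n)%N -> (i < nmir g)%N by case: (g) => /leq_trans; apply.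
have n2 : (2 < n)%N by case: (g).
have n1N i : (i < n.-1)%N -> (i < nmir g)%N.
  by move=> i1; apply: nN; apply: leq_trans i1 (leq_pred _).
pose h i (iN : (i < nmir g)%N) := hy hW (Ordinal iN).
pose B := [set hy hW i | i : 'I_(nmir g) & (i < n.-1)%N].
have BP H : H \in B -> exists2 i : 'I_(nmir g), (i < n.-1)%N & H = hy hW i.
  by case/imsetP => i; rewrite inE; exists i.
have memB (i : 'I_(nmir g)) : (i < n.-1)%N -> hy hW i \in B.
  by move=> i1; apply/imsetP; exists i; rewrite ?inE.
have lt0 : (0 < n.-1)%N by case: (g).
have lt1 : (1 < n.-1)%N by case: (g).
have ltl : (n.-1 < n)%N by case: (g).
pose i0 := Ordinal (n1N _ lt0); pose i1 := Ordinal (n1N _ lt1).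
pose iq := Ordinal (qN : (q < nmir g)%N); pose il := Ordinal (nN _ ltl).
apply: (@FrameSpec B (hy hW i0) (hy hW i1) (hy hW iq) (hy hW il)).
- apply/tcolP => H K /BP[i i_lt ->] /BP[j j_lt ->] ne; rewrite tr_hy.
  have := o _ (leq_trans i_lt (leq_pred _)) => /allnP/(_ _ (leq_trans j_lt (leq_pred _))).
  by case: eqP => // e; case/eqP: ne; congr hy; apply: val_inj.
- exact: memB.
- exact: memB.
- by rewrite (inj_eq (@hy_inj _ _ _ _ hW)).
- by rewrite nonp_hy.
- by rewrite nonp_hy.
- move=> H /BP[i i_lt ->]; rewrite !(inj_eq (@hy_inj _ _ _ _ hW)) tr_hy => a0 a1.
  have /orP[|//] := q2 i i_lt.
  rewrite ltnS leq_eqVlt ltnS leqn0 => /orP[e|e]; first by case/negP: a1.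
  by case/negP: a0.
move=> V; have [v ->] := hyP hW V; split => [a|->].
  have := u v (ltn_ord v) => /implyP/(_ _)/eqP-e.
  congr hy; apply: val_inj; apply: e; apply/allnP => i i_lt.
  by have := a _ (memB (Ordinal (n1N _ i_lt)) i_lt); rewrite tr_hy.
move=> H /BP[i i_lt ->]; rewrite tr_hy.
have := o _ ltl => /allnP/(_ _ (leq_trans i_lt (leq_pred _))).
by rewrite eqn_leq leqNgt i_lt.
Qed.
End Frame.

Section Torsion.
Variables (C : numClosedFieldType) (g : ST_type) (gT : finGroupType).
Variable rho : mx_representation C [set: gT] (ST_rank g).
Hypothesis hW : is_ST rho.
Local Notation tcol := (@transverse_collection C (ST_rank g) gT rho).
Variables (R : comNzRingType) (A : algType R) (d m1 m2 : R).
Variables (iw : gT -> A) (ie : hyp rho -> A).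
Hypothesis br : brauer_rel hW d m1 m2 iw ie.
Variables (B : {set hyp rho}) (X Y G P : hyp rho).
Hypotheses (tB : tcol B) (XB : X \in B) (YB : Y \in B) (XY : X != Y).
Hypotheses (XG : nonp X G) (YG : nonp Y G).
Hypothesis oth : forall H, H \in B -> H != X -> H != Y -> tr H G.
Hypothesis PU : forall V, (forall H, H \in B -> tr V H) <-> V = P.
Definition tors : A := d *: eB ie B - ie P * eB ie B.
(** In [br_pair] uniqueness of P gives e_Q s = s e_P and e_Q t = t e_P, so that the equation d y =
    e_Q y separates into an s part and a t part. *)
Lemma tors_rel : m1 *: (iw (val (rf hW true X G)) * tors) =
  m2 *: (iw (val (rf hW false Y G)) * tors).
Proof.
pose s := rf hW true X G; pose t := rf hW false Y G.
pose Q := ha (val (rf hW false X G)) Y.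
have E : d *: (m1 *: (iw (val s) * eB ie B) - m2 *: (iw (val t) * eB ie B)) =
    ie Q * (m1 *: (iw (val s) * eB ie B) - m2 *: (iw (val t) * eB ie B)).
  exact: (br_pair br true tB XB YB XY XG YG).
have gp := genpair2 hW tB true XB YB XY XG YG oth; rewrite -/s -/t in gp.
have st : Defs.setact (val s) B = Defs.setact (val t) B by case/and3P: gp => /eqP.
have QT H : H \in Defs.setact (val s) B -> tr Q H :=
  Q_tr (hW := hW) (c := true) tB XB YB XY XG YG oth (H := H).
have QP (r : refl rho) : Defs.setact (val r) B = Defs.setact (val s) B ->
    ie Q * iw (val r) = iw (val r) * ie P.
  move=> rs; have <- : ha (val r)^-1%g Q = P.
    apply: (proj1 (PU _)) => H HB; rewrite -(tr_act hW (val r)) haKV.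
    by apply: QT; rewrite -rs mem_sa.
  by rewrite (br_we br) haKV.
move: E; rewrite mulrBr -!scalerAr !(mulrA (ie Q) (iw _)) (QP s erefl) (QP t (esym st)).
rewrite scalerBr /tors !mulrBr !scalerBr -!scalerAr !scalerA ![_ * d]mulrC !mulrA.
have sw (a b c e : A) : a - b = c - e -> a - c = b - e.
  move/eqP; rewrite subr_eq => /eqP->; apply/eqP.
  by rewrite subr_eq addrC -addrA [- e + c]addrC.
exact: sw.
Qed.
(** With k = t^-1 s, the relation mu_1 k f = mu_2 f is iterated |W| times, and k^|W| = 1. *)
Lemma tors_torsion : (m1 ^+ #|gT| - m2 ^+ #|gT|) *: tors = 0.
Proof.
pose k := ((val (rf hW false Y G))^-1 * val (rf hW true X G))%g.
have st : m1 *: (iw k * tors) = m2 *: tors.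
  rewrite /k (br_iwM br) -mulrA scalerAr tors_rel -scalerAr mulrA -(br_iwM br) mulVg.
  by rewrite (br_iw1 br) mul1r.
have stn n : m1 ^+ n *: (iw (k ^+ n)%g * tors) = m2 ^+ n *: tors.
  elim: n => [|n IHn]; first by rewrite expg0 (br_iw1 br) mul1r.
  rewrite expgSr exprSr (br_iwM br) -mulrA -scalerA scalerAr st -scalerAr scalerA.
  by rewrite mulrC -scalerA IHn scalerA -exprS.
have kN : (k ^+ #|gT| = 1)%g.
  have /dvdnP[q] : (#[k]%g %| #|[set: gT]|)%N := cardSg (subsetT <[k]>%G).
  by rewrite cardsT => ->; rewrite mulnC expgM expg_order expg1n.
have := stn #|gT|; rewrite kN (br_iw1 br) mul1r => e.
by rewrite scalerBl e subrr.
Qed.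
End Torsion.

(** * Specialisations of the parameters and failure of freeness *)

Section ParameterLift.
Variables (C : numClosedFieldType) (g : ST_type) (gT : finGroupType).
Variable rho : mx_representation C [set: gT] (ST_rank g).
Hypothesis hW : is_ST rho.
Variables (R : comNzRingType) (a aV : R).
Hypothesis aK : a * aV = 1.
Let gen (x : parGen rho) : R :=
  match x with
  | gmu s => if cls s then a else 1
  | gmuV s => if cls s then aV else 1
  | _ => 1
  end.
Let gen_rel t u : par_rel t u -> peval intr gen t = peval intr gen u.
Proof.
case=> {t u} //=; try by move=> *; rewrite ?mulr1 // mulrC.
- by move=> s; case: (cls s); rewrite ?mulr1.
move=> s s' /imsetP[x _ e].
suff -> : cls s = cls s' by [].
have -> : s' = cjr x^-1%g s.
  by apply: val_inj; rewrite val_cjr [LHS]e conjgE invgK mulgA.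
by rewrite cls_cjr.
Qed.
Definition par_lift (x : parRing rho) : R := plift intr gen x.
Let par_liftE t : par_lift (ptm _ t) = peval intr gen t.
Proof. by apply: pliftE => // z x; exact: mulrC. Qed.
Lemma par_lift_zmod : zmod_morphism par_lift.
Proof.
have D : {morph par_lift : x y / x + y}.
  by elim/ptmW=> t; elim/ptmW=> u; rewrite -ptmD !par_liftE.
move=> x y; apply: (@addIr _ (par_lift y)).
by rewrite -D !subrK.
Qed.
Lemma par_lift_monoid : monoid_morphism par_lift.
Proof.
split; first by rewrite [LHS](par_liftE (Cst 1)).
by elim/ptmW=> t; elim/ptmW=> u; rewrite -ptmM !par_liftE.
Qed.
Definition par_morph : {rmorphism parRing rho -> R} := HB.pack par_lift
  (GRing.isZmodMorphism.Build _ _ par_lift par_lift_zmod)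
  (GRing.isMonoidMorphism.Build _ _ par_lift par_lift_monoid).
Lemma par_morph_gen x : par_morph (ptm _ (Gen x)) =
  match x with
  | gmu s => if cls s then a else 1
  | gmuV s => if cls s then aV else 1
  | _ => 1
  end.
Proof. exact: par_liftE. Qed.
Lemma par_morph_cst z : par_morph (ptm _ (Cst z)) = z%:~R.
Proof. exact: par_liftE. Qed.
End ParameterLift.

Section NotFree.
Variables (C : numClosedFieldType) (g : ST_type) (gT : finGroupType).
Variable rho : mx_representation C [set: gT] (ST_rank g).
Hypothesis hW : is_ST rho.
Local Notation A := (parRing rho).
Local Notation tcol := (@transverse_collection C (ST_rank g) gT rho).
Variable p : nat.
Hypotheses (pp : prime p) (gp : (#|gT| < p)%N).
Let q : rat := p.+1%:R.
Let q0 : q != 0. Proof. by rewrite pnatr_eq0. Qed.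
Let qV : q * q^-1 = 1. Proof. exact: mulfV. Qed.
Let oV : 1 * 1 = 1 :> 'F_p. Proof. exact: mulr1. Qed.
Let Psi : {rmorphism A -> rat} := par_morph rho qV.
Let psi : {rmorphism A -> 'F_p} := par_morph rho oV.
Let p0 : p%:R = 0 :> 'F_p.
Proof. exact: pcharf0 (pchar_Fp pp). Qed.
Let pS : p.+1%:Z%:~R = 1 :> 'F_p. Proof. by rewrite -pmulrn mulrS p0 addr0. Qed.
Let qE : p.+1%:Z%:~R = q. Proof. by rewrite -pmulrn. Qed.
(* Both specialisations come from Z[1/(p+1)], one by inclusion and one by
   reduction modulo p. *)
Lemma specialisations (a : A) : exists (n : int) (e : nat),
  Psi a * q ^+ e = n%:~R /\ psi a = n%:~R.
Proof.
elim/ptmW: a => t; elim: t => [z|x|t [n [e [h1 h2]]] u [n' [e' [h1' h2']]]|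
    t [n [e [h1 h2]]] u [n' [e' [h1' h2']]]].
- by exists z, 0%N; rewrite expr0 mulr1; split; exact: par_morph_cst.
- have one : exists (n : int) (e : nat), 1 * q ^+ e = n%:~R /\ 1 = n%:~R :> 'F_p.
    by exists 1, 0%N; rewrite expr0 mulr1.
  rewrite !par_morph_gen; case: x => [s|s||] //; case: (cls s) => //.
    exists p.+1, 0%N; rewrite expr0 mulr1; split=> //.
  by exists 1, 1%N; rewrite expr1 mulVf.
- exists (n * p.+1%:Z ^+ e' + n' * p.+1%:Z ^+ e), (e + e')%N.
  rewrite ptmD (rmorphD Psi) (rmorphD psi).
  move: (Psi (ptm _ t)) (Psi (ptm _ u)) (psi (ptm _ t)) (psi (ptm _ u)) h1 h1' h2 h2'.
  move=> x y x' y' h1 h1' h2 h2'; rewrite !rmorphD !rmorphM !rmorphXn /=.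
  rewrite -h1 -h1' -h2 -h2' qE pS !expr1n !mulr1; split=> //.
  by rewrite exprD; ring.
exists (n * n'), (e + e')%N; rewrite ptmM (rmorphM Psi) (rmorphM psi) !intrM -h1 -h1' h2 h2'.
by split; rewrite // exprD; ring.
Qed.
Lemma specialisation_eq0 a : Psi a = 0 -> psi a = 0.
Proof.
have [n [e [+ ->]]] := specialisations a; move=> /esym + P0; rewrite P0 mul0r => /eqP.
by rewrite intr_eq0 => /eqP->.
Qed.
(** At mu_1 = p + 1 and mu_2 = 1 the factor (p + 1)^N - 1 is a nonzero rational, so [Psi a]
    vanishes, and [psi a] with it. *)
Lemma torsion_coeff (s1 s2 : refl rho) a : cls s1 = true -> cls s2 = false ->
  (mu s1 ^+ #|gT| - mu s2 ^+ #|gT|) * a = 0 -> psi a = 0.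
Proof.
move=> cs1 cs2 /(congr1 Psi); rewrite rmorph0 rmorphM rmorphB !rmorphXn.
have -> : Psi (mu s1) = q by rewrite [LHS]par_morph_gen cs1.
have -> : Psi (mu s2) = 1 by rewrite [LHS]par_morph_gen cs2.
rewrite expr1n => /eqP; rewrite mulf_eq0 => /orP[|/eqP]; last exact: specialisation_eq0.
have -> : q ^+ #|gT| = (p.+1 ^ #|gT|)%N%:R by rewrite natrX.
rewrite subr_eq0 -[1]/(1%:R) eqr_nat => /eqP e.
have g0 : (0 < #|gT|)%N by apply/card_gt0P; exists 1%g.
have : (1 < p.+1 ^ #|gT|)%N by rewrite -(exp1n #|gT|) ltn_exp2r // ltnS prime_gt0.
by rewrite e.
Qed.

Variables (B : {set hyp rho}) (P : hyp rho).
Hypotheses (tB : tcol B) (PU : forall H, H \in B -> tr P H).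
(** On the sector of B over F_p, e_B acts as 1 and e_P as 0, so f acts as 1. The sector exists
    because p > |W| makes |K_B| invertible. *)
Lemma tors_lift_neq0 (s1 s2 : refl rho) : cls s1 = true -> cls s2 = false ->
  exists (S : algType 'F_p) (bl : Br rho -> S),
  [/\ {morph bl : x y / x + y}, forall a x, bl (a *: x) = psi a *: bl x &
      bl (tors (delta rho) (@bre _ _ _ rho) B P) != 0].
Proof.
move=> cs1 cs2; pose iN : 'F_p := (#|KB B|%:R)^-1.
have iNK : iN * #|KB B|%:R = 1.
  rewrite mulVf // -(dvdn_pcharf (pchar_Fp pp)); apply/negP => /dvdn_leq.
  rewrite card_KB // => /(_ isT); apply/negP; rewrite -ltnNge.
  exact: leq_ltn_trans (max_card _) gp.
have m6 : (1 : 'F_p) ^+ 6 = 1 by rewrite expr1n.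
have br := kE_brauer hW oV m6 tB iNK.
have e1 : psi (delta rho) = 1 by exact: par_morph_gen.
have e2 s : psi (mu s) = 1 by rewrite [LHS]par_morph_gen; case: (cls s).
have br' : brauer_rel hW (psi (delta rho)) (psi (mu s1)) (psi (mu s2))
    (@kL gT _) (kE hW 1 1 1 B iN) by rewrite e1 !e2.
exists 'M['F_p]_(#|gT|.-1.+1), (blift psi (@kL gT _) (kE hW 1 1 1 B iN)); split.
- exact: (bliftD cs1 cs2 br').
- exact: (bliftZ cs1 cs2 br').
set bl := blift _ _ _; apply: contraTneq isT => tors0.
have po := kpi_orth hW m6 tB iNK.
have blD : {morph bl : x y / x + y} := bliftD cs1 cs2 br'.
have blM : {morph bl : x y / x * y} := bliftM cs1 cs2 br'.
have blZ a x : bl (a *: x) = psi a *: bl x := bliftZ cs1 cs2 br' a x.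
have blN x : bl (- x) = - bl x.
  by rewrite -[- x]scaleN1r blZ rmorphN1 scaleN1r.
have tE : bl (tors (delta rho) (@bre _ _ _ rho) B P) =
    eB (kE hW 1 1 1 B iN) B - kE hW 1 1 1 B iN P * eB (kE hW 1 1 1 B iN) B.
  rewrite /tors blD blN blZ blM e1 scale1r.
  by rewrite [bl (bre P)](blift_e cs1 cs2 br') [bl (eB _ _)](blift_eB cs1 cs2 br').
have eBpi : eB (kE hW 1 1 1 B iN) B * kpi hW 1 B iN B = kpi hW 1 B iN B.
  rewrite /eB; elim/big_rec: _ => [|H x HB IHx]; first by rewrite mul1r.
  by rewrite -mulrA IHx [_ * _](sE_in hW 1 1 1 (@kL gT _) po) // scale1r.
have PB : P \notin B by apply/negP => /PU; rewrite (perp_irr hW).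
have HP H : H \in B -> tr H P by move=> HB; rewrite (perp_sym hW); exact: PU.
have := congr1 (fun x => x * kpi hW 1 B iN B) (esym tors0).
rewrite tE mulrBl -mulrA eBpi mul0r [_ * kpi _ _ _ _ _](sE_0 hW 1 1 1 (@kL gT _) po PB HP) subr0.
have [h _ hK] := gel_bij gT.
move/matrixP/(_ (h 1%g) (h 1%g)); rewrite !mxE !hK sa1 eqxx mulVg /kern group1 invg1.
rewrite (chi1 hW m6) mulr1 => iN0; have := iNK; rewrite -iN0 mul0r => /eqP.
by rewrite eq_sym oner_eq0.
Qed.
End NotFree.

Lemma Br_not_free (C : numClosedFieldType) (g : ST_type) (gT : finGroupType)
    (rho : mx_representation C [set: gT] (ST_rank g)) (hW : is_ST rho) :
  ~ is_free (Br rho).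
Proof.
move=> [I [b [bfree bspan]]].
have [p gp pp] := prime_above #|gT|.
have [B X Y G P tB XB YB XY XG YG oth PU] := frame_exists hW.
have cs1 : cls (rf hW true X G) = true by exact: cls_rf.
have cs2 : cls (rf hW false X G) = false by exact: cls_rf.
have br := Br_brauer hW cs1 cs2.
set f := tors (delta rho) (@bre _ _ _ rho) B P.
have f0 := tors_torsion br tB XB YB XY XG YG oth PU; rewrite -/f in f0.
set kap := (_ - _) in f0.
have [S [bl [blD blZ blf]]] := tors_lift_neq0 hW pp gp tB (proj2 (PU P) erefl) cs1 cs2.
have [s [c [_ fE]]] := bspan f.
(* Repetitions in [s] are merged, since independence is stated for duplicate-free sequences. *)
pose a i := c i *+ count_mem i s.
have fE' : f = \sum_(i <- undup s) a i *: b i.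
  rewrite fE -big_undup_iterop_count; apply: eq_bigr => i _.
  by rewrite -[LHS]/((c i *: b i) *+ count_mem i s) scalerMnl.
have a0 i : i \in undup s -> kap * a i = 0.
  apply: (bfree (undup s) (fun i => kap * a i) (undup_uniq s)) => //.
  rewrite -[RHS]f0 fE' scaler_sumr; apply: eq_bigr => j _; exact/esym/scalerA.
case/eqP: blf; rewrite -/f fE' big_seq.
have bl0 : bl 0 = 0 by rewrite -[0 in LHS](scale0r (0 : Br rho)) blZ rmorph0 scale0r.
rewrite (big_morph bl blD bl0) big1 // => i /a0 /(torsion_coeff pp cs1 cs2) ai.
by rewrite blZ [X in X *: _]ai scale0r.
Qed.

From mathcomp Require Import reals complex.
Local Open Scope complex_scope.

Theorem proposition7p11 (R0 : realType) (g : ST_type) (gT : finGroupType)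
    (rho : mx_representation R0[i] [set: gT] (ST_rank g)) (hW : is_ST rho) :
  ~ is_free (Br rho) /\
  (forall (R : idomainType) (phi : {rmorphism parRing rho -> R})
      (s1 s2 : refl rho),
    proper_ring phi ->
    distinguished s1 -> inv_distinguished s2 ->
    phi (mu_ratio s1 s2) ^+ 6 = 1 ->
    let phiK : {rmorphism parRing rho -> {fraction R}} :=
      GRing.RMorphism.clone _ _ (@tofrac R \o phi) _ in
    forall X : {set hyp rho} -> {set gT},
      (forall B, B \in Cadm phiK ->
         is_transversal (X B) (lcosets (KB B) [set: gT]) [set: gT]) ->
      is_basis (fun p : {set hyp rho} * gT =>
                  p.1 \in Cadm phiK /\ p.2 \in X p.1)
               (fun p => toBrR phi (brw rho p.2 * breB p.1))).
Proof.
split; first exact: Br_not_free.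
move=> R phi s1 s2 pr ds1 ds2 r6 phiK X XP.
exact: (base_change_basis hW pr ds1 ds2 r6 (phiK := phiK) (fun=> erefl) XP).
Qed.
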